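(* Let $\eta$ be a Poisson process with $\sigma$-finite intensity measure $L$ on a measurable space $(\mathbb{X},\mathcal{X})$, let $\ell\in\mathbb{N}$, and let $h:\mathbb{X}^\ell\to\{0,1\}$ be symmetric, measurable and integrable with respect to $L^\ell$. Let $$ S=\frac1{\ell!}\sum_{(x_1,\dots,x_\ell)\in\eta_{\neq}^\ell}h(x_1,\dots,x_\ell),\qquad \lambda=\mathbb{E}[S]=\frac1{\ell!}\int_{\mathbb{X}^\ell}h\,dL^\ell, $$ and $$ r=\max_{1\le i\le\ell-1}\int_{\mathbb{X}^i}\bigg(\int_{\mathbb{X}^{\ell-i}}h(x_1,\dots,x_\ell)\,dL^{\ell-i}(x_{i+1},\dots,x_\ell)\bigg)^2dL^i(x_1,\dots,x_i) $$ if $\ell\ge2$, and $r=0$ if $\ell=1$. Assume $\lambda>0$, and let $P_\lambda$ be a Poisson random variable with mean $\lambda$. Then $$ d_{TV}(S,P_\lambda)\le\Big(1\wedge\frac1\lambda\Big)\frac{2^\ell r}{\ell!}\qquad\text{and}\qquad d_W(S,P_\lambda)\le\Big(1\wedge\frac{1.1437}{\sqrt\lambda}\Big)\frac{2^\ell r}{\ell!}. $$ Moreover, for all $m\in\mathbb{N}$, $$ 0\le\mathbb{P}(S=0)-e^{-\lambda}\le\Bigg[\sum_{k=0}^{m-1}\Big(\frac1{k+1}\wedge\frac{k!}{\lambda^{k+1}}\Big)\mathbb{P}(S\le k)+\frac{m!}{\lambda^{m+1}}\Bigg]\frac{2^\ell r}{\ell!}, $$ and for all $v\in\mathbb{N}$,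 $$ |\mathbb{P}(S\le v)-\mathbb{P}(P_\lambda\le v)|\le\Bigg[\frac{(v+1)^2}{\lambda}+\mathbb{P}(S\le v)\Bigg]\frac{2^\ell r}{\ell!\lambda}. $$
   Context: $\mathbb{N}=\{1,2,\dots\}$, $a\wedge b=\min\{a,b\}$. $\eta_{\neq}^\ell$ denotes the collection of all $\ell$-tuples of distinct points of $\eta$ (writing $\eta=\sum_i\delta_{X_i}$, the tuples $(X_{i_1},\dots,X_{i_\ell})$ with pairwise distinct indices). For an $\mathbb{N}_0$-valued random variable $S$, $d_{TV}(S,P_\lambda)=\sup_{A\subset\mathbb{N}_0}|\mathbb{P}(S\in A)-\mathbb{P}(P_\lambda\in A)|$ and $d_W(S,P_\lambda)=\sup_g|\mathbb{E}[g(S)]-\mathbb{E}[g(P_\lambda)]|$, the supremum running over all $g:\mathbb{N}_0\to\mathbb{R}$ that are Lipschitz with constant at most $1$. *)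

(* Defs.v *)
From HB Require Import structures.
From mathcomp Require Import all_boot all_order all_fingroup all_algebra.
From mathcomp Require Import all_classical all_reals all_analysis measurable_realfun.

Set Implicit Arguments.
Unset Strict Implicit.
Unset Printing Implicit Defensive.

Import Order.TTheory GRing.Theory Num.Theory.
Import numFieldNormedType.Exports.

Local Open Scope classical_set_scope.
Local Open Scope ring_scope.
Local Open Scope ereal_scope.

Section power_measure.
Context d (T : measurableType d) (R : realType).
Variable L : {sigma_finite_measure set T -> \bar R}.

Definition cons_pair n (p : T * n.-tuple T) : n.+1.-tuple T :=
  [tuple of p.1 :: p.2].

Lemma measurable_cons_pair n :
  measurable_fun [set: T * n.-tuple T] (@cons_pair n).
Proof. exact: measurable_cons. Qed.

Section step.
Variables (n : nat) (mu : {sigma_finite_measure set n.-tuple T -> \bar R}).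

Definition cons_measure : set (n.+1.-tuple T) -> \bar R :=
  pushforward (L \x mu) (@cons_pair n).

Let cons_measure0 : cons_measure set0 = 0.
Proof. by rewrite /cons_measure /pushforward preimage_set0 measure0. Qed.

Let cons_measure_ge0 A : 0 <= cons_measure A.
Proof. by rewrite /cons_measure /pushforward; exact: measure_ge0. Qed.

Let cons_measure_sigma_additive : semi_sigma_additive cons_measure.
Proof.
have mc F : measurable F -> measurable (@cons_pair n @^-1` F).
  by move=> mF; rewrite -[X in measurable X]setTI; exact: measurable_cons_pair.
move=> F mF tF mUF; rewrite /cons_measure /pushforward preimage_bigcup.
apply: measure_semi_sigma_additive.
- by move=> k; exact: mc.
- apply/trivIsetP => /= i j _ _ ij; rewrite -preimage_setI.
  by move/trivIsetP : tF => /(_ _ _ _ _ ij) ->//; rewrite preimage_set0.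
- by rewrite -preimage_bigcup; exact: mc.
Qed.

HB.instance Definition _ := isMeasure.Build _ _ _ cons_measure
  cons_measure0 cons_measure_ge0 cons_measure_sigma_additive.

Let cons_measure_sigma_finite : sigma_finite setT cons_measure.
Proof.
have /sigma_finiteP[F [TF ndF Foo]] := sigma_finiteT L.
have /sigma_finiteP[G [TG ndG Goo]] := sigma_finiteT mu.
pose g (t : n.+1.-tuple T) : T * n.-tuple T := (thead t, [tuple of behead t]).
have gK : cancel g (@cons_pair n) by move=> t; rewrite [RHS]tuple_eta.
have cK : cancel (@cons_pair n) g.
  by case=> x t; rewrite /g /cons_pair theadE; congr pair; exact: val_inj.
have mg : measurable_fun [set: n.+1.-tuple T] g.
  apply/measurable_fun_pairP; split; first exact: measurable_tnth.
  exact: measurable_behead.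
exists (fun k => g @^-1` (F k `*` G k)).
  apply/seteqP; split => // t _.
  have [i _ Fi] : (\bigcup_i F i) (g t).1 by rewrite -TF.
  have [j _ Gj] : (\bigcup_i G i) (g t).2 by rewrite -TG.
  exists (maxn i j) => //; split.
  - by move: Fi; exact/subsetPset/ndF/leq_maxl.
  - by move: Gj; exact/subsetPset/ndG/leq_maxr.
move=> k; have [mF Fk] := Foo k; have [mG Gk] := Goo k; split.
  by rewrite -[X in measurable X]setTI; apply: mg => //; exact: measurableX.
rewrite /= /cons_measure /pushforward -comp_preimage.
rewrite (_ : g \o _ = id); last exact/funext.
by rewrite preimage_id product_measure1E// lte_mul_pinfty// ge0_fin_numE.
Qed.

HB.instance Definition _ := @Measure_isSigmaFinite.Build _ _ _ cons_measure
  cons_measure_sigma_finite.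

End step.

Fixpoint power_measure n : {sigma_finite_measure set n.-tuple T -> \bar R} :=
  match n with
  | 0 => [the {sigma_finite_measure set 0.-tuple T -> \bar R}
            of \d_([tuple] : 0.-tuple T)]
  | n'.+1 => [the {sigma_finite_measure set n'.+1.-tuple T -> \bar R}
                of cons_measure (power_measure n')]
  end.


Lemma power_measure_box n (A : 'I_n -> set T) :
    (forall i, measurable (A i)) ->
  power_measure n [set t | forall i, A i (tnth t i)] = \prod_(i < n) L (A i).
Proof.
have mbox m (B : 'I_m -> set T) : (forall i, measurable (B i)) ->
    measurable [set t : m.-tuple T | forall i, B i (tnth t i)].
  move=> mB; rewrite (_ : mkset _ =
      \bigcap_(i in [set: 'I_m]) ((fun t => tnth t i) @^-1` B i)).
    apply: fin_bigcap_measurable => // i _; rewrite -[X in measurable X]setTI.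
    exact: (measurable_tnth i measurableT).
  by apply/seteqP; split => [t /= H i _|t /= H i]; exact: H.
elim: n A => [|n IH] A mA.
  by rewrite big_ord0 /= diracE mem_set// => -[].
rewrite big_ord_recl -(IH (fun i => A (lift ord0 i)) (fun i => mA _)).
rewrite /= -product_measure1E//; last first.
  by apply: (mbox _ (fun i => A (lift ord0 i))) => i; exact: mA.
congr (product_measure1 _ _ _).
apply/seteqP; split => [[x t]/= H|[x t]/= [H1 H2] i].
  split; first exact: (H ord0).
  by move=> i; have := H (lift ord0 i); rewrite tnthS.
by case: (unliftP ord0 i) => [j ->|->//]; rewrite tnthS.
Qed.

End power_measure.

(* A proper point process, i.e. the sum of the Dirac masses at X_i over
   i < kappa, where kappa takes values in {0, 1, ...} u {oo} and None stands
   for oo. *)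
Record proper_point_process d (T : measurableType d) d' (Om : measurableType d')
    := ProperPointProcess {
  npoints : Om -> option nat ;
  point : nat -> Om -> T ;
  measurable_npoints : forall k, measurable (npoints @^-1` [set k]) ;
  measurable_point : forall i, measurable_fun [set: Om] (point i) }.

Section poisson_process.
Context d (T : measurableType d) d' (Om : measurableType d') (R : realType).
Implicit Types (eta : proper_point_process T Om) (L : set T -> \bar R).

Definition indices eta (w : Om) : set nat :=
  [set i | if npoints eta w is Some k then (i < k)%N else true].

Definition num_points eta (B : set T) (w : Om) : \bar R :=
  \esum_(i in indices eta w) \d_(point eta i w) B.

(* The second argument of poisson_prob is a dummy; at rate 0 it is the Dirac
   mass at 0. When L B = +oo, eta(B) is infinite almost surely. *)
Definition is_poisson_process (P : probability Om R) L eta : Prop :=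
  (forall (B : set T) (k : nat), measurable B ->
    P [set w | num_points eta B w = k%:R%:E] =
    if L B == +oo then 0 else poisson_prob (fine (L B)) 0 [set k]) /\
  (forall (m : nat) (B : 'I_m -> set T) (A : 'I_m -> set (\bar R)),
    (forall j, measurable (B j)) -> trivIset [set: 'I_m] B ->
    (forall j, measurable (A j : set (\bar R))) ->
    P (\bigcap_(j in [set: 'I_m]) (num_points eta (B j) @^-1` A j)) =
    \prod_(j < m) P (num_points eta (B j) @^-1` A j)).

End poisson_process.

Section ustatistic.
Context d (T : measurableType d) (R : realType) (l : nat).
Implicit Types (L : {sigma_finite_measure set T -> \bar R})
  (h : l.-tuple T -> R).

Definition symmetric_kernel h : Prop :=
  forall (s : 'S_l) (t : l.-tuple T), h [tuple tnth t (s i) | i < l] = h t.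

Definition ustat d' (Om : measurableType d')
    (eta : proper_point_process T Om) h (w : Om) : \bar R :=
  (l`!%:R^-1)%R%:E *
  \esum_(i in [set i : l.-tuple nat |
                 uniq i /\ (forall j, j \in i -> indices eta w j)])
    (h (map_tuple (point eta ^~ w) i))%:E.

Definition ustat_mean L h : R :=
  (l`!%:R^-1 * \int[power_measure L l]_x h x)%R.

Definition tuple_glue (i : 'I_l) (x : i.-tuple T) (y : (l - i).-tuple T) :
  l.-tuple T := tcast (subnKC (ltnW (ltn_ord i))) [tuple of x ++ y].

(* All terms are nonnegative, so the neutral element 0 only matters when the
   range is empty, i.e. for l = 1. The inner integral, hence r, may be +oo. *)
Definition ustat_r L h : \bar R :=
  \big[maxe/0]_(i < l | (0 < i)%N)
    \int[power_measure L i]_x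
      (\int[power_measure L (l - i)]_y (h (tuple_glue x y))%:E) ^+ 2.

End ustatistic.

Section distances.
Context d (Om : measurableType d) (R : realType) (P : probability Om R).
(* S is meant to be N_0-valued almost surely only: a U-statistic may be +oo on a
   null set, where nat_value takes the junk value 0. *)
Implicit Types (S : Om -> \bar R) (lambda : R).

Definition nat_event S (A : set nat) : set Om :=
  [set w | exists2 k, A k & S w = k%:R%:E].

Definition nat_value S (w : Om) : nat := Num.truncn (fine (S w)).

Definition dTV_poisson S lambda : \bar R :=
  ereal_sup [set `|P (nat_event S A) - poisson_prob lambda 0 A| |
              A in [set: set nat]].

Definition lipschitz1 (g : nat -> R) : Prop :=
  forall a b : nat, (`|g a - g b| <= `|a%:R - b%:R|)%R.

Definition dW_poisson S lambda : \bar R :=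
  ereal_sup [set `|'E_P[g \o nat_value S] - 'E_(poisson_prob lambda 0)[g]| |
              g in lipschitz1].

End distances.

(* Main.v *)
From HB Require Import structures.
From mathcomp Require Import all_boot all_order all_fingroup all_algebra.
From mathcomp Require Import all_classical all_reals all_analysis measurable_realfun.
From mathcomp Require Import ring lra zify.
Require Import Defs.

(** The Poisson process restricted to a set [W] of finite measure is a Poisson
number of independent points: by uniqueness of measures on boxes, the list of
its points has a density (lemma [count_measureE]), so expectations of symmetric
functions of the points are explicit series of iterated integrals ([pint]).

For such series the Mecke formula is elementary.  It turns [E (S G(S))] into
[lambda] times the mean of [G] at the statistic of the process with [l] added
points, and adding the points raises [S] by [1 + D], where [D] counts the
admissible tuples using some, but not all, of the new points.  If [G] varies by
at most [psi(S)] per unit step, with [psi] nonincreasing, the error is bounded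
by the mean of [D psi(S)]; another use of the formula and the monotonicity of
[psi] bound the latter by [(2^l r / l!) E psi(S)].  This is where the mean of a
nonincreasing function of [S], e.g. [P(S <= k)], enters.

Inserting solutions of the Stein equation for [G] gives the four estimates.  The
bound [1.1437 / sqrt lambda] comes from representing the increments of the
solution by the semigroup of the immigration-death process, and from a bound on
the mode of the Poisson distribution.  An exhaustion of the space by sets of
finite measure removes the restriction to [W].

The means and the constants are finite in this argument except for [r]; when
[r] is infinite, only the lower bound on [P(S = 0)] has content, and it follows
with [psi = 0]. *)
Set Implicit Arguments.
Unset Strict Implicit.
Unset Printing Implicit Defensive.

Import Order.TTheory GRing.Theory Num.Theory.
Import numFieldNormedType.Exports.

Local Open Scope classical_set_scope.
Local Open Scope ring_scope.

(** * Means under the Poisson distribution *)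

(** The assumption on [eta] speaks only about counts of disjoint sets, whereas the statistic depends
    on the positions of points. Given [k] measurable sets, the atoms they generate in the window are
    disjoint cells, and the joint law of the cell counts already fixes the measure of a box of
    [k]-tuples; this is why boxes suffice. For 1-Lipschitz data they lie in [-1, 1]. Adding 1 keeps
    their increments, and the error [lam - j] it creates in the Stein equation has mean zero because
    the statistic has mean lambda. Hence the test functions [G] take values in [0, 2]. The factor
    2^l is a crude bound for the binomial coefficients that choose which of the [l] new points are
    reused; the argument itself yields the smaller constant [rsum]. The number 1.1437 is 8 / (3
    sqrt(2e)) rounded up: sqrt(2e) is the exact constant in the bound on the Poisson mode, and 8/3
    comes from integrating the smoothing bound over the semigroup parameter. *)

Section poisson_mean.
Variable R : realType.
Implicit Types (a b : nat -> R) (mu c s lam : R).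

(** The class contains Lipschitz functions and [k * G k] for bounded [G]; the factor [k.+1] allows a
    nonzero value at 0. *)
Definition linear_growth a := exists C, forall k, `|a k| <= C * k.+1%:R.

Definition fdiff a k : R := a k.+1 - a k.

Lemma linear_growth_shift a : linear_growth a -> linear_growth (fun k => a k.+1).
Proof.
move=> [C aC]; exists (C *+ 2) => k; apply: le_trans (aC _) _.
have C0 : 0 <= C by have := aC 0%N; rewrite mulr1; exact: le_trans.
rewrite mulrnAl -mulrnAr ler_wpM2l// -[X in _ <= X]mulr_natr -natrM ler_nat; lia.
Qed.

Lemma linear_growthD a b : linear_growth a -> linear_growth b ->
  linear_growth (fun k => a k + b k).
Proof.
move=> [C aC] [D bD]; exists (C + D) => k; rewrite mulrDl.
exact: le_trans (ler_normD _ _) (lerD (aC _) (bD _)).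
Qed.

Lemma linear_growthN a : linear_growth a -> linear_growth (fun k => - a k).
Proof. by move=> [C aC]; exists C => k; rewrite normrN. Qed.

Lemma linear_growth_fdiff a : linear_growth a -> linear_growth (fdiff a).
Proof.
move=> aC; apply: linear_growthD; first exact: linear_growth_shift.
exact: linear_growthN.
Qed.

Lemma linear_growth_bounded c a : (forall k, `|a k| <= c) -> linear_growth a.
Proof.
move=> ac; exists c => k; apply: le_trans (ac k) _.
by rewrite ler_peMr ?ler1n// (le_trans _ (ac 0%N)).
Qed.

Lemma linear_growth_lipschitz a : (forall k, `|fdiff a k| <= 1) ->
  linear_growth a.
Proof.
move=> a1; exists (`|a 0%N| + 1).
have H k : `|a k| <= `|a 0%N| + k%:R.
  elim: k => [|k IH]; first by rewrite addr0.
  rewrite -(subrK (a k) (a k.+1)); apply: le_trans (ler_normD _ _) _.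
  by rewrite -natr1 addrA [leRHS]addrC; exact: lerD (a1 k) IH.
move=> k; apply: le_trans (H k) _; rewrite mulrDl mul1r lerD ?ler_nat//.
by rewrite ler_peMr ?ler1n.
Qed.

(** Coefficients of the exponential generating function, which makes termwise differentiation of
    power series available. *)
Definition egf a k : R := a k / k`!%:R.

Lemma is_cvg_egf a mu : linear_growth a -> cvgn (pseries (egf a) mu).
Proof.
move=> [C aC]; apply: normed_cvg => /=.
have C0 : 0 <= C by have := aC 0%N; rewrite mulr1; exact: le_trans.
(* Since [n < 2 ^ n], linear growth is absorbed by the exponential series at twice the modulus of
   [mu]. *)
apply: (@series_le_cvg _ _ (C *: exp_coeff (2 * `|mu|))) => //=.
- by move=> n /=; rewrite mulr_ge0// exp_coeff_ge0// mulr_ge0.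
- move=> n; rewrite /egf -[leRHS]/(C * ((2 * `|mu|) ^+ n / n`!%:R)) !normrM normfV normrX normr_nat exprMn.
  rewrite (_ : C * (_ / _) = (C * 2 ^+ n) / n`!%:R * `|mu| ^+ n); last first.
    by ring.
  rewrite ler_wpM2r ?exprn_ge0// ler_wpM2r// (le_trans (aC n))// ler_wpM2l//.
  by rewrite -natrX ler_nat ltn_expl.
- by rewrite seriesZ; apply: is_cvgMr; exact: is_cvg_series_exp_coeff.
Qed.

(** As a power series the Poisson mean makes sense for every real [mu] and can be differentiated in
    [mu]. *)
Definition pmean a mu : R := expR (- mu) * limn (pseries (egf a) mu).

Lemma pmeanD a b mu : linear_growth a -> linear_growth b ->
  pmean (fun k => a k + b k) mu = pmean a mu + pmean b mu.
Proof.
move=> ga gb; rewrite /pmean -mulrDr; congr (_ * _).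
rewrite -limD; [|exact: is_cvg_egf|exact: is_cvg_egf].
congr (limn _); apply/funext => n; rewrite /pseries /series [RHS]/GRing.add /= -big_split /=.
by apply: eq_bigr => i _; rewrite /egf; ring.
Qed.

Lemma pmeanZ c a mu : linear_growth a ->
  pmean (fun k => c * a k) mu = c * pmean a mu.
Proof.
move=> ga; rewrite /pmean mulrCA; congr (_ * _).
rewrite -[c * _]/(c *: limn _) -limZr; last exact: is_cvg_egf.
congr (limn _); apply/funext => n; rewrite /pseries /series [RHS]/GRing.scale /= scaler_sumr.
by apply: eq_bigr => i _; rewrite /egf /GRing.scale /=; ring.
Qed.

Lemma pmeanN a mu : linear_growth a -> pmean (fun k => - a k) mu = - pmean a mu.
Proof.
by move=> ga; rewrite -mulN1r -pmeanZ//; congr pmean; apply/funext=> k; rewrite mulN1r.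
Qed.

Lemma pmean_fdiff a mu : linear_growth a ->
  pmean (fdiff a) mu = pmean (fun k => a k.+1) mu - pmean a mu.
Proof.
move=> ga; rewrite -pmeanN// -pmeanD//; first exact: linear_growth_shift.
exact: linear_growthN.
Qed.

Lemma pmean_cst c mu : pmean (cst c) mu = c.
Proof.
have g1 : linear_growth (cst 1) by apply: (@linear_growth_bounded 1) => k; rewrite normr1.
rewrite (_ : cst c = (fun k => c * cst 1 k)); last first.
  by apply/funext => k; rewrite /= mulr1.
rewrite pmeanZ// /pmean.
have -> : pseries (egf (cst 1)) mu = pseries (fun n => n`!%:R^-1) mu.
  by congr (pseries _ mu); apply/funext => k; rewrite /egf mul1r.
by have /(congr1 (fun f => f mu)) /= <- := @expRE R; rewrite [_ * expR mu]mulrC expRxMexpNx_1 mulr1.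
Qed.

Lemma pmean_ge0 a mu : linear_growth a -> 0 <= mu -> (forall k, 0 <= a k) ->
  0 <= pmean a mu.
Proof.
move=> ga mu0 a0; rewrite /pmean mulr_ge0 ?expR_ge0// limr_ge//; first exact: is_cvg_egf.
near=> n; rewrite /pseries /series /= sumr_ge0// => k _.
by rewrite mulr_ge0 ?exprn_ge0// /egf divr_ge0.
Unshelve. all: by end_near. Qed.

Lemma pmean_le a b mu : linear_growth a -> linear_growth b -> 0 <= mu ->
  (forall k, a k <= b k) -> pmean a mu <= pmean b mu.
Proof.
move=> ga gb mu0 ab; rewrite -subr_ge0 -pmeanN// -pmeanD//; last exact: linear_growthN.
by apply: pmean_ge0 => // [|k]; [apply: linear_growthD => //; exact: linear_growthN|rewrite subr_ge0].
Qed.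

Lemma pmean_bounded c a mu : 0 <= mu -> (forall k, `|a k| <= c) -> `|pmean a mu| <= c.
Proof.
move=> mu0 ac; have ga := linear_growth_bounded ac.
have gc c' : linear_growth (cst c') by apply: (@linear_growth_bounded `|c'|).
rewrite ler_norml -(pmean_cst (- c) mu) -[in X in _ && X](pmean_cst c mu).
by apply/andP; split; apply: pmean_le => // k /=; have := ac k; rewrite ler_norml => /andP[].
Qed.

Lemma pmean0 a : pmean a 0 = a 0%N.
Proof.
rewrite /pmean oppr0 expR0 mul1r; apply/cvg_lim => //.
rewrite -(cvg_shiftS _); apply: cvg_near_cst; near=> n.
rewrite /= /pseries /series /= big_mkord big_ord_recl big1 /=.
  by rewrite /egf fact0 divr1 expr0 mulr1 addr0.
by move=> i _; rewrite /bump /= expr0n /= mulr0.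
Unshelve. all: by end_near. Qed.

(** Differentiating an exponential generating function shifts its coefficients, and the factor
    [expR (- mu)] subtracts the mean itself; the result is the mean of the difference. *)
Lemma is_derive_pmean a mu : linear_growth a ->
  is_derive mu 1 (pmean a) (pmean (fdiff a) mu).
Proof.
move=> ga.
have dE b : pseries_diffs (egf b) = egf (fun k => b k.+1).
  apply/funext => k; rewrite /pseries_diffs /egf factS natrM invfM.
  by rewrite mulrCA !mulrA mulfK// pnatr_eq0.
have gs := linear_growth_shift ga; have gss := linear_growth_shift gs.
pose K : R := `|mu| + 1.
have dl : is_derive mu 1 (fun x => limn (pseries (egf a) x))
    (limn (pseries (egf (fun k => a k.+1)) mu)).
  rewrite -dE; apply: (@pseries_snd_diffs _ _ K).
  - exact: is_cvg_egf.
  - by rewrite dE; exact: is_cvg_egf.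
  - by rewrite !dE; exact: is_cvg_egf.
  - by rewrite /K [ltRHS]ger0_norm ?ltrDl// ler_wpDr.
have de : is_derive mu 1 (fun x : R => expR (- x)) (- expR (- mu)).
  have d1 : is_derive mu 1 (-%R : R -> R) (-1) by exact: is_deriveN.
  by have := is_derive1_comp (is_derive_expR (- mu)) d1; rewrite mulrN1.
have := is_deriveM de dl.
rewrite [X in is_derive _ _ X _](_ : _ = pmean a) ?pmean_fdiff//.
by move=> /is_derive_eq; apply; rewrite /pmean /GRing.scale /=; ring.
Qed.

End poisson_mean.

(** * Upper bound for the mode of the Poisson distribution *)

Section poisson_peak.
Variable R : realType.
Implicit Types (a : nat -> R) (mu c s lam : R).

Lemma nonincreasing_of_derive (f df : R -> R) (a b : R) : a <= b ->
  (forall x, x \in `[a, b] -> is_derive x 1 f (df x)) ->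
  (forall x, x \in `]a, b[ -> df x <= 0) -> f b <= f a.
Proof.
rewrite le_eqVlt => /predU1P[->//|ab] fd df0.
have cf : {within `[a, b], continuous f}.
  by apply: derivable_within_continuous => x xab; have [] := fd _ xab.
have fd' x : x \in `]a, b[ -> is_derive x 1 f (df x).
  by move=> xab; apply: fd; exact: subset_itv_oo_cc.
have [c cab E] := @MVT R f df a b ab fd' cf.
by rewrite -subr_le0 E mulr_le0_ge0 ?df0// subr_ge0 ltW.
Qed.

(* The logarithm of [(n + x) ^ (n + x) / (n - x) ^ (n - x)], suitably
   normalised, has derivative [ln (1 - x ^ 2)]. *)
Lemma ln_ratio_le (x : R) : 0 <= x -> x < 1 ->
  (1 + x) * ln (1 + x) - (1 - x) * ln (1 - x) <= 2 * x.
Proof.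
move=> x0 x1; rewrite -subr_le0.
pose f t : R := (1 + t) * ln (1 + t) - (1 - t) * ln (1 - t) - 2 * t.
pose df t : R := ln (1 + t) + ln (1 - t).
suff : f x <= f 0 by rewrite /f addr0 subr0 ln1 !mulr0 !subr0.
apply: (@nonincreasing_of_derive f df) => // t; rewrite in_itv/= => /andP[t0 tx].
  have t1 : t < 1 by exact: le_lt_trans x1.
  have p1 : 0 < 1 + t by rewrite ltr_wpDr.
  have p2 : 0 < 1 - t by rewrite subr_gt0.
  have d1 : is_derive t 1 (fun t : R => 1 + t) 1.
    by have := is_deriveD (is_derive_cst (1 : R) t 1) (is_derive_id t 1); rewrite add0r.
  have d2 : is_derive t 1 (fun t : R => 1 - t) (-1).
    by have := is_deriveB (is_derive_cst (1 : R) t 1) (is_derive_id t 1); rewrite sub0r.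
  have l1 := is_derive1_comp (is_derive1_ln p1) d1.
  have l2 := @is_derive1_comp R (@ln R) (fun t : R => 1 - t) t _ _ (is_derive1_ln p2) d2.
  have e1 := is_deriveM d1 l1; have e2 := is_deriveM d2 l2.
  have e3 : is_derive t 1 (fun t : R => 2 * t) 2.
    by have := is_deriveZ 2 (is_derive_id t (1 : R)); rewrite /GRing.scale /= mulr1.
  apply: (is_derive_eq (is_deriveB (is_deriveB e1 e2) e3)).
  rewrite /df /GRing.scale /=; field.
  by rewrite !gt_eqF.
have t1 : t < 1 by exact: lt_trans x1.
rewrite /df -lnM ?posrE ?subr_gt0// ?ltr_wpDr ?(ltW t0)//.
apply: ln_le0; nra.
Qed.

Lemma expn_ratio_le n : (0 < n)%N ->
  (n%:R + 2^-1) ^+ (n.*2.+1) <=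
  expR 2 * n%:R ^+ 2 * (n%:R - 2^-1) ^+ (n.*2.-1) :> R.
Proof.
move=> n0; have n1 : 1 <= n%:R :> R by rewrite ler1n.
have nn0 : 0 < n%:R :> R by rewrite ltr0n.
(* With [x = 1 / (2n)] the bases are [n (1 + x)] and [n (1 - x)] and the exponents [2n (1 + x)] and
   [2n (1 - x)], so the logarithm of the claim is [2n] times [ln_ratio_le]. *)
pose x : R := (2 * n%:R)^-1.
have x0 : 0 < x by rewrite invr_gt0; lra.
have x1 : x < 1 by rewrite invf_lt1; lra.
have nx : n%:R * x = 2^-1 by rewrite /x; field; rewrite gt_eqF.
have -> : n%:R + 2^-1 = n%:R * (1 + x) by rewrite mulrDr mulr1 nx.
have -> : n%:R - 2^-1 = n%:R * (1 - x) by rewrite mulrBr mulr1 nx.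
rewrite !exprMn mulrA -(mulrA _ (n%:R ^+ 2)) -exprD.
rewrite (_ : 2 + n.*2.-1 = n.*2.+1)%N; last by lia.
rewrite mulrAC [leLHS]mulrC ler_wpM2r ?exprn_ge0//.
have p1 : 0 < 1 + x by lra.
have p2 : 0 < 1 - x by lra.
have -> : expR 2 * (1 - x) ^+ n.*2.-1 = expR (2 + ln (1 - x) * n.*2.-1%:R).
  by rewrite [RHS]expRD expRM_natr lnK.
rewrite -[in leLHS](lnK p1) -expRM_natr ler_expR.
have := ln_ratio_le (ltW x0) x1.
have -> : n.*2.+1%:R = 2 * n%:R * (1 + x) :> R.
  by rewrite mulrDr mulr1 -mulrA nx divff// -[n.*2.+1]addn1 natrD -[n.*2]mul2n natrM.
have -> : n.*2.-1%:R = 2 * n%:R * (1 - x) :> R.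
  by rewrite mulrBr mulr1 -mulrA nx divff// -subn1 natrB ?double_gt0// -[n.*2]mul2n natrM.
move=> H; rewrite -lerBlDr.
have -> : ln (1 + x) * (2 * n%:R * (1 + x)) - ln (1 - x) * (2 * n%:R * (1 - x)) =
  2 * n%:R * ((1 + x) * ln (1 + x) - (1 - x) * ln (1 - x)) by ring.
apply: le_trans (_ : 2 * n%:R * (2 * x) <= _); first by rewrite ler_wpM2l// mulr_ge0.
by rewrite mulrCA -mulrA nx; lra.
Qed.

(** A Stirling-type bound centred at [j + 1/2], squared to keep integer exponents. There is equality
    at [j = 0], which is the source of the constant [2e]; the ratio of consecutive bounds is
    controlled by [expn_ratio_le]. *)
Lemma factorial_lower_bound j :
  2 * expR 1 * ((j%:R + 2^-1) ^+ (j.*2.+1) * expR (- j.*2.+1%:R)) <= j`!%:R ^+ 2 :> R.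
Proof.
elim: j => [|j IH].
  rewrite fact0 expr1 add0r mulrCA mulrA -!mulrA -expRD subrr expR0; lra.
rewrite factS natrM exprMn; apply: le_trans (ler_wpM2l (sqr_ge0 _) IH).
have /= := expn_ratio_le (ltn0Sn j).
have -> : j.+1%:R - 2^-1 = j%:R + 2^-1 :> R by rewrite -natr1; lra.
move=> H; rewrite [leRHS]mulrCA; apply: ler_wpM2l; first by rewrite mulr_ge0 ?expR_ge0.
have -> : expR (- j.*2.+1%:R) = expR (- (j.+1).*2.+1%:R) * expR 2 :> R.
  by rewrite -expRD; congr expR; rewrite doubleS -2![_.+1%:R]natr1 -[in RHS]natr1; lra.
rewrite mulrA [leRHS]mulrA [leRHS]mulrAC ler_wpM2r ?expR_ge0//.
by apply: le_trans H _; rewrite le_eqVlt; apply/orP; left; apply/eqP; ring.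
Qed.

(** Apart from the factorial the left-hand side is governed by [mu ^+ n * expR (- (2 * mu))] with
    [n = 2j + 1], which is largest at [mu = j + 1/2]; there [factorial_lower_bound] applies. *)
Lemma poisson_peak_sqr j mu : 0 < mu ->
  (mu ^+ j / j`!%:R * expR (- mu)) ^+ 2 * (2 * expR 1 * mu) <= 1.
Proof.
move=> mu0; set n := j.*2.+1.
have n0 : 0 < n%:R :> R by rewrite ltr0n.
have f0 : 0 < j`!%:R :> R by rewrite ltr0n fact_gt0.
have H : mu ^+ n * expR (- (2 * mu)) <= (j%:R + 2^-1) ^+ n * expR (- n%:R).
  have e1 : 2 * mu / n%:R <= expR (2 * mu / n%:R - 1).
    by have := @expR_ge1Dx R (2 * mu / n%:R - 1); rewrite addrC subrK.
  have nE : n%:R = 2 * (j%:R + 2^-1) :> R by rewrite /n -addn1 natrD -mul2n natrM; lra.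
  have j0 : 0 < j%:R + 2^-1 :> R by rewrite ltr_wpDl.
  have e2 : mu <= (j%:R + 2^-1) * expR (2 * mu / n%:R - 1).
    apply: le_trans (ler_wpM2l (ltW j0) e1); rewrite nE le_eqVlt; apply/orP; left.
    by apply/eqP; field; rewrite gt_eqF//; lra.
  have e3 : mu ^+ n <= ((j%:R + 2^-1) * expR (2 * mu / n%:R - 1)) ^+ n.
    by apply: lerXn2r => //; rewrite nnegrE ?ltW// mulr_gt0// expR_gt0.
  apply: le_trans (ler_wpM2r (expR_ge0 _) e3) _.
  rewrite exprMn -expRM_natr -[leLHS]mulrA -expRD mulrBl mul1r divfK ?gt_eqF//.
  by rewrite addrAC subrr add0r.
have fb := factorial_lower_bound j.
rewrite exprMn -expRM_natr expr_div_n -exprM mulNr muln2 mulrC [mu * 2]mulrC.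
rewrite mulrA (mulrA _ (mu ^+ _)) -(mulrA _ mu (mu ^+ _)) -exprS.
rewrite [X in X <= 1](_ : _ = 2 * expR 1 * (mu ^+ n * expR (- (2 * mu))) / j`!%:R ^+ 2); last first.
  by rewrite /n; field; rewrite gt_eqF.
rewrite ler_pdivrMr ?exprn_gt0// mul1r.
by apply: le_trans fb; rewrite ler_wpM2l// mulr_ge0// expR_ge0.
Qed.

End poisson_peak.

(** * Smoothing by the Poisson distribution *)

Section poisson_smoothing.
Variable R : realType.
Implicit Types (a : nat -> R) (mu c M : R).

Definition pmass mu k : R := mu ^+ k / k`!%:R * expR (- mu).

Lemma pmass_ge0 mu k : 0 <= mu -> 0 <= pmass mu k.
Proof. by move=> mu0; rewrite mulr_ge0 ?expR_ge0// divr_ge0// exprn_ge0. Qed.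

Lemma pmassS mu k : pmass mu k.+1 * k.+1%:R = mu * pmass mu k.
Proof. by rewrite /pmass exprS factS natrM; field; rewrite pnatr_eq0 -lt0n fact_gt0 addrC natr1 pnatr_eq0. Qed.

Lemma cvg_pmean a mu : linear_growth a ->
  (\sum_(0 <= k < n) pmass mu k * a k) @[n --> \oo] --> pmean a mu.
Proof.
move=> ga; rewrite /pmean.
rewrite (_ : (fun n => _) = (fun n => expR (- mu) * pseries (egf a) mu n)).
  by apply: cvgMr; exact: is_cvg_egf.
apply/funext => n; rewrite /pseries /series /= mulr_sumr; apply: eq_bigr => i _.
by rewrite /pmass /egf; ring.
Qed.

(** Summation by parts moves the difference onto the weights, and a unimodal sequence bounded by [M]
    has total variation at most [2 * M]. *)
Lemma pmean_fdiff_le a mu M : 0 < mu -> (forall k, `|a k| <= 1) ->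
  (forall k, pmass mu k <= M) -> `|pmean (fdiff a) mu| <= 2 * M.
Proof.
move=> mu0 a1 pM; have p0 k := pmass_ge0 k (ltW mu0).
pose S n := \sum_(0 <= k < n) pmass mu k * fdiff a k.
(* Without its boundary term, the partial sum is bounded by the variation of the weights so far: the
   last weight up to the mode, at most [2 * M] minus the last weight after it. *)
have H n : `|S n.+1 - a n.+1 * pmass mu n| <=
    if n%:R <= mu then pmass mu n else 2 * M - pmass mu n.
  elim: n => [|n].
    rewrite (ltW mu0) /S big_nat1 /fdiff.
    rewrite (_ : _ - _ = - (a 0%N * pmass mu 0)); last by ring.
    by rewrite normrN normrM [leRHS](_ : _ = 1 * `|pmass mu 0|) ?ler_wpM2r// mul1r ger0_norm.
  set q := pmass mu n; set q' := pmass mu n.+1 => IH.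
  have -> : S n.+2 - a n.+2 * q' = (S n.+1 - a n.+1 * q) + a n.+1 * (q - q').
    by rewrite {1}/S big_nat_recr//= -/(S n.+1) /fdiff -/q'; ring.
  apply: le_trans (ler_normD _ _) _.
  have : `|a n.+1 * (q - q')| <= `|q - q'| by rewrite normrM ler_piMl.
  have qq := pmassS mu n; rewrite -/q -/q' in qq.
  have q0 : 0 <= q := p0 _; have q0' : 0 <= q' := p0 _.
  have qM : q <= M := pM _; have qM' : q' <= M := pM _.
  have n0 : 0 < n.+1%:R :> R by rewrite ltr0n.
  have [nmu|nmu] := leP n.+1%:R mu.
    have nmu' : n%:R <= mu by apply: le_trans nmu; rewrite ler_nat.
    have : q <= q'.
      rewrite -(ler_pM2r n0) qq mulrC ler_wpM2r//.
    by rewrite nmu' in IH => ? /[dup]; rewrite (ler0_norm (_ : q - q' <= 0)) ?subr_le0// => ?; lra.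
  have : q' <= q.
    by rewrite -(ler_pM2r n0) qq mulrC ler_wpM2l// ltW.
  move=> ?; rewrite (ger0_norm (_ : 0 <= q - q')) ?subr_ge0// => ?.
  by move: IH; case: ifPn => _; lra.
have ga : linear_growth (fdiff a) by apply/linear_growth_fdiff/(linear_growth_bounded a1).
have cS := cvg_pmean (mu := mu) ga.
have cN : `|S n| @[n --> \oo] --> `|pmean (fdiff a) mu| by exact: cvg_norm.
rewrite -(cvg_lim (@Rhausdorff R) cN); apply: limr_le; first by apply/cvgP: cN.
near=> n.
have [m ->] : exists m, n = m.+1.
  by exists n.-1; rewrite prednK//; near: n; exact: nbhs_infty_gt.
have := H m; have := p0 m; have := pM m => ? ? H'.
have ap : `|a m.+1 * pmass mu m| <= pmass mu m.
  by rewrite normrM (ger0_norm (p0 m)) ler_piMl.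
rewrite -(subrK (a m.+1 * pmass mu m) (S m.+1)); apply: le_trans (ler_normD _ _) _.
by move: H'; case: ifPn => _; lra.
Unshelve. all: by end_near. Qed.

Lemma pmean_fdiff_sqrt a mu : 0 < mu -> (forall k, `|a k| <= 1) ->
  `|pmean (fdiff a) mu| <= 2 / Num.sqrt (2 * expR 1 * mu).
Proof.
move=> mu0 a1; apply: pmean_fdiff_le => // k.
have e0 : 0 < 2 * expR 1 * mu by rewrite !mulr_gt0// expR_gt0.
rewrite -[leRHS]div1r ler_pdivlMr ?sqrtr_gt0//.
rewrite -(@ler_pXn2r _ 2%N)// ?nnegrE//; last first.
  by apply: mulr_ge0; [exact/pmass_ge0/ltW|exact: sqrtr_ge0].
by rewrite exprMn sqr_sqrtr ?(ltW e0)// expr1n; exact: poisson_peak_sqr.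
Qed.

End poisson_smoothing.

(** * The Stein equation *)

Section stein_semigroup.
Variables (R : realType) (lam : R).
Hypothesis lam0 : 0 < lam.
Implicit Types (a f : nat -> R) (s c : R).

(* [semigroup k s a] is the mean of [a (B + Q)] for independent
   B ~ Bin(k, s) and Q ~ Po(lam (1 - s)): the immigration-death semigroup
   at time [- ln s], started at [k]. *)
Fixpoint semigroup k s a : R :=
  if k is k'.+1 then semigroup k' s a + s * semigroup k' s (fdiff a)
  else pmean a (lam * (1 - s)).

(** Turns the recursion for [semigroup] into a convex combination with weights [1 - s] and [s] of
    the values at [a] and at its shift, so that bounds pass from [k] to [k.+1]. *)
Lemma semigroup_fdiff k s a : linear_growth a ->
  semigroup k s (fdiff a) = semigroup k s (fun j => a j.+1) - semigroup k s a.
Proof.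
elim: k a => [|k IH] a ga /=; first exact: pmean_fdiff.
rewrite IH// (IH (fdiff a)); last exact: linear_growth_fdiff.
by rewrite IH//; ring.
Qed.

Lemma semigroup_bounded k s a c : 0 <= s -> s <= 1 -> (forall j, `|a j| <= c) ->
  `|semigroup k s a| <= c.
Proof.
move=> s0 s1; elim: k a => [|k IH] a ac /=.
  by apply: pmean_bounded => //; rewrite mulr_ge0 ?subr_ge0// ltW.
rewrite semigroup_fdiff; last exact: linear_growth_bounded ac.
have := IH _ ac; have := IH (fun j => a j.+1) (fun j => ac j.+1).
set x := semigroup k s _; set y := semigroup k s a => xc yc.
have -> : y + s * (x - y) = (1 - s) * y + s * x by ring.
apply: le_trans (ler_normD _ _) _; rewrite !normrM (ger0_norm s0) ger0_norm ?subr_ge0//.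
have -> : c = (1 - s) * c + s * c by ring.
by apply: lerD; rewrite ler_wpM2l// subr_ge0.
Qed.

(** The Poisson component alone smooths; the binomial component only averages over shifts of [a]. *)
Lemma semigroup_smoothing k s a : 0 <= s -> s < 1 -> (forall j, `|a j| <= 1) ->
  `|semigroup k s (fdiff a)| <= 2 / Num.sqrt (2 * expR 1 * (lam * (1 - s))).
Proof.
move=> s0 s1; elim: k a => [|k IH] a a1 /=.
  by apply: pmean_fdiff_sqrt => //; rewrite mulr_gt0// subr_gt0.
have ga := linear_growth_fdiff (linear_growth_bounded a1).
rewrite (semigroup_fdiff _ _ ga).
have := IH _ a1; have := IH (fun j => a j.+1) (fun j => a1 j.+1).
rewrite -[fdiff (fun j => a j.+1)]/(fun j => fdiff a j.+1).
set c := 2 / _; set x := semigroup k s _; set y := semigroup k s _ => xc yc.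
have -> : y + s * (x - y) = (1 - s) * y + s * x by ring.
apply: le_trans (ler_normD _ _) _; rewrite !normrM (ger0_norm s0) ger0_norm ?subr_ge0 ?(ltW s1)//.
have -> : c = (1 - s) * c + s * c by ring.
by apply: lerD; apply: ler_wpM2l => //; rewrite subr_ge0 ltW.
Qed.

Lemma semigroup0 k a : linear_growth a -> semigroup k 0 a = pmean a lam.
Proof. by elim: k a => [|k IH] a ga /=; rewrite ?subr0 ?mulr1// IH// mul0r addr0. Qed.

Lemma semigroup1 k a : semigroup k 1 a = a k.
Proof.
by elim: k a => [|k IH] a /=; rewrite ?subrr ?mulr0 ?pmean0// !IH mul1r addrC subrK.
Qed.

(** The first term comes from the success probability of the binomial part, the second from the rate
    [lam * (1 - s)]. At [k = 0] the factor [k%:R] removes the meaningless [k.-1]. *)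
Lemma is_derive_semigroup k s a : linear_growth a ->
  is_derive s 1 (semigroup k ^~ a)
    (k%:R * semigroup k.-1 s (fdiff a) - lam * semigroup k s (fdiff a)).
Proof.
elim: k a => [|k IH] a ga /=.
  have d1 : is_derive s 1 (fun t : R => lam * (1 - t)) (- lam).
    have := is_deriveZ lam (is_deriveB (is_derive_cst (1 : R) s 1) (is_derive_id s 1)).
    by rewrite /GRing.scale /= sub0r mulrN1.
  have := @is_derive1_comp R (pmean a) _ s _ _ (is_derive_pmean (lam * (1 - s)) ga) d1.
  by move=> /is_derive_eq; apply; ring.
have gd := linear_growth_fdiff ga.
have := is_deriveD (IH _ ga) (is_deriveM (is_derive_id s 1) (IH _ gd)).
move=> /is_derive_eq; apply.
case: k {IH} => [|k] /=; rewrite /GRing.scale /=; first by ring.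
by rewrite -[in RHS]natr1; ring.
Qed.

(** An antiderivative in [s] of [semigroup k s (fdiff f)], obtained by solving the formula of
    [is_derive_semigroup] for its last term; it replaces integrals over the semigroup parameter. *)
Fixpoint primitive k f s : R :=
  if k is k'.+1 then (k%:R * primitive k' f s - semigroup k s f) / lam
  else - semigroup 0 s f / lam.

Lemma is_derive_primitive k f s : linear_growth f ->
  is_derive s 1 (primitive k f) (semigroup k s (fdiff f)).
Proof.
move=> gf; elim: k => [|k IH].
  have := is_deriveZ (- lam^-1) (is_derive_semigroup 0 s gf).
  rewrite [X in is_derive _ _ X _](_ : _ = primitive 0 f).
    by move=> /is_derive_eq; apply; rewrite /GRing.scale /=; field; rewrite gt_eqF.
  by apply/funext => t; rewrite /= {1}/GRing.scale /=; ring.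
have := is_deriveZ lam^-1 (is_deriveB (is_deriveZ k.+1%:R IH) (is_derive_semigroup k.+1 s gf)).
rewrite [X in is_derive _ _ X _](_ : _ = primitive k.+1 f).
  by move=> /is_derive_eq; apply; rewrite /GRing.scale /=; field; rewrite gt_eqF.
by apply/funext => t; rewrite [LHS]mulrC.
Qed.

Fixpoint stein f k : R :=
  if k is k'.+1 then (k'%:R * stein f k' + (f k' - pmean f lam)) / lam else 0.

Lemma steinE f k : lam * stein f k.+1 - k%:R * stein f k = f k - pmean f lam.
Proof. by rewrite /= mulrC divfK ?gt_eqF// addrC addKr. Qed.

(** This is the representation of the solution as minus the integral over [0, 1] of
    [semigroup k s (fdiff f)]. At [s = 1] and [s = 0] the semigroup gives [f k] and the Poisson
    mean, so the recursions for [primitive] and [stein] agree. *)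
Lemma stein_primitive f k : linear_growth f ->
  stein f k.+1 = primitive k f 0 - primitive k f 1.
Proof.
move=> gf; elim: k => [|k IH].
  rewrite [LHS]/= [primitive _ _ 0]/= [primitive _ _ 1]/= mul0r subr0 mulr1 subrr mulr0 pmean0.
  by ring.
rewrite [LHS]/= -/(stein f k.+1) IH [primitive k.+1 _ 0]/= [primitive k.+1 _ 1]/=.
rewrite -/(semigroup k.+1 0 f) -/(semigroup k.+1 1 f).
have := semigroup0 k.+1 gf => /= ->; have := semigroup1 k.+1 f => /= ->.
by ring.
Qed.

(** Plays the role of bounding an integral by the integral of a majorant of the modulus. *)
Lemma derive_comparison (F dF G dG : R -> R) (a b : R) : a <= b ->
  (forall x, x \in `[a, b] -> is_derive x 1 F (dF x)) ->
  (forall x, x \in `[a, b] -> is_derive x 1 G (dG x)) ->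
  (forall x, x \in `]a, b[ -> `|dF x| <= dG x) -> `|F b - F a| <= G b - G a.
Proof.
move=> ab dFE dGE FG; rewrite ler_norml; apply/andP; split.
- have := @nonincreasing_of_derive R (fun x => - F x - G x) (fun x => - dF x - dG x) a b ab.
  move=> H; rewrite -subr_ge0; have : - F b - G b <= - F a - G a; last by lra.
  apply: H => x xab; first exact: is_deriveB (is_deriveN (dFE _ xab)) (dGE _ xab).
  by have := FG _ xab; rewrite ler_norml => /andP[]; lra.
- have := @nonincreasing_of_derive R (fun x => F x - G x) (fun x => dF x - dG x) a b ab.
  move=> H; rewrite -subr_ge0; have : F b - G b <= F a - G a; last by lra.
  apply: H => x xab; first exact: is_deriveB (dFE _ xab) (dGE _ xab).
  by have := FG _ xab; rewrite ler_norml => /andP[]; lra.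
Qed.

(** * Stein solutions for Lipschitz functions *)

Section lipschitz.
Variable f : nat -> R.
Hypothesis f1 : forall k, `|fdiff f k| <= 1.

Let gf : linear_growth f := linear_growth_lipschitz f1.

Lemma stein_bounded k : `|stein f k| <= 1.
Proof.
case: k => [|k]; first by rewrite normr0.
rewrite stein_primitive// distrC.
apply: le_trans (_ : id 1 - id 0 <= 1 :> R); last by rewrite /= subr0.
apply: (@derive_comparison _ (fun s => semigroup k s (fdiff f)) _ (cst 1)) => // x.
- by move=> _; exact: is_derive_primitive.
- by rewrite in_itv/= => /andP[x0 x1]; apply: semigroup_bounded => //; exact: ltW.
Qed.

Let stein_fdiff k :
  stein f k.+2 - stein f k.+1 =
  (primitive k.+1 f 0 - primitive k f 0) - (primitive k.+1 f 1 - primitive k f 1).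
Proof. by rewrite !stein_primitive//; ring. Qed.

(** By the recursion for [semigroup], passing from [k] to [k.+1] produces a second difference of [f]
    with weight [s]. *)
Let is_derive_step k s :
  is_derive s 1 (fun t => primitive k.+1 f t - primitive k f t)
    (s * semigroup k s (fdiff (fdiff f))).
Proof.
apply: (is_derive_eq (is_deriveB (is_derive_primitive k.+1 s gf) (is_derive_primitive k s gf))).
by rewrite /=; ring.
Qed.

Lemma stein_fdiff_le1 k : `|stein f k.+2 - stein f k.+1| <= 1.
Proof.
rewrite stein_fdiff distrC.
(* Second differences of [f] are at most 2 in modulus, so the integrand is at most [2 * s], with
   antiderivative [s ^+ 2]. *)
apply: le_trans (_ : 1 ^+ 2 - 0 ^+ 2 <= 1 :> R); last by rewrite expr1n expr0n subr0.
apply: (@derive_comparison (fun s => primitive k.+1 f s - primitive k f s)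
  (fun s => s * semigroup k s (fdiff (fdiff f)))
  (fun s => s ^+ 2) (fun s => 2 * s)) => // x.
- move=> _; apply: DeriveDef; first exact: exprn_derivable.
  by rewrite exp_derive /GRing.scale /= mulr1.
- rewrite in_itv/= => /andP[x0 x1]; rewrite normrM (ger0_norm (ltW x0)) mulrC.
  rewrite ler_wpM2r ?(ltW x0)//; apply: semigroup_bounded; [exact: ltW..|move=> j].
  by have := f1 j; have := f1 j.+1; rewrite /fdiff !ler_norml => /andP[? ?] /andP[? ?]; apply/andP; split; lra.
Qed.

(* The substitution s = 1 - w ^ 2 removes the singularity of the smoothing
   bound at s = 1. *)
Lemma stein_fdiff_le_sqrt k :
  `|stein f k.+2 - stein f k.+1| <= 8 / (3 * Num.sqrt (2 * expR 1 * lam)).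
Proof.
rewrite stein_fdiff.
have e0 : 0 < 2 * expR 1 * lam by rewrite !mulr_gt0// expR_gt0.
pose q := Num.sqrt (2 * expR 1 * lam); have q0 : 0 < q by rewrite sqrtr_gt0.
pose D t := primitive k.+1 f t - primitive k f t.
have -> : primitive k.+1 f 0 - primitive k f 0 - (primitive k.+1 f 1 - primitive k f 1) =
    D (1 - 1 ^+ 2) - D (1 - 0 ^+ 2).
  by rewrite expr1n expr0n subrr subr0.
(* After the substitution the integrand is at most [(1 - w ^+ 2) * (2 / (q * w)) * (2 * w)], that is
   [4 / q * (1 - w ^+ 2)], and [G] is an antiderivative of it. *)
pose G (w : R) : R := 4 / q * (w - w ^+ 3 / 3).
apply: le_trans (_ : G 1 - G 0 <= _); last first.
  rewrite /G expr1n expr0n /= mul0r subr0 mulr0 subr0 le_eqVlt; apply/orP; left.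
  by apply/eqP; rewrite -/q; field; rewrite gt_eqF.
have dX n (x : R) : is_derive x 1 (fun w : R => w ^+ n.+1) (n.+1%:R * x ^+ n).
  apply: DeriveDef; first exact: exprn_derivable.
  by rewrite exp_derive /GRing.scale /= mulr1.
apply: (@derive_comparison (fun w => D (1 - w ^+ 2))
  (fun w => ((1 - w ^+ 2) * semigroup k (1 - w ^+ 2) (fdiff (fdiff f))) * (- (2 * w)))
  G (fun w => 4 / q * (1 - w ^+ 2))) => // x.
- move=> _; apply: (@is_derive1_comp R D (fun w => 1 - w ^+ 2)); first exact: is_derive_step.
  have := is_deriveB (is_derive_cst (1 : R) x 1) (dX 1%N x) => /is_derive_eq; apply.
  by rewrite sub0r expr1.
- move=> _; have := is_deriveZ (4 / q) (is_deriveB (is_derive_id x 1) (is_deriveZ (3^-1) (dX 2%N x))).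
  rewrite [X in is_derive _ _ X _ -> _](_ : _ = G).
    by move=> /is_derive_eq; apply; rewrite /GRing.scale /=; field; rewrite gt_eqF.
  by apply/funext => w; rewrite /G [_ / 3]mulrC.
- rewrite in_itv/= => /andP[x0 x1].
  have s0 : 0 < 1 - x ^+ 2 by rewrite subr_gt0; apply: exprn_ilt1 => //; exact: ltW.
  have s1 : 1 - x ^+ 2 < 1 by rewrite ltrBlDr ltrDl exprn_gt0.
  have := @semigroup_smoothing k _ (fdiff f) (ltW s0) s1 f1.
  rewrite subKr mulrA sqrtrM ?(ltW e0)// sqrtr_sqr (gtr0_norm x0) -/q => H.
  have x2 : 0 <= 2 * x by rewrite mulr_ge0// ltW.
  rewrite normrM normrN normrM (gtr0_norm s0) (ger0_norm x2).
  apply: le_trans (_ : (1 - x ^+ 2) * (2 / (q * x)) * (2 * x) <= _).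
    by apply: ler_wpM2r => //; apply: ler_wpM2l => //; exact: ltW.
  rewrite le_eqVlt; apply/orP; left; apply/eqP; field.
  by rewrite !gt_eqF.
Qed.

End lipschitz.

(** The fraction is the sum of the first eight terms of the exponential series. *)
Lemma expR1_lower_bound : 685 / 252 <= expR 1 :> R.
Proof.
rewrite /expR; apply: le_trans (_ : series (exp_coeff 1) 8 <= _).
  have sS n : series (exp_coeff 1) n.+1 = series (exp_coeff 1) n + n`!%:R^-1 :> R.
    by rewrite /series /= big_nat_recr//= /exp_coeff /= expr1n mul1r.
  rewrite !sS [series _ 0]big_nil.
  have [-> -> -> -> ->] : [/\ 3`! = 6, 4`! = 24, 5`! = 120, 6`! = 720 & 7`! = 5040]%N by [].
  have [-> -> ->] : [/\ 0`! = 1, 1`! = 1 & 2`! = 2]%N by [].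
  by lra.
apply: nondecreasing_cvgn_le; last exact: is_cvg_series_exp_coeff.
by apply/nondecreasing_series => n _ _; exact: exp_coeff_ge0.
Qed.

Lemma stein_wasserstein f k : (forall k, `|fdiff f k| <= 1) ->
  `|stein f k.+2 - stein f k.+1| <= Num.min 1 (11437 / 10000 / Num.sqrt lam).
Proof.
move=> f1; rewrite le_min; apply/andP; split; first exact: stein_fdiff_le1.
apply: le_trans (stein_fdiff_le_sqrt f1 k) _.
(* A fraction between 8 / (3 sqrt(2e)), about 1.143685, and 1.1437, which the bound [685 / 252] on e
   is sharp enough to separate. *)
have : 390 / 341 <= 11437 / 10000 :> R by lra.
(* Generalised so that simplification does not expand these numerals. *)
move: (11437 / 10000 : R) => c c0.
have e0 : 0 <= 2 * expR 1 :> R by rewrite mulr_ge0// expR_ge0.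
have s0 : 0 < Num.sqrt (2 * expR 1) :> R by rewrite sqrtr_gt0 mulr_gt0// expR_gt0.
rewrite sqrtrM// mulrA invfM !mulrA ler_wpM2r ?invr_ge0 ?sqrtr_ge0//.
rewrite ler_pdivrMr ?mulr_gt0//; have := sqr_sqrtr e0; have := expR1_lower_bound.
set q := Num.sqrt (2 * expR 1) in s0 *.
by move: (expR 1) => e; nra.
Qed.

End stein_semigroup.

(** * Stein solutions for functions with values in [0, 1] *)

Section stein_total_variation.
Variables (R : realType) (lam : R).
Hypothesis lam0 : 0 < lam.
Implicit Types (f : nat -> R) (k v n : nat).

Local Notation p := (pmass lam).

(** Strict inequality: this is the probability that a Poisson variable is less than [k], so
    [1 - pcdf k] is the tail from [k] on. *)
Definition pcdf k := \sum_(0 <= j < k) p j.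

Local Notation T := pcdf.

Let p_gt0 k : 0 < p k.
Proof. by rewrite /pmass mulr_gt0 ?expR_gt0// divr_gt0 ?exprn_gt0// ltr0n fact_gt0. Qed.

Let TS k : T k.+1 = T k + p k.
Proof. by rewrite /pcdf big_nat_recr. Qed.

Let pS k : k.+1%:R * p k.+1 = lam * p k.
Proof. by rewrite mulrC pmassS. Qed.

Let cvgT : T n @[n --> \oo] --> (1 : R).
Proof.
have g1 : linear_growth (cst (1 : R)).
  by apply: (@linear_growth_bounded _ 1) => k; rewrite normr1.
have := cvg_pmean (mu := lam) g1; rewrite pmean_cst.
by under eq_fun do under eq_bigr do rewrite mulr1.
Qed.

Let ndT : nondecreasing_seq T.
Proof. by apply/nondecreasing_series => n _ _; exact/ltW. Qed.

Let T_ge0 k : 0 <= T k.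
Proof. by apply: sumr_ge0 => i _; exact/ltW. Qed.

Let T_le1 k : T k <= 1.
Proof.
rewrite -(cvg_lim (@Rhausdorff R) cvgT); apply: nondecreasing_cvgn_le => //.
by apply/cvgP: cvgT.
Qed.

Let tail_le c k : (forall n, T (k + n)%N <= c) -> 1 <= c.
Proof.
move=> H; rewrite -(cvg_lim (@Rhausdorff R) cvgT); apply: limr_le.
  by apply/cvgP: cvgT.
near=> n; rewrite -(@subnKC k n); first exact: H.
by near: n; exact: nbhs_infty_ge.
Unshelve. all: by end_near. Qed.

(** Termwise: for [j >= k], [k * p j.+1] is at most [j.+1 * p j.+1], which is [lam * p j]. *)
Let tail_ratio k : k%:R * (1 - T k.+1) <= lam * (1 - T k).
Proof.
case: k => [|k]; first by rewrite mul0r mulr_ge0 ?subr_ge0// ltW.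
have k0 : 0 < k.+1%:R :> R by rewrite ltr0n.
rewrite -(ler_pdivlMl _ _ k0) lerBlDr.
apply: (@tail_le _ k.+2) => n; rewrite -lerBlDr ler_pdivlMl//.
apply: le_trans (_ : lam * (T (k.+1 + n)%N - T k.+1) <= _); last first.
  by rewrite ler_wpM2l ?(ltW lam0)// lerB.
elim: n => [|n IH]; first by rewrite !addn0 !subrr !mulr0.
rewrite (addnS k.+2) (addnS k.+1) (TS (k.+2 + n)) (TS (k.+1 + n)).
have : k.+1%:R * p (k.+2 + n) <= lam * p (k.+1 + n).
  by rewrite -pS ler_wpM2r ?(ltW (p_gt0 _))// ler_nat; lia.
by move: IH; rewrite -[(k.+2 + n)%N]/((k.+1 + n).+1) TS !mulrBr !mulrDr; lra.
Qed.

(** Since [lam * p j] equals [j.+1 * p j.+1], the left-hand side is a sum over the values 1 to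
    [k.+1]; hence the loss of [p 0]. *)
Let head_ratio k : lam * T k.+1 <= k.+1%:R * (T k.+2 - p 0).
Proof.
elim: k => [|k IH]; first by rewrite /T !big_nat_recr//= big_nil add0r addrAC subrr add0r pS.
rewrite TS mulrDr [in leRHS]TS addrAC [leRHS]mulrDr pS lerD//.
apply: le_trans IH _; rewrite ler_wpM2r ?ler_nat// subr_ge0.
by have := @ndT 1%N k.+2 isT; rewrite /T big_nat1.
Qed.

Let headF f k := \sum_(0 <= j < k) p j * f j.

(** Multiplied by [p k], the Stein equation telescopes because [lam * p k] equals
    [k.+1 * p k.+1]. *)
Lemma stein_partial_sum f k :
  k%:R * p k * stein lam f k = headF f k - pmean f lam * T k.
Proof.
elim: k => [|k IH]; first by rewrite /headF /T !mul0r !big_nil mulr0 subr0.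
rewrite pS /headF big_nat_recr//= -/(headF f k) TS.
rewrite -[lam * _ * _]/(lam * p k * stein lam f k.+1) mulrAC.
have /eqP := steinE lam0 f k; rewrite subr_eq => /eqP ->.
by rewrite mulrDl mulrAC IH; ring.
Qed.

Section indicator_like.
Variable f : nat -> R.
Hypotheses (f_ge0 : forall k, 0 <= f k) (f_le1 : forall k, f k <= 1).

Let gf : linear_growth f.
Proof. by apply: (@linear_growth_bounded _ 1) => k; rewrite ger0_norm. Qed.

Let headF_le k : headF f k <= pmean f lam.
Proof.
have cF := cvg_pmean (mu := lam) gf.
rewrite -(cvg_lim (@Rhausdorff R) cF); apply: nondecreasing_cvgn_le.
  by apply/nondecreasing_series => n _ _; rewrite mulr_ge0// ltW.
by apply/cvgP: cF.
Qed.

(** Split [pmean f lam] into the part below [m], the term at [m] and the tail. In the increment the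
    first part has a nonpositive coefficient by [tail_ratio], the tail by [head_ratio], and the term
    at [m] contributes at most [f m * (1 - p 0) / lam], again by [head_ratio]. *)
Lemma stein_fdiff_le k :
  stein lam f k.+2 - stein lam f k.+1 <= (1 - expR (- lam)) / lam.
Proof.
set m := k.+1; have m0 : 0 < m%:R :> R by rewrite ltr0n.
set x := stein lam f m; set y := stein lam f m.+1.
have E1 : m%:R * p m * x = _ := stein_partial_sum f m.
have E2 : m.+1%:R * p m.+1 * y = _ := stein_partial_sum f m.+1.
rewrite pS TS {1}/headF big_nat_recr//= -/(headF f m) in E2.
have F0 : 0 <= headF f m by apply: sumr_ge0 => i _; rewrite mulr_ge0// ltW.
have F1 := headF_le m.+1; rewrite {1}/headF big_nat_recr//= -/(headF f m) in F1.
have t1 := tail_ratio m; have t2 := head_ratio k.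
rewrite -/m TS in t2; rewrite TS in t1.
have pE : p 0 = expR (- lam) by rewrite /pmass expr0 fact0 divr1 mul1r.
have e0 : 0 <= 1 - expR (- lam) by rewrite subr_ge0 expR_le1 oppr_le0 ltW.
apply: (@le_trans _ _ (f m * ((1 - expR (- lam)) / lam))); last first.
  by rewrite ler_piMl// divr_ge0// ltW.
rewrite -pE; have q0 := p_gt0 m; have q1 := p_gt0 0%N.
have T0 := T_ge0 m.
move: x y E1 E2 => x y E1 E2.
move: (headF f m) (pmean f lam) (T m) (p m) (p 0%N) (f m) (f_ge0 m) F0 F1 t1 t2 E1 E2 q0 q1 T0.
move=> H Q t q q' fm fm0 H0 F1 t1 t2 E1 E2 q0 q1 T0.
move: (m%:R : R) m0 t1 t2 E1 => M M0 t1 t2 E1.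
have lM : 0 < lam * M * q by rewrite !mulr_gt0.
rewrite -(ler_pM2l lM).
have -> : lam * M * q * (y - x) = M * (lam * q * y) - lam * (M * q * x) by ring.
have -> : lam * M * q * (fm * ((1 - q') / lam)) = M * q * fm * (1 - q').
  by field; rewrite gt_eqF.
rewrite E1 E2.
have h1 := ler_wpM2l H0 t1.
have Fp0 : 0 <= Q - (H + q * fm) by rewrite subr_ge0.
have t2' : lam * t <= M * (t + q) by nra.
have h2 := ler_wpM2l Fp0 t2'.
have qf0 : 0 <= q * fm by rewrite mulr_ge0// ltW.
have h3 := ler_wpM2l qf0 t2.
by lra.
Qed.

End indicator_like.

(** Converts the upper bound on increments into a lower bound. *)
Lemma stein_compl f k : linear_growth f ->
  stein lam (fun j => 1 - f j) k = - stein lam f k.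
Proof.
move=> gf; have g1 : linear_growth (cst (1 : R)).
  by apply: (@linear_growth_bounded _ 1) => j; rewrite normr1.
elim: k => [|k IH]; first by rewrite oppr0.
rewrite /= IH (pmeanD (a := cst 1)) ?pmeanN ?pmean_cst//; last exact: linear_growthN.
by field; rewrite gt_eqF.
Qed.

Lemma stein_tv f k : (forall j, 0 <= f j <= 1) ->
  `|stein lam f k.+2 - stein lam f k.+1| <= Num.min 1 lam^-1.
Proof.
move=> f01; have f0 j : 0 <= f j by case/andP: (f01 j).
have f1 j : f j <= 1 by case/andP: (f01 j).
have gf : linear_growth f.
  by apply: (@linear_growth_bounded _ 1) => j; rewrite ger0_norm.
apply: (@le_trans _ _ ((1 - expR (- lam)) / lam)); last first.
  rewrite le_min ler_pdivrMr// mul1r; apply/andP; split.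
    by have := @expR_ge1Dx R (- lam); lra.
  by rewrite ler_piMl ?invr_ge0 ?(ltW lam0)// gerBl expR_ge0.
rewrite ler_norml stein_fdiff_le// andbT.
have := @stein_fdiff_le (fun j => 1 - f j) _ _ k.
rewrite !stein_compl// => /(_ _ _)/wrap[].
- by move=> j; rewrite subr_ge0.
- by move=> j; rewrite gerBl.
- by lra.
Qed.

Section lower_sets.
Variable v : nat.
Let f k : R := (k <= v)%N%:R.

Let gf : linear_growth f.
Proof. by apply: (@linear_growth_bounded _ 1) => j; rewrite /f normr_nat lern1 leq_b1. Qed.

Let headF_const k : (v < k)%N -> headF f k = T v.+1.
Proof.
move=> vk; rewrite /headF (@big_cat_nat _ _ _ v.+1)//= [X in _ + X]big_nat_cond.
rewrite [X in _ + X]big1 ?addr0; last first.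
  by move=> j /[!andbT] /andP[vj _]; rewrite /f leqNgt vj mulr0.
by apply: eq_big_nat => j /andP[_ jv]; rewrite /f -ltnS jv mulr1.
Qed.

Lemma pmean_lower_set : pmean f lam = T v.+1.
Proof.
have cF := cvg_pmean (mu := lam) gf.
rewrite -(cvg_lim (@Rhausdorff R) cF); apply: cvg_lim => //.
apply: cvg_near_cst; near=> n; apply: headF_const.
by near: n; exact: nbhs_infty_gt.
Unshelve. all: by end_near. Qed.

Lemma stein_lower_setE k : (v < k)%N ->
  k%:R * p k * stein lam f k = T v.+1 * (1 - T k).
Proof.
by move=> vk; rewrite stein_partial_sum headF_const// pmean_lower_set; ring.
Qed.

Lemma stein_lower_set_ge0 k : (v < k)%N -> 0 <= stein lam f k.
Proof.
move=> vk; have k0 : 0 < k%:R * p k by rewrite mulr_gt0// ltr0n (leq_trans _ vk).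
by rewrite -(ler_pM2l k0) mulr0 stein_lower_setE// mulr_ge0 ?T_ge0 ?subr_ge0.
Qed.

(** Above [v] the solution is proportional to the tail from [k] divided by [k * p k], so
    monotonicity amounts to [tail_ratio]. *)
Lemma stein_lower_set_nonincreasing k n : (v < k)%N ->
  stein lam f (k + n) <= stein lam f k.
Proof.
move=> vk; elim: n => [|n]; rewrite ?addn0// addnS; apply: le_trans.
have {vk} := ltn_addr n vk; move: (k + n)%N => {n}k vk.
have k0 : 0 < k%:R :> R by rewrite ltr0n (leq_trans _ vk).
have kp : 0 < lam * k%:R * p k by apply: mulr_gt0 => //; exact: mulr_gt0.
rewrite -(ler_pM2l kp).
have -> : lam * k%:R * p k * stein lam f k.+1 = k%:R * (k.+1%:R * p k.+1 * stein lam f k.+1).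
  by rewrite pS; ring.
have -> : lam * k%:R * p k * stein lam f k = lam * (k%:R * p k * stein lam f k) by ring.
rewrite !stein_lower_setE//; last exact: ltnW.
by rewrite mulrCA [leRHS]mulrCA ler_wpM2l.
Qed.

(** By monotonicity only [k = v.+2] matters. As [v.+1 <= lam], the weights increase up to [v], so
    the lower set has mass at most [v.+1 * p v]; comparing [p v] with [p v.+1] gives the second
    factor [v.+1 / lam]. *)
Lemma stein_lower_set_le k : v.+1%:R <= lam -> (v.+1 < k)%N ->
  stein lam f k <= v.+1%:R ^+ 2 / lam ^+ 2.
Proof.
move=> vlam vk; rewrite -(subnKC vk); apply: le_trans (stein_lower_set_nonincreasing _ _) _ => //.
have Tv : T v.+1 <= v.+1%:R * p v.
  have H j : (j <= v)%N -> p j <= p v.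
    move=> jv; rewrite -(subKn jv); elim: (v - j)%N (leq_subr j v) => [|i IH] iv; first by rewrite subn0.
    apply: le_trans (IH (ltnW iv)); set u := (v - i.+1)%N.
    have -> : (v - i = u.+1)%N by rewrite /u; lia.
    have u0 : 0 < u.+1%:R :> R by rewrite ltr0n.
    rewrite -(ler_pM2l u0) pS ler_wpM2r ?(ltW (p_gt0 _))//.
    by apply: le_trans vlam; rewrite ler_nat; lia.
  rewrite /T big_mkord; apply: le_trans (_ : \sum_(i < v.+1) p v <= _).
    by apply: ler_sum => i _; apply: H; rewrite -ltnS.
  by rewrite sumr_const card_ord mulr_natl.
have q0 : 0 < v.+2%:R * p v.+2 by rewrite mulr_gt0.
rewrite -(ler_pM2l q0) stein_lower_setE//.
apply: (@le_trans _ _ (v.+1%:R * p v)).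
  apply: le_trans Tv; rewrite ler_piMr ?T_ge0// gerBl; exact: T_ge0.
rewrite pS.
have -> : lam * p v.+1 * (v.+1%:R ^+ 2 / lam ^+ 2) = v.+1%:R * (v.+1%:R * p v.+1) / lam.
  by field; rewrite gt_eqF.
rewrite pS le_eqVlt; apply/orP; left; apply/eqP.
by field; rewrite gt_eqF.
Qed.

(** The numerator is [p 0] times a tail; bounding the tail by 1 leaves [p 0 / (lam * p k)]. *)
Lemma stein_zero_le_fact k : v = 0%N -> stein lam f k.+1 <= k`!%:R / lam ^+ k.+1.
Proof.
move=> v0; have q0 : 0 < k.+1%:R * p k.+1 by rewrite mulr_gt0.
rewrite -(ler_pM2l q0) stein_lower_setE// ?v0// pS.
have -> : T 1 = p 0 by rewrite /T big_nat1.
have -> : lam * p k * (k`!%:R / lam ^+ k.+1) = p 0.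
  rewrite /pmass expr0 fact0 divr1 mul1r exprS; field.
  by apply/and3P; split; rewrite ?expf_neq0 ?gt_eqF// ltr0n fact_gt0.
by rewrite ler_piMr ?(ltW (p_gt0 _))// gerBl T_ge0.
Qed.

(** Here the tail is kept: [p 0 * p (k.+1 + n) <= p k.+1 * p n], as binomial coefficients are at
    least 1, and summing over [n] bounds [p 0] times the tail by [p k.+1]. *)
Lemma stein_zero_le_inv k : v = 0%N -> stein lam f k.+1 <= k.+1%:R^-1.
Proof.
move=> v0; have q0 : 0 < k.+1%:R * p k.+1 by rewrite mulr_gt0.
rewrite -(ler_pM2l q0) stein_lower_setE// ?v0//.
have -> : T 1 = p 0 by rewrite /T big_nat1.
have -> : k.+1%:R * p k.+1 / k.+1%:R = p k.+1 by rewrite mulrAC mulfV ?mul1r// pnatr_eq0.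
rewrite -ler_pdivlMl// lerBlDr.
have H n : p 0 * p (k.+1 + n) <= p k.+1 * p n.
  elim: n => [|n IH]; first by rewrite addn0 mulrC.
  have n0 : 0 < n.+1%:R :> R by rewrite ltr0n.
  rewrite -(ler_pM2l n0) [leRHS]mulrCA pS.
  apply: (@le_trans _ _ (lam * (p 0 * p (k.+1 + n)))); last first.
    by rewrite [leRHS]mulrCA; apply: ler_wpM2l => //; exact: ltW.
  rewrite mulrCA [leRHS]mulrCA ler_wpM2l ?(ltW (p_gt0 _))// -pS addnS.
  by rewrite ler_wpM2r ?(ltW (p_gt0 _))// ler_nat; lia.
apply: (@tail_le _ k.+1) => n; rewrite -lerBlDr ler_pdivlMl//.
have -> : T (k.+1 + n) - T k.+1 = \sum_(0 <= j < n) p (k.+1 + j).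
  elim: n => [|n IH]; first by rewrite addn0 subrr big_nil.
  by rewrite addnS TS big_nat_recr//= -IH addrAC.
apply: (@le_trans _ _ (p k.+1 * T n)).
  by rewrite /T !mulr_sumr; apply: ler_sum => j _; exact: H.
by rewrite ler_piMr ?(ltW (p_gt0 _)).
Qed.

End lower_sets.

End stein_total_variation.

(** * Sums over subsequences and arrangements *)

Section subsequences.
Variable T : eqType.
Implicit Types (s t u : seq T) (l i : nat).

(** Selection is by position, so equal entries count separately, as do coinciding points of the
    process. *)
Fixpoint subs s l : seq (seq T) :=
  match s, l with
  | _, 0 => [:: [::]]
  | [::], _.+1 => [::]
  | x :: s', l'.+1 => subs s' l ++ [seq x :: u | u <- subs s' l']
  end.

Lemma subs0 s : subs s 0 = [:: [::]].
Proof. by case: s. Qed.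

Lemma size_mem_subs s l u : u \in subs s l -> size u = l.
Proof.
elim: s l u => [|x s IH] [|l] u //=; [by rewrite inE => /eqP ->..|].
by rewrite mem_cat => /orP[/IH//|/mapP[v /IH <- ->]].
Qed.

Lemma size_subs s l : size (subs s l) = 'C(size s, l).
Proof.
elim: s l => [|x s IH] [|l] //=.
by rewrite size_cat size_map !IH binS.
Qed.

Lemma subs_small s l : (size s < l)%N -> subs s l = [::].
Proof. by move=> sl; apply: size0nil; rewrite size_subs bin_small. Qed.

Lemma subs_size s : subs s (size s) = [:: s].
Proof. by elim: s => [//|x s IH] /=; rewrite subs_small// IH. Qed.

Section sums.
Variable M : nmodType.
Implicit Type F : seq T -> M.

Definition sum_subs F l s := \sum_(u <- subs s l) F u.

Lemma sum_subs0 F s : sum_subs F 0 s = F [::].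
Proof. by rewrite /sum_subs subs0 big_seq1. Qed.

Lemma sum_subs_nil F l : sum_subs F l.+1 [::] = 0.
Proof. by rewrite /sum_subs big_nil. Qed.

Lemma sum_subs_cons F l x s :
  sum_subs F l.+1 (x :: s) =
  sum_subs F l.+1 s + sum_subs (fun u => F (x :: u)) l s.
Proof. by rewrite /sum_subs /= big_cat big_map. Qed.

Lemma eq_sum_subs F F' l s : (forall u, size u = l -> F u = F' u) ->
  sum_subs F l s = sum_subs F' l s.
Proof. by move=> FF; apply: eq_big_seq => u /size_mem_subs; exact: FF. Qed.

(** Vandermonde convolution: [i] counts the entries taken from [s]. *)
Lemma sum_subs_cat F l s t :
  sum_subs F l (s ++ t) = \sum_(i < l.+1)
    sum_subs (fun a => sum_subs (fun b => F (a ++ b)) (l - i) t) i s.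
Proof.
elim: s l F => [|x s IH] [|l] F.
- by rewrite big_ord_recl big_ord0 addr0 !sum_subs0.
- rewrite big_ord_recl sum_subs0 big1 ?addr0// => i _.
  by rewrite lift0 sum_subs_nil.
- by rewrite big_ord_recl big_ord0 addr0 !sum_subs0.
- rewrite /= sum_subs_cons !IH [RHS]big_ord_recl !sum_subs0.
  rewrite [in LHS]big_ord_recl sum_subs0 -addrA; congr (_ + _).
  rewrite -big_split /=; apply: eq_bigr => i _.
  by rewrite /bump /= add1n subSS sum_subs_cons.
Qed.

Definition symmetric_on F := forall s t, perm_eq s t -> F s = F t.

Lemma symmetric_on_cons F x : symmetric_on F -> symmetric_on (fun u => F (x :: u)).
Proof. by move=> sF s t st; apply: sF; rewrite perm_cons. Qed.

Lemma sum_subs_middle F l x s t : symmetric_on F ->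
  sum_subs F l (s ++ x :: t) = sum_subs F l (x :: s ++ t).
Proof.
elim: s l F => [//|y s IH] [|l] F sF; first by rewrite !sum_subs0.
rewrite [in RHS]cat_cons cat_cons [LHS]sum_subs_cons !IH//; last exact: symmetric_on_cons.
case: l => [|l]; rewrite !sum_subs_cons ?sum_subs0; first by rewrite addrAC.
rewrite [LHS]addrACA; congr (_ + _ + (_ + _)).
by apply: eq_sum_subs => u _; apply: sF; rewrite -[y :: x :: u]/([:: y] ++ [:: x] ++ u) perm_catCA.
Qed.

Lemma symmetric_sum_subs F l : symmetric_on F -> symmetric_on (sum_subs F l).
Proof.
move=> + s; elim: s l F => [|x s IH] l F sF t; first by rewrite perm_sym => /perm_nilP ->.
move=> /[dup] /perm_mem/(_ x); rewrite mem_head => /esym/splitPr[t1 t2].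
rewrite perm_sym -cat1s perm_catCA perm_cons perm_sym => st.
rewrite sum_subs_middle//; case: l => [|l]; first by rewrite !sum_subs0.
by rewrite !sum_subs_cons (IH _ _ sF _ st) (IH _ _ (symmetric_on_cons _ sF) _ st).
Qed.

End sums.

Fixpoint picks s : seq (T * seq T) :=
  if s is x :: s' then (x, s') :: [seq (p.1, x :: p.2) | p <- picks s'] else [::].

(** Ordered selections of [l] positions without repetition, the finite counterpart of the tuples
    with distinct indices in the statistic. *)
Fixpoint arr s l : seq (seq T) :=
  if l is l'.+1 then flatten [seq [seq p.1 :: u | u <- arr p.2 l'] | p <- picks s]
  else [:: [::]].

Lemma picksP s p : p \in picks s -> perm_eq s (p.1 :: p.2).
Proof.
elim: s p => [//|x s IH] p /=; rewrite inE => /predU1P[->//|/mapP[q /IH qs -> /=]].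
by rewrite -(perm_cons x) in qs; apply: perm_trans qs _; rewrite (perm_catCA [:: x] [:: q.1] q.2).
Qed.

Lemma mem_picks s x : x \in s -> exists t, (x, t) \in picks s.
Proof.
elim: s => [//|y s IH] /=; rewrite inE => /predU1P[->|/IH[t tp]].
  by exists s; rewrite mem_head.
by exists (y :: t); rewrite inE; apply/orP; right; apply/mapP; exists (x, t).
Qed.

Lemma unzip1_picks s : unzip1 (picks s) = s.
Proof. by elim: s => //= x s IH; rewrite -[in RHS]IH /unzip1 -map_comp. Qed.

Lemma arrP s l u : uniq s ->
  (u \in arr s l) = [&& uniq u, size u == l & all (mem s) u].
Proof.
elim: l s u => [|l IH] s u us /=.
  by rewrite inE; case: u => //= x u; rewrite andbF.
apply/flatten_mapP/and3P => [[p ps /mapP[v vl ->]]|[]].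
  have pp := picksP ps; have : uniq (p.1 :: p.2) by rewrite -(perm_uniq pp).
  rewrite /= => /andP[p1 up2]; move: vl; rewrite IH// => /and3P[-> /eqP -> /allP vs].
  rewrite eqxx; split=> //.
    by rewrite andbT; apply: contra p1 => /vs.
  apply/andP; split; first by rewrite (perm_mem pp) mem_head.
  by apply/allP => y /vs /=; rewrite /= (perm_mem pp) inE => ->; rewrite orbT.
case: u => [//|x u] /= /andP[xu uu] sz /andP[xs uls].
have [t tp] := mem_picks xs; exists (x, t) => //; apply/mapP; exists u => //=.
have pp := picksP tp; have /= /andP[xt ut] : uniq (x :: t) by rewrite -(perm_uniq pp).
rewrite IH// uu -(eqn_add2r 1) !addn1 sz /=; apply/allP => y yu /=.
have := allP uls _ yu; rewrite /= (perm_mem pp) inE => /predU1P[yx|//].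
by rewrite yx (negbTE xu) in yu.
Qed.

Lemma uniq_arr s l : uniq s -> uniq (arr s l).
Proof.
elim: l s => [//|l IH] s us /=.
have : forall p, p \in picks s -> uniq p.2.
  move=> p /picksP pp; have /= : uniq (p.1 :: p.2) by rewrite -(perm_uniq pp).
  by case/andP.
have : uniq (unzip1 (picks s)) by rewrite unzip1_picks.
elim: (picks s) => [//|p ps IHp] /= /andP[p1 ups] up2.
have up : uniq [seq p.1 :: u | u <- arr p.2 l].
  by rewrite map_inj_uniq; [apply/IH/up2; rewrite mem_head|move=> u v []].
rewrite cat_uniq up IHp// ?andbT; last first.
  by move=> q qps; apply: up2; rewrite inE qps orbT.
apply/hasPn => u /flatten_mapP[q qps /mapP[v _ ->]]; apply/mapP => -[w _ [qp _]].
by move: p1; rewrite -qp; case/mapP; exists q.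
Qed.

Section arr_sums.
Variable M : nmodType.
Implicit Type F : seq T -> M.

Definition sum_arr F l s := \sum_(u <- arr s l) F u.

Lemma sum_arr0 F s : sum_arr F 0 s = F [::].
Proof. by rewrite /sum_arr big_seq1. Qed.

Lemma sum_arrS F l s :
  sum_arr F l.+1 s = \sum_(p <- picks s) sum_arr (fun u => F (p.1 :: u)) l p.2.
Proof.
by rewrite /sum_arr /= big_flatten big_map; apply: eq_bigr => p _; rewrite big_map.
Qed.

(** Each subsequence of length [l.+1] arises once for each of its entries taken as the picked
    one. *)
Lemma sum_picks_subs F l s : symmetric_on F ->
  \sum_(p <- picks s) sum_subs (fun u => F (p.1 :: u)) l p.2 =
  sum_subs F l.+1 s *+ l.+1.
Proof.
elim: s l F => [|x s IH] l F sF; first by rewrite big_nil sum_subs_nil mul0rn.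
rewrite /= big_cons big_map /= sum_subs_cons mulrnDl.
have sFx := symmetric_on_cons x sF.
case: l => [|l].
  rewrite sum_subs0 !mulr1n addrC; congr (_ + _).
  under eq_bigr do rewrite sum_subs0.
  have := IH 0%N F sF; rewrite mulr1n => <-.
  by apply: eq_bigr => p _; rewrite sum_subs0.
under eq_bigr do rewrite sum_subs_cons.
rewrite big_split /= IH//.
have -> : \sum_(p <- picks s) sum_subs (fun u => F [:: p.1, x & u]) l p.2 =
    sum_subs (fun u => F (x :: u)) l.+1 s *+ l.+1.
  rewrite -IH//; apply: eq_bigr => p _; apply: eq_sum_subs => u _; apply: sF.
  by rewrite (perm_catCA [:: p.1] [:: x] u).
by rewrite addrCA -mulrS.
Qed.

Lemma sum_arr_subs F l s : symmetric_on F ->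
  sum_arr F l s = sum_subs F l s *+ l`!.
Proof.
elim: l F s => [|l IH] F s sF; first by rewrite sum_arr0 sum_subs0.
rewrite sum_arrS.
rewrite (eq_bigr (fun p => sum_subs (fun u => F (p.1 :: u)) l p.2 *+ l`!)); last first.
  by move=> p _; rewrite IH//; exact: symmetric_on_cons.
by rewrite sumrMnl sum_picks_subs// -mulrnA factS.
Qed.

End arr_sums.

(** The colours are filled independently: the positions of colour [x] in [a] receive distinct
    entries of colour [x], which gives a falling factorial. *)
Lemma arr_color_count (C : finType) (c : T -> C) (a : seq C) s :
  count (fun u => map c u == a) (arr s (size a)) =
  (\prod_(x : C) (count_mem x (map c s)) ^_ (count_mem x a))%N.
Proof.
elim: a s => [|y a IH] s /=.
  by rewrite big1// => x _; rewrite ffactn0.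
rewrite count_flatten sumnE !big_map.
under eq_bigr => p _ do rewrite count_map.
have E p : p \in picks s ->
  count (preim (cons p.1) (fun u => map c u == y :: a)) (arr p.2 (size a)) =
  ((c p.1 == y) * \prod_(x : C) (count_mem x (map c s) - (x == y)) ^_ (count_mem x a))%N.
  move=> /picksP pp; have [cy|cy] := eqVneq (c p.1) y; last first.
    by rewrite mul0n -[RHS](count_pred0 (arr p.2 (size a))); apply: eq_count => u /=; rewrite eqseq_cons (negbTE cy).
  rewrite mul1n (eq_count (a2 := fun u => map c u == a)); last first.
    by move=> u /=; rewrite eqseq_cons cy eqxx.
  rewrite IH; apply: eq_bigr => x _; congr (_ ^_ _).
  rewrite (seq.permP (perm_map c pp)) /= cy [y == x]eq_sym; lia.
rewrite (eq_big_seq _ E) -big_distrl /=.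
have -> : (\sum_(p <- picks s) (c p.1 == y) = count_mem y (map c s))%N.
  rewrite -[in RHS](unzip1_picks s) -map_comp count_map.
  by elim: (picks s) => [|p ps IHp]; rewrite ?big_nil// big_cons IHp.
rewrite (bigD1 y)//= [RHS](bigD1 y)//= eqxx mulnA; congr (_ * _)%N.
  by rewrite subn1 -ffactnS add1n.
by apply: eq_bigr => x xy; rewrite (negbTE xy) subn0 [y == x]eq_sym (negbTE xy) add0n.
Qed.

End subsequences.

Lemma subs_map (T U : eqType) (f : T -> U) s l :
  subs (map f s) l = map (map f) (subs s l).
Proof.
elim: s l => [|x s IH] [|l] //=.
by rewrite map_cat !IH -!map_comp.
Qed.

Lemma picks_map (T U : eqType) (f : T -> U) s :
  picks (map f s) = [seq (f p.1, map f p.2) | p <- picks s].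
Proof. by elim: s => //= x s ->; rewrite -!map_comp. Qed.

Lemma arr_map (T U : eqType) (f : T -> U) s l :
  arr (map f s) l = map (map f) (arr s l).
Proof.
elim: l s => [//|l IH] s /=; rewrite picks_map -map_comp map_flatten -map_comp.
by congr flatten; apply: eq_map => p /=; rewrite IH -!map_comp.
Qed.

(** * Iterated integrals *)

Local Open Scope ereal_scope.

Section tuple_measurability.
Context d (T : measurableType d).

Lemma measurable_cat_tuple d1 (Z : measurableType d1) a b (f : Z -> a.-tuple T)
    (g : Z -> b.-tuple T) :
  measurable_fun setT f -> measurable_fun setT g ->
  measurable_fun setT (fun z => [tuple of f z ++ g z] : (a + b).-tuple T).
Proof.
move=> mf mg; apply/measurable_fun_tnthP => i; case: (split_ordP i) => j ->.
  rewrite (_ : _ \o _ = (@tnth _ T ^~ j) \o f); first exact: measurableT_comp (measurable_tnth j) mf.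
  by apply/funext => z /=; rewrite tnth_lshift.
rewrite (_ : _ \o _ = (@tnth _ T ^~ j) \o g); first exact: measurableT_comp (measurable_tnth j) mg.
by apply/funext => z /=; rewrite tnth_rshift.
Qed.

Lemma measurable_sub_tuple k i (q : i.-tuple 'I_k) :
  measurable_fun setT (fun t : k.-tuple T => map_tuple (tnth t) q).
Proof.
apply/measurable_fun_tnthP => j.
rewrite (_ : _ \o _ = (@tnth _ T ^~ (tnth q j))); first exact: measurable_tnth.
by apply/funext => t /=; rewrite tnth_map.
Qed.

End tuple_measurability.

Section sequence_functions.
Context d (T : measurableType d) (R : realType).

(** Measurability length by length, jointly with a parameter; Tonelli needs it when some of the
    points are integrated before others. *)
Definition jmeasurable d1 (Z : measurableType d1) (F : Z -> seq T -> \bar R) :=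
  forall k, measurable_fun setT (fun p : Z * k.-tuple T => F p.1 p.2).

Definition smeasurable (F : seq T -> \bar R) :=
  forall k, measurable_fun setT (fun t : k.-tuple T => F t).

Section joint.
Context d1 (Z : measurableType d1).
Implicit Types F G : Z -> seq T -> \bar R.

Lemma jmeasurable_section F z : jmeasurable F -> smeasurable (F z).
Proof.
move=> mF k; apply: (measurableT_comp (mF k) (g := fun t => (z, t))).
exact: measurable_pair1.
Qed.

Lemma jmeasurable_smeasurable (F : seq T -> \bar R) : smeasurable F ->
  jmeasurable (fun (_ : Z) => F).
Proof. by move=> mF k; exact: measurableT_comp (mF k) measurable_snd. Qed.

Lemma jmeasurable_comp d2 (Y : measurableType d2) (f : Y -> Z) F :
  measurable_fun setT f -> jmeasurable F -> jmeasurable (fun y => F (f y)).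
Proof.
move=> mf mF k.
apply: (measurableT_comp (mF k) (g := fun p : Y * k.-tuple T => (f p.1, p.2))).
apply/measurable_fun_pairP; split; last exact: measurable_snd.
exact: measurableT_comp mf measurable_fst.
Qed.

Lemma jmeasurable_cat a F : jmeasurable F ->
  jmeasurable (fun (p : Z * a.-tuple T) s => F p.1 (p.2 ++ s)).
Proof.
move=> mF k.
apply: (measurableT_comp (mF (a + k)%N)
  (g := fun p : (Z * a.-tuple T) * k.-tuple T => (p.1.1, [tuple of p.1.2 ++ p.2]))).
apply/measurable_fun_pairP; split.
  exact: measurableT_comp measurable_fst measurable_fst.
apply: measurable_cat_tuple; last exact: measurable_snd.
exact: measurableT_comp measurable_snd measurable_fst.
Qed.

Lemma jmeasurable_sum_subs i F : jmeasurable F ->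
  jmeasurable (fun z s => sum_subs (F z) i s).
Proof.
move=> mF k.
(* Selecting from the fixed index list makes the range of summation independent of the sequence. *)
have E (p : Z * k.-tuple T) : sum_subs (F p.1) i p.2 =
    \sum_(q <- subs (enum 'I_k) i) F p.1 (map (tnth p.2) q).
  by rewrite /sum_subs -[in LHS](map_tnth_enum p.2) subs_map big_map.
under eq_fun do rewrite E.
apply: emeasurable_sum => q.
apply: (measurableT_comp (mF (size q))
  (g := fun p : Z * k.-tuple T => (p.1, map_tuple (tnth p.2) (in_tuple q)))).
apply/measurable_fun_pairP; split; first exact: measurable_fst.
exact: measurableT_comp (measurable_sub_tuple _) measurable_snd.
Qed.

Lemma jmeasurableM F G : jmeasurable F -> jmeasurable G ->
  jmeasurable (fun z s => F z s * G z s).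
Proof. by move=> mF mG k; apply: emeasurable_funM; [exact: mF|exact: mG]. Qed.

End joint.

Lemma jmeasurable_catl d1 (Z : measurableType d1) (F : Z -> seq T -> \bar R) u :
  jmeasurable F -> jmeasurable (fun z s => F z (u ++ s)).
Proof.
move=> mF; apply: (jmeasurable_comp (f := fun z => (z, in_tuple u)) _ (jmeasurable_cat mF)).
by apply/measurable_fun_pairP; split; [exact: measurable_id|exact: measurable_cst].
Qed.

Lemma smeasurable_unit (F : seq T -> \bar R) :
  jmeasurable (fun (_ : unit) => F) -> smeasurable F.
Proof. exact: jmeasurable_section tt. Qed.

Lemma jmeasurable_scons (F : seq T -> \bar R) : smeasurable F ->
  jmeasurable (fun x s => F (x :: s)).
Proof.
move=> mF k; apply: (measurableT_comp (mF k.+1)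
  (g := fun p : T * k.-tuple T => [tuple of p.1 :: p.2])).
by apply: measurable_cons; [exact: measurable_fst|exact: measurable_snd].
Qed.

Lemma jmeasurable_scat a (F : seq T -> \bar R) : smeasurable F ->
  jmeasurable (fun (u : a.-tuple T) s => F (u ++ s)).
Proof.
move=> mF k; apply: (measurableT_comp (mF (a + k)%N)
  (g := fun p : a.-tuple T * k.-tuple T => [tuple of p.1 ++ p.2])).
by apply: measurable_cat_tuple; [exact: measurable_fst|exact: measurable_snd].
Qed.

Lemma smeasurable_cons (F : seq T -> \bar R) x : smeasurable F ->
  smeasurable (fun s => F (x :: s)).
Proof. by move=> /jmeasurable_scons; exact: jmeasurable_section. Qed.

Lemma smeasurable_cat (F : seq T -> \bar R) u : smeasurable F ->
  smeasurable (fun s => F (u ++ s)).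
Proof.
move=> mF; elim: u F mF => [//|x u IH] F mF.
by apply: (IH (fun s => F (x :: s))); exact: smeasurable_cons.
Qed.

Lemma smeasurable_sum_subs i (F : seq T -> \bar R) : smeasurable F ->
  smeasurable (sum_subs F i).
Proof.
move=> mF; apply: smeasurable_unit; apply: jmeasurable_sum_subs.
exact: jmeasurable_smeasurable.
Qed.

Lemma smeasurableM (F G : seq T -> \bar R) : smeasurable F -> smeasurable G ->
  smeasurable (fun s => F s * G s).
Proof. by move=> mF mG k; apply: emeasurable_funM; [exact: mF|exact: mG]. Qed.

Lemma smeasurableD (F G : seq T -> \bar R) : smeasurable F -> smeasurable G ->
  smeasurable (fun s => F s + G s).
Proof. by move=> mF mG k; apply: emeasurable_funD; [exact: mF|exact: mG]. Qed.

Lemma smeasurable_cst (c : \bar R) : smeasurable (fun=> c).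
Proof. by move=> k; exact: measurable_cst. Qed.

Lemma smeasurable_sum (I : Type) (r : seq I) (F : I -> seq T -> \bar R) :
  (forall i, smeasurable (F i)) -> smeasurable (fun s => \sum_(i <- r) F i s).
Proof. by move=> mF k; apply: emeasurable_sum => i; exact: mF. Qed.

End sequence_functions.

Section iterated_integral.
Context d (T : measurableType d) (R : realType).
Variable mu : {sigma_finite_measure set T -> \bar R}.
Implicit Types F G phi : seq T -> \bar R.

Definition sint k F : \bar R := \int[power_measure mu k]_t F t.

Lemma sint0 F : smeasurable F -> sint 0 F = F [::].
Proof.
by move=> mF; rewrite /sint /= integral_dirac//; [rewrite diracT mul1e|exact: mF].
Qed.

Lemma eq_sint k F G : (forall s, size s = k -> F s = G s) -> sint k F = sint k G.
Proof. by move=> FG; apply: eq_integral => t _; rewrite FG ?size_tuple. Qed.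

Lemma sint_cst0 k : sint k (fun=> 0) = 0.
Proof. exact: integral0. Qed.

Lemma sint_ge0 k F : (forall s, 0 <= F s) -> 0 <= sint k F.
Proof. by move=> F0; apply: integral_ge0. Qed.

Lemma le_sint k F G : smeasurable F -> smeasurable G -> (forall s, 0 <= F s) ->
  (forall s, size s = k -> F s <= G s) -> sint k F <= sint k G.
Proof.
move=> mF mG F0 FG; apply: ge0_le_integral => // [||t _].
- exact: mF.
- exact: mG.
- by apply: FG; rewrite size_tuple.
Qed.

Lemma sintD k F G : smeasurable F -> smeasurable G ->
  (forall s, 0 <= F s) -> (forall s, 0 <= G s) ->
  sint k (fun s => F s + G s) = sint k F + sint k G.
Proof.
move=> mF mG F0 G0; apply: ge0_integralD => //; [exact: mF|exact: mG].
Qed.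

Lemma sintZl k F c : smeasurable F -> (forall s, 0 <= F s) -> 0 <= c ->
  sint k (fun s => c * F s) = c * sint k F.
Proof. by move=> mF F0 c0; apply: ge0_integralZl => //; exact: mF. Qed.

Lemma sint_sum (I : Type) (r : seq I) k (F : I -> seq T -> \bar R) :
  (forall i, smeasurable (F i)) -> (forall i s, 0 <= F i s) ->
  sint k (fun s => \sum_(i <- r) F i s) = \sum_(i <- r) sint k (F i).
Proof.
by move=> mF F0; apply: ge0_integral_sum => // i; exact: mF.
Qed.

Lemma sintS k F : smeasurable F -> (forall s, 0 <= F s) ->
  sint k.+1 F = \int[mu]_x sint k (fun s => F (x :: s)).
Proof.
move=> mF F0; rewrite /sint /=.
rewrite ge0_integral_pushforward//; [|exact: measurable_cons_pair|exact: mF].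
rewrite preimage_setT fubini_tonelli1//=.
by apply: measurableT_comp; [exact: mF|exact: measurable_cons_pair].
Qed.

Lemma measurable_sint d1 (Z : measurableType d1) k (F : Z -> seq T -> \bar R) :
  jmeasurable F -> (forall z s, 0 <= F z s) ->
  measurable_fun setT (fun z => sint k (F z)).
Proof.
move=> mF F0.
exact: (@measurable_fun_fubini_tonelli_F _ _ _ _ _ (power_measure mu k)
  (fun p : Z * k.-tuple T => F p.1 p.2) (mF k) (fun p => F0 _ _)).
Qed.

Lemma sint_swap k (F : T -> seq T -> \bar R) :
  jmeasurable F -> (forall z s, 0 <= F z s) ->
  sint k (fun s => \int[mu]_x F x s) = \int[mu]_x sint k (F x).
Proof.
move=> mF F0; apply/esym.
exact: (@fubini_tonelli _ _ _ _ _ mu (power_measure mu k)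
  (fun p : T * k.-tuple T => F p.1 p.2) (mF k) (fun p => F0 _ _)).
Qed.

Lemma smeasurable_sint k F : smeasurable F -> (forall s, 0 <= F s) ->
  smeasurable (fun u => sint k (fun v => F (u ++ v))).
Proof. by move=> mF F0 a; apply: measurable_sint => //; exact: jmeasurable_scat. Qed.

Lemma sum_subs_ge0 i F s : (forall s, 0 <= F s) -> 0 <= sum_subs F i s.
Proof. by move=> F0; apply: sume_ge0 => u _; exact: F0. Qed.

(** By symmetry of [phi] each of the ['C(k, i)] selections may be moved to the front. The induction
    splits on whether the first point is selected, which is Pascal's rule. *)
Lemma sint_subs k i F phi : smeasurable F -> (forall s, 0 <= F s) ->
  smeasurable phi -> (forall s, 0 <= phi s) -> symmetric_on phi ->
  sint k (fun s => sum_subs F i s * phi s) =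
  'C(k, i)%:R%:E * sint i (fun u => F u * sint (k - i) (fun v => phi (u ++ v))).
Proof.
elim: k i F phi => [|k IH] [|i] F phi mF F0 mp p0 sp.
- have mR : smeasurable (fun u => F u * sint 0 (fun v => phi (u ++ v))).
    by apply: smeasurableM => //; exact: smeasurable_sint.
  rewrite bin0 mul1e !sint0//; first by rewrite sum_subs0.
  by apply: smeasurableM => //; exact: smeasurable_sum_subs.
- rewrite bin0n mul0e -[RHS](sint_cst0 0).
  by apply: eq_sint => s /size0nil ->; rewrite sum_subs_nil mul0e.
- have mR : smeasurable (fun u => F u * sint k.+1 (fun v => phi (u ++ v))).
    by apply: smeasurableM => //; exact: smeasurable_sint.
  rewrite bin0 mul1e subn0 sint0//= -sintZl//.
  by apply: eq_sint => s _; rewrite sum_subs0.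
have mjp : jmeasurable (fun x s => phi (x :: s)) by exact: jmeasurable_scons.
have mjF : jmeasurable (fun x s => F (x :: s)) by exact: jmeasurable_scons.
have mA : jmeasurable (fun x s => sum_subs F i.+1 s * phi (x :: s)).
  apply: jmeasurableM => //; apply: jmeasurable_smeasurable.
  exact: smeasurable_sum_subs.
have mB : jmeasurable (fun x s => sum_subs (fun u => F (x :: u)) i s * phi (x :: s)).
  by apply: jmeasurableM => //; exact: jmeasurable_sum_subs.
have A0 x s : 0 <= sum_subs F i.+1 s * phi (x :: s).
  by rewrite mule_ge0// sum_subs_ge0.
have B0 x s : 0 <= sum_subs (fun u => F (x :: u)) i s * phi (x :: s).
  by rewrite mule_ge0// sum_subs_ge0.
rewrite sintS; last 2 first.
- by apply: smeasurableM => //; exact: smeasurable_sum_subs.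
- by move=> s; rewrite mule_ge0// sum_subs_ge0.
transitivity (\int[mu]_x (sint k (fun s => sum_subs F i.+1 s * phi (x :: s)) +
    sint k (fun s => sum_subs (fun u => F (x :: u)) i s * phi (x :: s)))).
  apply: eq_integral => x _; rewrite -sintD//; last 2 first.
  - exact: jmeasurable_section mA.
  - exact: jmeasurable_section mB.
  by apply: eq_sint => s _; rewrite sum_subs_cons ge0_muleDl ?sum_subs_ge0.
rewrite ge0_integralD//; last 4 first.
- by move=> x _; exact: sint_ge0.
- exact: measurable_sint.
- by move=> x _; exact: sint_ge0.
- exact: measurable_sint.
have sx x : symmetric_on (fun s => phi (x :: s)) by exact: symmetric_on_cons.
have mx x : smeasurable (fun s => phi (x :: s)) by exact: smeasurable_cons.
have mFx x : smeasurable (fun s => F (x :: s)) by exact: smeasurable_cons.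
pose A x := sint i.+1 (fun u => F u * sint (k - i.+1) (fun v => phi (x :: u ++ v))).
pose B x := sint i (fun u => F (x :: u) * sint (k - i) (fun v => phi (x :: u ++ v))).
rewrite (eq_integral (fun x => 'C(k, i.+1)%:R%:E * A x)); last first.
  by move=> x _; rewrite IH.
rewrite [X in _ + X](eq_integral (fun x => 'C(k, i)%:R%:E * B x)); last first.
  by move=> x _; rewrite (IH i (fun u => F (x :: u))).
have mjc m : jmeasurable (fun x u => sint m (fun v => phi (x :: u ++ v))).
  move=> a; apply: measurable_sint => //.
  exact: (jmeasurable_cat (F := fun x s => phi (x :: s))).
have mAj : jmeasurable (fun x u => F u * sint (k - i.+1) (fun v => phi (x :: u ++ v))).
  by apply: jmeasurableM => //; exact: jmeasurable_smeasurable.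
have mBj : jmeasurable (fun x u => F (x :: u) * sint (k - i) (fun v => phi (x :: u ++ v))).
  exact: jmeasurableM.
have Aj0 x u : 0 <= F u * sint (k - i.+1) (fun v => phi (x :: u ++ v)).
  by rewrite mule_ge0// sint_ge0.
have Bj0 x u : 0 <= F (x :: u) * sint (k - i) (fun v => phi (x :: u ++ v)).
  by rewrite mule_ge0// sint_ge0.
have ZA (c : nat) : \int[mu]_x (c%:R%:E * A x) = c%:R%:E * \int[mu]_x A x.
  by rewrite ge0_integralZl ?lee_fin//; [exact: measurable_sint|move=> x _; exact: sint_ge0].
have ZB (c : nat) : \int[mu]_x (c%:R%:E * B x) = c%:R%:E * \int[mu]_x B x.
  by rewrite ge0_integralZl ?lee_fin//; [exact: measurable_sint|move=> x _; exact: sint_ge0].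
rewrite ZA ZB.
pose H u := F u * sint (k - i) (fun v => phi (u ++ v)).
have mH : smeasurable H by apply: smeasurableM => //; exact: smeasurable_sint.
have H0 u : 0 <= H u by rewrite mule_ge0// sint_ge0.
have -> : \int[mu]_x B x = sint i.+1 H by rewrite [RHS]sintS.
have -> : 'C(k, i.+1)%:R%:E * \int[mu]_x A x = 'C(k, i.+1)%:R%:E * sint i.+1 H.
  (* If [k <= i] the coefficient is 0. Otherwise the unselected block is nonempty, and by symmetry
     [x] may be taken as its first variable. *)
  have [ki|ik] := ltnP k i.+1; first by rewrite bin_small// !mul0e.
  congr (_ * _); rewrite -sint_swap//; apply: eq_sint => u _.
  rewrite ge0_integralZl//; last 2 first.
  - apply: measurable_sint => //.
    exact: (jmeasurable_catl (F := fun x s => phi (x :: s))).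
  - by move=> x _; exact: sint_ge0.
  rewrite /H; congr (_ * _); rewrite -(subnSK ik) sintS//; last first.
    exact: smeasurable_cat.
  apply: eq_integral => x _; apply: eq_sint => v _; apply: sp.
  by rewrite -cat1s perm_catCA.
by rewrite subSS -ge0_muleDl ?lee_fin// -EFinD -natrD binS.
Qed.

End iterated_integral.

(** * Poisson series of iterated integrals and the Mecke formula *)

Section poisson_integral.
Context d (T : measurableType d) (R : realType).
Variables (mu : {sigma_finite_measure set T -> \bar R}) (Lam : R).
Implicit Types (F G phi : seq T -> \bar R) (c : R).

Let w k : R := (expR (- Lam) / k`!%:R)%R.

Let w_ge0 k : (0 <= w k)%R.
Proof. by rewrite divr_ge0 ?expR_ge0. Qed.

(* When [mu] has total mass [Lam], this is the mean of [F] at the list of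
   points of a Poisson process with intensity [mu]. *)
Definition pint F : \bar R := \sum_(0 <= k <oo) (w k)%:E * sint mu k F.

Let term_ge0 F k : (forall s, 0 <= F s) -> 0 <= (w k)%:E * sint mu k F.
Proof. by move=> F0; rewrite mule_ge0 ?lee_fin ?sint_ge0. Qed.

Lemma pint_ge0 F : (forall s, 0 <= F s) -> 0 <= pint F.
Proof. by move=> F0; apply: nneseries_ge0 => k _ _; exact: term_ge0. Qed.

Lemma eq_pint F G : (forall s, F s = G s) -> pint F = pint G.
Proof. by move=> FG; congr pint; exact/funext. Qed.

Lemma le_pint F G : smeasurable F -> smeasurable G -> (forall s, 0 <= F s) ->
  (forall s, F s <= G s) -> pint F <= pint G.
Proof.
move=> mF mG F0 FG; apply: lee_nneseries => k _; first by move=> ?; exact: term_ge0.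
by rewrite lee_wpmul2l ?lee_fin// le_sint.
Qed.

Lemma pintD F G : smeasurable F -> smeasurable G ->
  (forall s, 0 <= F s) -> (forall s, 0 <= G s) ->
  pint (fun s => F s + G s) = pint F + pint G.
Proof.
move=> mF mG F0 G0; rewrite /pint -nneseriesD; last 2 first.
- by move=> k _ _; exact: term_ge0.
- by move=> k _ _; exact: term_ge0.
by apply: eq_eseriesr => k _; rewrite sintD// ge0_muleDr// sint_ge0.
Qed.

Lemma pint_cst0 : pint (fun=> 0) = 0.
Proof. by apply: eseries0 => k _ _; rewrite sint_cst0 mule0. Qed.

Lemma pint_sum (I : Type) (r : seq I) (F : I -> seq T -> \bar R) :
  (forall i, smeasurable (F i)) -> (forall i s, 0 <= F i s) ->
  pint (fun s => \sum_(i <- r) F i s) = \sum_(i <- r) pint (F i).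
Proof.
move=> mF F0; elim: r => [|i r IH].
  by rewrite big_nil -[RHS]pint_cst0; apply: eq_pint => s; rewrite big_nil.
rewrite big_cons -IH -pintD//; last 2 first.
- exact: smeasurable_sum.
- by move=> s; exact: sume_ge0.
by apply: eq_pint => s; rewrite big_cons.
Qed.

Lemma smeasurable_pint F : smeasurable F -> (forall s, 0 <= F s) ->
  smeasurable (fun u => pint (fun v => F (u ++ v))).
Proof.
move=> mF F0 a; apply: ge0_emeasurable_sum => [k t _ _|k _].
  by apply: term_ge0.
apply: measurable_funeM; exact: (smeasurable_sint mu k mF F0).
Qed.

(** The Mecke formula for [i] points: with [k = j + i], the factor ['C(k, i)] of [sint_subs] over
    [k!] is [1 / (i! j!)], and [1 / j!] is the Poisson weight of the remaining points. *)
Lemma pint_subs i (f : seq T -> R) phi : smeasurable (EFin \o f) ->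
  (forall s, 0 <= f s)%R ->
  smeasurable phi -> (forall s, 0 <= phi s) -> symmetric_on phi ->
  pint (fun s => sum_subs (EFin \o f) i s * phi s) =
  (i`!%:R^-1)%:E * sint mu i (fun u => (f u)%:E * pint (fun v => phi (u ++ v))).
Proof.
move=> mf f0 mp p0 sp.
have F0 s : 0 <= (EFin \o f) s by rewrite lee_fin.
have mpu u : smeasurable (fun v => phi (u ++ v)) by exact: smeasurable_cat.
pose A j u := (w j)%:E * sint mu j (fun v => phi (u ++ v)).
have A0 j u : 0 <= A j u by exact: term_ge0.
have mA j : smeasurable (A j).
  by move=> a; apply: measurable_funeM; exact: (smeasurable_sint mu j mp p0).
have mfA j : smeasurable (fun u => (f u)%:E * A j u) by exact: smeasurableM.
rewrite /pint (@nneseries_split _ _ 0 i); last first.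
  by move=> k _; apply: term_ge0 => s; rewrite mule_ge0// sum_subs_ge0.
rewrite add0n big_nat big1 ?add0e; last first.
  by move=> k /andP[_ ki]; rewrite sint_subs// bin_small// mul0e mule0.
rewrite -nneseries_addn; last first.
  by move=> k; apply: term_ge0 => s; rewrite mule_ge0// sum_subs_ge0.
transitivity (\sum_(0 <= j <oo) (i`!%:R^-1)%:E * sint mu i (fun u => (f u)%:E * A j u)).
  apply: eq_eseriesr => j _; rewrite sint_subs// addnK.
  have -> : sint mu i (fun u => (f u)%:E * A j u) =
      (w j)%:E * sint mu i (fun u => (f u)%:E * sint mu j (fun v => phi (u ++ v))).
    rewrite -sintZl//; first by apply: eq_sint => u _; rewrite muleCA.
    - by apply: smeasurableM => //; exact: smeasurable_sint.
    - by move=> u; apply: mule_ge0; [rewrite lee_fin|exact: sint_ge0].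
    - by rewrite lee_fin.
  rewrite !muleA -!EFinM; congr (_%:E * _); rewrite /w.
  have -> : ((j + i)`!%:R = 'C(j + i, i)%:R * (i`!%:R * j`!%:R) :> R)%R.
    by rewrite -!natrM -(bin_fact (leq_addl j i)) addnK.
  have c0 : ('C(j + i, i)%:R != 0 :> R)%R by rewrite pnatr_eq0 -lt0n bin_gt0 leq_addl.
  have fi : (i`!%:R != 0 :> R)%R by rewrite pnatr_eq0 -lt0n fact_gt0.
  have fj : (j`!%:R != 0 :> R)%R by rewrite pnatr_eq0 -lt0n fact_gt0.
  by field; rewrite c0 fi fj.
rewrite nneseriesZl; last first.
  by move=> j _; apply: sint_ge0 => u; rewrite mule_ge0// lee_fin.
congr (_ * _); rewrite /sint -integral_nneseries//; last 2 first.
- by move=> j; exact: mfA.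
- by move=> j u _; rewrite mule_ge0// lee_fin.
by apply: eq_integral => u _; rewrite nneseriesZl// => j _; exact: A0.
Qed.

End poisson_integral.

Lemma sum_subs_natE (T : eqType) (R : realType) (f : seq T -> nat) i s :
  (sum_subs f i s)%:R%:E = sum_subs (fun u => (f u)%:R%:E : \bar R) i s.
Proof. by rewrite /sum_subs natr_sum sumEFin. Qed.

Lemma ge0_sum_subsZr (T : eqType) (R : realType) (F : seq T -> \bar R) i s c :
  (forall s, 0 <= F s) -> sum_subs F i s * c = sum_subs (fun u => F u * c) i s.
Proof. by move=> F0; rewrite /sum_subs ge0_sume_distrl. Qed.

(** * Coupling by added points for the counting statistic *)

Section counting_statistic.
Context d (T : measurableType d) (R : realType).
Variables (l : nat) (h : seq T -> bool).
Hypothesis l_gt0 : (0 < l)%N.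
Hypothesis h_sym : forall s t, perm_eq s t -> h s = h t.

Let hn u : nat := h u.
Let hE u : \bar R := (hn u)%:R%:E.

Hypothesis h_meas : smeasurable hE.

(** Unordered selections absorb the factor [1 / l!], so the statistic is a natural number by
    construction. *)
Definition nstat s : nat := sum_subs (fun u => h u : nat) l s.

Local Notation V := nstat.

(** The mixed terms of [sum_subs_cat]: [i] points from the added [u], [l - i] from the configuration
    [v]. The two extreme indices give the old statistic and [h u]. *)
Definition extra u v : nat :=
  (\sum_(1 <= i < l) sum_subs (fun a => sum_subs (fun b => hn (a ++ b)) (l - i) v) i u)%N.

Let hE_ge0 u : 0 <= hE u. Proof. by rewrite lee_fin. Qed.

Let hn_sym : symmetric_on hn.
Proof. by move=> s t st; rewrite /hn (h_sym st). Qed.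

Let hE_sym : symmetric_on hE.
Proof. by move=> s t st; rewrite /hE /hn (h_sym st). Qed.

Lemma nstat_sym : symmetric_on V.
Proof. exact: symmetric_sum_subs hn_sym. Qed.

Lemma nstat_cat u v : size u = l -> V (u ++ v) = (V v + h u + extra u v)%N.
Proof.
move=> ul; rewrite /V sum_subs_cat.
transitivity
  (\sum_(0 <= i < l.+1) sum_subs (fun a => sum_subs (fun b => hn (a ++ b)) (l - i) v) i u)%N.
  by rewrite big_mkord.
rewrite big_nat_recr//= big_ltn// sum_subs0 subn0 subnn -/(extra u v).
rewrite [X in (_ + X)%N](_ : _ = hn u); first by rewrite addnAC.
by rewrite /sum_subs -[in subs u _]ul subs_size big_seq1 -/(sum_subs _ 0 v) sum_subs0 cats0.
Qed.

Lemma nstat_cat_ge u v : (V v <= V (u ++ v))%N.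
Proof.
rewrite /V sum_subs_cat big_ord_recl sum_subs0 subn0.
exact: leq_addr.
Qed.

Lemma smeasurable_nstat (phi : nat -> R) : smeasurable (fun s => (phi (V s))%:E).
Proof.
move=> k; apply: (measurableT_comp (f := fun n : nat => (phi n)%:E)) => //.
have mV : measurable_fun setT (fun t : k.-tuple T => (V t)%:R%:E : \bar R).
  have := smeasurable_sum_subs l h_meas (k := k).
  by under eq_fun do rewrite -sum_subs_natE.
move=> _ A _; rewrite setTI.
have -> : (fun t : k.-tuple T => V t) @^-1` A =
    \bigcup_(n in A) ((fun t : k.-tuple T => (V t)%:R%:E : \bar R) @^-1` [set n%:R%:E]).
  apply/seteqP; split => [t /= At|t [n An /= [/eqP]]]; first by exists (V t).
  by rewrite eqr_nat => /eqP ->.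
apply: bigcup_measurable => n _; rewrite -[X in measurable X]setTI.
exact: mV.
Qed.

Variables (mu : {sigma_finite_measure set T -> \bar R}) (Lam : R).

Local Notation M := (pint mu Lam).

Definition rterm i : \bar R :=
  sint mu i (fun a => sint mu (l - i) (fun b => hE (a ++ b)) ^+ 2).

(** The constant produced by the argument: ['C(l, i)] selects the reused new points, [l!] and
    [(l - i)!] come from the two uses of the Mecke formula. *)
Definition rsum : \bar R :=
  \sum_(1 <= i < l) ('C(l, i)%:R / (l`!%:R * (l - i)`!%:R))%:E * rterm i.

Section decreasing.
Variable psi : nat -> R.
Hypothesis psi_ge0 : forall n, (0 <= psi n)%R.
Hypothesis psi_dec : forall n m, (n <= m)%N -> (psi m <= psi n)%R.

Let psiV s : \bar R := (psi (V s))%:E.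

Let psiV_ge0 s : 0 <= psiV s. Proof. by rewrite lee_fin. Qed.

Let m := M psiV.

Let m_ge0 : 0 <= m. Proof. exact: pint_ge0. Qed.

Let N i a := M (fun v => sum_subs (fun b => hE (a ++ b)) (l - i) v * psiV v).

Let N_ge0 i a : 0 <= N i a.
Proof. by apply: pint_ge0 => v; rewrite mule_ge0// sum_subs_ge0. Qed.

Let mpsiV : smeasurable psiV := smeasurable_nstat psi.

Let mhE a : smeasurable (fun b => hE (a ++ b)).
Proof. exact: smeasurable_cat. Qed.

(** The Mecke formula adds the points [b] that complete [a]; they can only raise the statistic,
    hence lower [psi], and may then be dropped. This is where monotonicity of [psi] enters. *)
Let N_le i a :
  N i a <= ((l - i)`!%:R^-1)%:E * (m * sint mu (l - i) (fun b => hE (a ++ b))).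
Proof.
rewrite /N; have := @pint_subs _ T R mu Lam (l - i) (fun b => (hn (a ++ b))%:R) psiV.
rewrite /comp => -> //; last first.
  by move=> s t st; rewrite /psiV (nstat_sym st).
  exact: mhE.
rewrite lee_wpmul2l ?lee_fin// -sintZl//; apply: le_sint.
- by apply: smeasurableM; [exact: mhE|exact: smeasurable_pint].
- by apply: smeasurableM => //; exact: smeasurable_cst.
- by move=> s; rewrite mule_ge0 ?lee_fin// pint_ge0.
move=> b _; rewrite muleC lee_wpmul2r//.
apply: le_pint => //; first exact: smeasurable_cat.
by move=> v; rewrite lee_fin psi_dec// nstat_cat_ge.
Qed.

Let smN i : smeasurable (N i).
Proof.
move=> a; apply: ge0_emeasurable_sum => [k t _ _|k _].
  rewrite mule_ge0 ?lee_fin ?divr_ge0 ?expR_ge0// sint_ge0// => s.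
  by rewrite mule_ge0// sum_subs_ge0.
apply: measurable_funeM; apply: measurable_sint => [|t s]; last first.
  by rewrite mule_ge0// sum_subs_ge0.
apply: jmeasurableM; last exact: jmeasurable_smeasurable.
by apply: jmeasurable_sum_subs; exact: jmeasurable_scat.
Qed.

Let extraE u v : (extra u v)%:R%:E =
  \sum_(1 <= i < l) sum_subs (fun a => sum_subs (fun b => hE (a ++ b)) (l - i) v) i u.
Proof.
rewrite /extra natr_sum -sumEFin; apply: eq_bigr => i _; rewrite sum_subs_natE.
by apply: eq_sum_subs => a _; rewrite sum_subs_natE.
Qed.

Let pint_extra u : M (fun v => (extra u v)%:R%:E * psiV v) =
  \sum_(1 <= i < l) sum_subs (N i) i u.
Proof.
have sm i a : smeasurable (fun v => sum_subs (fun b => hE (a ++ b)) (l - i) v * psiV v).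
  by apply: smeasurableM => //; exact: smeasurable_sum_subs.
have s0 i a v : 0 <= sum_subs (fun b => hE (a ++ b)) (l - i) v * psiV v.
  by rewrite mule_ge0// sum_subs_ge0.
transitivity (M (fun v => \sum_(1 <= i < l) \sum_(a <- subs u i)
    sum_subs (fun b => hE (a ++ b)) (l - i) v * psiV v)).
  apply: eq_pint => v; rewrite extraE ge0_sume_distrl; last first.
    by move=> i _; apply: sum_subs_ge0 => a; exact: sum_subs_ge0.
  apply: eq_bigr => i _; rewrite ge0_sum_subsZr//.
  by move=> a; exact: sum_subs_ge0.
rewrite pint_sum; last 2 first.
- by move=> i; exact: smeasurable_sum.
- by move=> i v; exact: sume_ge0.
by apply: eq_bigr => i _; rewrite pint_sum.
Qed.

(** Integrating out the new points not reused gives one factor, the integral of [h] over completions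
    of [a]; [N_le] gives the same factor again. This is the origin of the square in [rterm]. *)
Lemma extra_bound :
  (l`!%:R^-1)%:E * sint mu l (fun u => hE u * M (fun v => (extra u v)%:R%:E * psiV v)) <=
  rsum * m.
Proof.
have -> : sint mu l (fun u => hE u * M (fun v => (extra u v)%:R%:E * psiV v)) =
    \sum_(1 <= i < l) 'C(l, i)%:R%:E *
      sint mu i (fun a => N i a * sint mu (l - i) (fun b => hE (a ++ b))).
  transitivity (sint mu l (fun u => \sum_(1 <= i < l) sum_subs (N i) i u * hE u)).
    apply: eq_sint => u _; rewrite pint_extra muleC ge0_sume_distrl// => i _.
    exact: sum_subs_ge0.
  rewrite sint_sum; last 2 first.
  - by move=> i; apply: smeasurableM => //; exact: smeasurable_sum_subs.
  - by move=> i u; rewrite mule_ge0// sum_subs_ge0.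
  by apply: eq_bigr => i _; rewrite sint_subs.
have mr i : smeasurable (fun a => sint mu (l - i) (fun b => hE (a ++ b))).
  exact: smeasurable_sint.
have r0 i : 0 <= rterm i.
  by apply: sint_ge0 => a; rewrite expe2 mule_ge0// sint_ge0.
rewrite ge0_sume_distrr; last first.
  move=> i _; rewrite mule_ge0 ?lee_fin// sint_ge0// => a.
  by rewrite mule_ge0// sint_ge0.
rewrite /rsum ge0_sume_distrl; last first.
  by move=> i _; rewrite mule_ge0// lee_fin divr_ge0// mulr_ge0.
apply: lee_sum => i _.
apply: (@le_trans _ _ ((l`!%:R^-1)%:E * ('C(l, i)%:R%:E *
    (((l - i)`!%:R^-1)%:E * (m * rterm i))))).
  rewrite !lee_wpmul2l ?lee_fin//.
  have z0 a : 0 <= sint mu (l - i) (fun b => hE (a ++ b)) by exact: sint_ge0.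
  have m2 : smeasurable (fun a => sint mu (l - i) (fun b => hE (a ++ b)) ^+ 2).
    have -> : (fun a => sint mu (l - i) (fun b => hE (a ++ b)) ^+ 2) = (fun a =>
        sint mu (l - i) (fun b => hE (a ++ b)) * sint mu (l - i) (fun b => hE (a ++ b))).
      by apply/funext => a; rewrite expe2.
    exact: smeasurableM.
  rewrite /rterm -sintZl//; last by move=> a; rewrite expe2 mule_ge0.
  rewrite -sintZl ?lee_fin//; last 2 first.
  - by apply: smeasurableM => //; exact: smeasurable_cst.
  - by move=> a; rewrite mule_ge0// expe2 mule_ge0.
  apply: le_sint.
  - exact: smeasurableM.
  - apply: smeasurableM; first exact: smeasurable_cst.
    by apply: smeasurableM => //; exact: smeasurable_cst.
  - by move=> a; rewrite mule_ge0.
  by move=> a _; rewrite expe2 !muleA lee_wpmul2r// -muleA; exact: N_le.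
rewrite !muleA -!EFinM [X in _ <= X]muleAC.
suff -> : (l`!%:R^-1 * 'C(l, i)%:R / (l - i)`!%:R =
  'C(l, i)%:R / (l`!%:R * (l - i)`!%:R) :> R)%R by [].
by rewrite invfM; ring.
Qed.

Variable G : nat -> R.
Hypothesis G_ge0 : forall n, (0 <= G n)%R.

Let GV s : \bar R := (G (V s))%:E.

Let GS s : \bar R := (G (V s).+1)%:E.

Let mean := (l`!%:R^-1)%:E * sint mu l hE.

Let mGV : smeasurable GV := smeasurable_nstat G.

Let mGS : smeasurable GS := smeasurable_nstat (fun n => G n.+1).

Let ex u v : \bar R := (extra u v)%:R%:E * psiV v.

Let ex_ge0 u v : 0 <= ex u v. Proof. by rewrite mule_ge0// lee_fin. Qed.

Let mex u : smeasurable (ex u).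
Proof.
apply: smeasurableM => //.
rewrite (_ : (fun v => _) = (fun v => \sum_(1 <= i < l)
    sum_subs (fun a => sum_subs (fun b => hE (a ++ b)) (l - i) v) i u)); last first.
  by apply/funext => v; rewrite extraE.
apply: smeasurable_sum => i; apply: smeasurable_sum => a.
exact: smeasurable_sum_subs.
Qed.

Let smMex : smeasurable (fun u => M (ex u)).
Proof.
rewrite (_ : (fun u => _) = (fun u => \sum_(1 <= i < l) sum_subs (N i) i u)); last first.
  by apply/funext => u; rewrite /ex pint_extra.
by apply: smeasurable_sum => i; exact: smeasurable_sum_subs.
Qed.

Let campbell : M (fun s => (V s)%:R%:E * GV s) =
  (l`!%:R^-1)%:E * sint mu l (fun u => hE u * M (fun v => GV (u ++ v))).
Proof.
have := @pint_subs _ T R mu Lam l (fun u => (hn u)%:R) GV h_meas _ mGV.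
move=> <- //; [|by move=> s; rewrite lee_fin|].
  by congr pint; apply/funext => s; rewrite sum_subs_natE.
by move=> s t st; rewrite /GV (nstat_sym st).
Qed.

Let mean_shift : mean * M GS = (l`!%:R^-1)%:E * sint mu l (fun u => hE u * M GS).
Proof.
have M0 : 0 <= M GS by apply: pint_ge0 => s; rewrite lee_fin.
rewrite /mean -muleA; congr (_ * _); rewrite muleC -sintZl//.
by apply: eq_sint => u _; rewrite muleC.
Qed.

Let GV_ge0 s : 0 <= GV s. Proof. by rewrite lee_fin. Qed.

Let GS_ge0 s : 0 <= GS s. Proof. by rewrite lee_fin. Qed.

Let smGV : smeasurable (fun u => hE u * M (fun v => GV (u ++ v))).
Proof. by apply: smeasurableM => //; exact: smeasurable_pint. Qed.

Let smGS : smeasurable (fun u => hE u * M GS).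
Proof. by apply: smeasurableM => //; exact: smeasurable_cst. Qed.

Let smEx : smeasurable (fun u => hE u * M (ex u)).
Proof. exact: smeasurableM. Qed.

Let hM_ge0 u F : (forall v, 0 <= F v) -> 0 <= hE u * M F.
Proof. by move=> F0; rewrite mule_ge0// pint_ge0. Qed.

Let nstat_add u v : size u = l -> h u -> V (u ++ v) = ((V v).+1 + extra u v)%N.
Proof. by move=> ul hu; rewrite nstat_cat// hu addn1. Qed.

(** Only [u] with [h u] contribute, so [A] and [B] need to be compared for these alone; the
    integrated error is covered by [extra_bound]. *)
Let coupling (A B : seq T -> seq T -> \bar R) :
  smeasurable (fun u => hE u * M (A u)) -> smeasurable (fun u => hE u * M (B u)) ->
  (forall u, smeasurable (A u)) -> (forall u, smeasurable (B u)) ->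
  (forall u v, 0 <= A u v) -> (forall u v, 0 <= B u v) ->
  (forall u v, size u = l -> h u -> A u v <= B u v + ex u v) ->
  (l`!%:R^-1)%:E * sint mu l (fun u => hE u * M (A u)) <=
  (l`!%:R^-1)%:E * sint mu l (fun u => hE u * M (B u)) + rsum * m.
Proof.
move=> smA smB mA mB A0 B0 AB; apply: le_trans (leeD2l _ extra_bound).
have B0' u : 0 <= hE u * M (B u) by exact: hM_ge0.
have ex0' u : 0 <= hE u * M (ex u) by apply: hM_ge0 => v; exact: ex_ge0.
rewrite -ge0_muleDr ?sint_ge0// -sintD// lee_wpmul2l ?lee_fin//.
apply: le_sint => //; [exact: smeasurableD|by move=> u; exact: hM_ge0|].
move=> u ul; have e1 : 0 <= M (B u) by exact: pint_ge0.
have e2 : 0 <= M (ex u) by apply: pint_ge0 => v; exact: ex_ge0.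
rewrite -[M (fun v => _ * psiV v)]/(M (ex u)) -ge0_muleDr// -pintD//.
rewrite /hE /hn; case hu : (h u); last by rewrite !mul0e.
rewrite !mul1e; apply: le_pint => //; first exact: smeasurableD.
by move=> v; exact: AB.
Qed.

(** In the hypothesis [s] is the statistic before adding points and [n] the value of [extra].
    Avoiding subtraction keeps all integrands nonnegative. *)
Lemma stein_chen_upper :
  (forall s n, G s.+1 <= G (s.+1 + n)%N + n%:R * psi s)%R ->
  mean * M GS <= M (fun s => (V s)%:R%:E * GV s) + rsum * m.
Proof.
move=> HG; rewrite campbell mean_shift; apply: coupling => //.
- by move=> u; exact: smeasurable_cat.
- by move=> u v ul hu; rewrite /GV /GS /ex /psiV nstat_add// -EFinM -EFinD lee_fin.
Qed.

Lemma stein_chen_lower :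
  (forall s n, G (s.+1 + n)%N <= G s.+1 + n%:R * psi s)%R ->
  M (fun s => (V s)%:R%:E * GV s) <= mean * M GS + rsum * m.
Proof.
move=> HG; rewrite campbell mean_shift; apply: coupling => //.
- by move=> u; exact: smeasurable_cat.
- by move=> u v ul hu; rewrite /GV /GS /ex /psiV nstat_add// -EFinM -EFinD lee_fin.
Qed.

End decreasing.

End counting_statistic.

(** * Points of a point process *)

Section esum_lemmas.
Variable R : realType.

Lemma esum_countable (C : countType) (a : C -> \bar R) : (forall c, 0 <= a c) ->
  \esum_(c in [set: C]) a c = \sum_(0 <= n <oo) oapp a 0 (@pickle_inv C n).
Proof.
move=> a0; rewrite nneseries_esumT; last by move=> n; case: (@pickle_inv C n) => /=.
rewrite (esumID (range (@pickle C))); last by move=> n _; case: (@pickle_inv C n) => /=.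
rewrite !setTI [X in _ + X]esum1 ?adde0; last first.
  move=> n /= nr; case E : (@pickle_inv C n) => [c|//] /=.
  by case: nr; exists c => //; have := @pickle_invK C n; rewrite E.
rewrite (reindex_esum [set: C] (range (@pickle C)) (@pickle C)); last first.
  by split => [c _|c c' _ _ /(pcan_inj (@pickleK C))|]; first by exists c.
by apply: eq_esum => c _; rewrite pickleK_inv.
Qed.

Lemma esum_seq (C : choiceType) (r : seq C) (a : C -> \bar R) :
  (forall c, 0 <= a c) -> uniq r -> \esum_(c in [set` r]) a c = \sum_(c <- r) a c.
Proof.
move=> a0 ur; rewrite esum_fset; [by rewrite -fsbig_seq|exact: finite_seq|by []].
Qed.

Lemma esum_arr (l : nat) (e : seq nat) (D : set nat) (F : seq nat -> \bar R) :
  (forall s, 0 <= F s) -> uniq e -> (forall i, i \in e <-> D i) ->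
  \esum_(p in [set p : l.-tuple nat | uniq p /\ forall j, j \in p -> D j]) F p =
  sum_arr F l e.
Proof.
move=> F0 ue eD.
have sz : all (fun q => size q == l) (arr e l).
  by apply/allP => q; rewrite arrP// => /and3P[].
pose r : seq (l.-tuple nat) := pmap insub (arr e l).
have vr : map val r = arr e l.
  rewrite /r (pmap_filter (@insubK _ _ _)); apply/all_filterP.
  by apply: sub_all sz => q sq; rewrite isSome_insub.
rewrite (_ : [set p | _] = [set` r]); last first.
  apply/seteqP; split => p /=; rewrite -(mem_map val_inj) vr arrP// size_tuple eqxx /=.
    move=> [-> pD]; apply/allP => j jp /=; apply/eD; exact: pD.
  by move=> /andP[-> /allP pe]; split=> // j /pe /= /eD.
rewrite esum_seq//; first by rewrite /sum_arr -vr big_map.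
by rewrite -(map_inj_uniq val_inj) vr uniq_arr.
Qed.

End esum_lemmas.

Section points.
Context d (T : measurableType d) d' (Om : measurableType d') (R : realType).
Variable eta : proper_point_process T Om.
Implicit Types (B : set T) (w : Om).

Local Notation X := (point eta).

Definition hits B w : set nat := [set i | indices eta w i /\ B (X i w)].

Lemma num_pointsE B w : num_points R eta B w = \esum_(i in hits B w) 1 :> \bar R.
Proof.
rewrite /num_points -[hits B w]/(indices eta w `&` [set i | B (X i w)]) esum_mkcondr.
apply: eq_esum => i _; rewrite diracE.
have -> : (i \in [set i | B (X i w)]) = (X i w \in B) by apply/idP/idP; rewrite !inE.
by case: ifP.
Qed.

Definition is_enum (e : seq nat) (D : set nat) := uniq e /\ forall i, i \in e <-> D i.

Lemma num_points_enum B w e : is_enum e (hits B w) ->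
  num_points R eta B w = (size e)%:R%:E :> \bar R.
Proof.
move=> [ue eD]; rewrite num_pointsE.
have -> : hits B w = [set` e] by apply/seteqP; split => i /=; rewrite eD.
by rewrite esum_seq// sumEFin big_const_seq count_predT iter_addr addr0.
Qed.

Lemma num_points_finite B w k : num_points R eta B w = k%:R%:E :> \bar R ->
  exists2 e, is_enum e (hits B w) & size e = k.
Proof.
move=> Nk; have fD : finite_set (hits B w).
  apply: contrapT => /(infinite_set_fset k.+1)[D DB kD].
  pose r : seq nat := finmap.enum_fset D.
  have : (size r)%:R%:E <= num_points R eta B w :> \bar R.
    rewrite num_pointsE; apply: esum_ge; exists [set` r]; first by split; [exact: finite_seq|exact: DB].
    rewrite -fsbig_seq ?finmap.fset_uniq// sumEFin big_const_seq count_predT.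
    by rewrite iter_addr addr0.
  by rewrite Nk lee_fin ler_nat leqNgt => /negP; apply.
have [e eD ue] : exists2 e : seq nat, hits B w = [set` e] & uniq e.
  have /finite_seqP[s sD] := fD; exists (undup s); last exact: undup_uniq.
  by rewrite sD; apply/seteqP; split=> i /=; rewrite mem_undup.
have en : is_enum e (hits B w) by split=> // i; rewrite eD.
exists e => //; have := num_points_enum en; rewrite Nk => -[] /eqP.
by rewrite eqr_nat => /eqP.
Qed.

Lemma measurable_indices i : measurable [set w | indices eta w i].
Proof.
have -> : [set w | indices eta w i] = (npoints eta @^-1` [set None]) `|`
    \bigcup_(k in [set k | (i < k)%N]) (npoints eta @^-1` [set Some k]).
  apply/seteqP; split => w; rewrite /indices /=.
    by case E : npoints => [k|]; [move=> ik; right; exists k|left].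
  by case=> [->//|[k /= ik ->]].
apply: measurableU; first exact: measurable_npoints.
by apply: bigcup_measurable => k _; exact: measurable_npoints.
Qed.

Lemma measurable_hits B i : measurable B -> measurable [set w | hits B w i].
Proof.
move=> mB; apply: measurableI; first exact: measurable_indices.
by rewrite -[X in measurable X]setTI; exact: (measurable_point eta i measurableT).
Qed.

Lemma measurable_tuple_points l (p : l.-tuple nat) :
  measurable_fun setT (fun w => map_tuple (X ^~ w) p).
Proof.
apply/measurable_fun_tnthP => i.
rewrite (_ : _ \o _ = X (tnth p i)); first exact: measurable_point.
by apply/funext => w /=; rewrite tnth_map.
Qed.

(** The index set depends on [w]; a countable sum over all index tuples, each cut off by a
    measurable event, does not. *)
Lemma measurable_esum_tuples l B (F : l.-tuple T -> \bar R) : measurable B ->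
  measurable_fun setT F -> (forall x, 0 <= F x) ->
  measurable_fun setT (fun w =>
    \esum_(p in [set p : l.-tuple nat | uniq p /\ forall j, j \in p -> hits B w j])
      F (map_tuple (X ^~ w) p)).
Proof.
move=> mB mF F0.
have mD (p : l.-tuple nat) : measurable [set w | uniq p /\ forall j, j \in p -> hits B w j].
  apply: (@measurableI _ _ [set _ | uniq p]).
    case: (uniq p); first by rewrite (_ : mkset _ = setT)//; apply/seteqP.
    by rewrite (_ : mkset _ = set0)//; apply/seteqP; split.
  have := @fin_bigcap_measurable _ Om nat [set` p] (fun j => [set w | hits B w j]).
  by apply=> [|j _]; [exact: finite_seq|exact: measurable_hits].
pose a w (p : l.-tuple nat) : \bar R :=
  if w \in [set w | uniq p /\ forall j, j \in p -> hits B w j]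
  then F (map_tuple (X ^~ w) p) else 0.
rewrite (_ : (fun w => _) = (fun w => \sum_(0 <= n <oo)
    oapp (a w) 0 (@pickle_inv (l.-tuple nat) n))); last first.
  apply/funext => w; rewrite esum_mkcond -esum_countable; last first.
    by move=> p; rewrite /a; case: ifPn.
  exact: eq_esum.
apply: ge0_emeasurable_sum => [n w _ _|n _].
  by case: pickle_inv => //= p; rewrite /a; case: ifPn.
case: pickle_inv => [p|] /=; last exact: measurable_cst.
apply: (measurable_restrictT _ (mD p)).1; apply: measurable_funTS.
exact: measurableT_comp mF (measurable_tuple_points p).
Qed.

Lemma measurable_num_points B : measurable B ->
  measurable_fun setT (num_points R eta B : Om -> \bar R).
Proof.
move=> mB; rewrite (_ : num_points R eta B = fun w => \sum_(0 <= i <oo)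
  (\1_[set w | hits B w i] w)%:E); last first.
  apply/funext => w; rewrite num_pointsE esum_mkcond nneseries_esumT//.
  apply: eq_esum => i _; rewrite indicE; case: ifPn => iD; first by rewrite mem_set//; exact: set_mem.
  by rewrite memNset//; move=> iD'; case/negP: iD; exact: mem_set.
apply: ge0_emeasurable_sum => // i _; apply/measurable_EFinP.
by apply: measurable_indic; exact: measurable_hits.
Qed.

End points.

(** * Uniqueness of measures on tuples *)

Section power_measure_uniqueness.
Context d (T : measurableType d) (R : realType).

Definition tuple_box n (A : 'I_n -> set T) : set (n.-tuple T) :=
  [set t | forall i, A i (tnth t i)].

Lemma measurable_tuple_box n (A : 'I_n -> set T) :
  (forall i, measurable (A i)) -> measurable (tuple_box A).
Proof.
move=> mA; rewrite (_ : tuple_box A =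
    \bigcap_(i in [set: 'I_n]) ((fun t => tnth t i) @^-1` A i)).
  apply: fin_bigcap_measurable => // i _; rewrite -[X in measurable X]setTI.
  exact: (measurable_tnth i measurableT).
by apply/seteqP; split => [t /= H i _|t /= H i]; exact: H.
Qed.

Lemma tuple_measure_unique n (m1 m2 : {measure set n.-tuple T -> \bar R}) :
  m1 setT < +oo ->
  (forall A : 'I_n -> set T, (forall i, measurable (A i)) ->
    m1 (tuple_box A) = m2 (tuple_box A)) ->
  forall A, measurable A -> m1 A = m2 A.
Proof.
move=> m1oo m12 A mA.
pose C : set (set (n.-tuple T)) :=
  [set B | exists2 A : 'I_n -> set T, (forall i, measurable (A i)) & B = tuple_box A].
have CT : C setT.
  exists (fun=> setT) => //; apply/seteqP; split => // t _ i //.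
apply: (measure_unique C (fun=> setT)) => //.
- apply/seteqP; split.
    apply: smallest_sub; first exact: smallest_sigma_algebra.
    move=> B.
    elim/big_ind : _ => [//|U V UC VC [/UC//|/VC//]|i _ [D mD <-]].
    apply: sub_sigma_algebra; exists (fun j => if j == i then D else setT).
      by move=> j; case: ifP.
    rewrite setTI; apply/seteqP; split => [t /= Dt j|t /(_ i) /=].
      by case: eqP => [->|].
    by rewrite eqxx.
  apply: smallest_sub; first exact: sigma_algebra_measurable.
  by move=> B [D mD ->]; exact: measurable_tuple_box.
- move=> B1 B2 [A1 mA1 ->] [A2 mA2 ->]; exists (fun i => A1 i `&` A2 i).
    by move=> i; exact: measurableI.
  apply/seteqP; split => [t /= [t1 t2] i|t /= t12]; first by split; [exact: t1|exact: t2].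
  by split=> i; have [] := t12 i.
- by apply/seteqP; split => // x _; exists 0%N.
- by move=> B [D mD ->]; exact: m12.
Qed.

End power_measure_uniqueness.

(** * Tuples of points sorted by cells *)

Lemma sum_count_mem (C : finType) (s : seq C) : (\sum_x count_mem x s = size s)%N.
Proof.
elim: s => [|y s IH]; first by rewrite big1.
rewrite /= -add1n -IH big_split /=; congr (_ + _)%N.
by rewrite (bigD1 y)//= eqxx big1 ?addn0// => i /negbTE; rewrite eq_sym => ->.
Qed.

(** With equal totals, if the families differ then some [n i] is below [m i], and its falling
    factorial vanishes. *)
Lemma prod_ffact_eqsum (I : finType) (n m : I -> nat) :
  (\sum_i n i = \sum_i m i)%N ->
  (\prod_i n i ^_ m i = [forall i, n i == m i] * \prod_i (m i)`!)%N.
Proof.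
move=> nm; case: forallP => [nmi|nnmi].
  by rewrite mul1n; apply: eq_bigr => i _; rewrite (eqP (nmi i)) ffactnn.
have [/existsP[i nmi]|/existsPn mn] := boolP [exists i, (n i < m i)%N].
  by rewrite (bigD1 i)//= ffact_small.
case: nnmi => i; rewrite eqn_leq andbC leqNgt mn /=; move: nm.
rewrite (bigD1 i)//= [RHS](bigD1 i)//= => nm.
rewrite -(leq_add2r (\sum_(j | j != i) m j)) -nm leq_add2l.
by apply: leq_sum => j _; rewrite leqNgt.
Qed.

Section point_pattern.
Context d (T : measurableType d) d' (Om : measurableType d') (R : realType).
Variable eta : proper_point_process T Om.
Implicit Types (W : set T) (w : Om).

Local Notation X := (point eta).

Definition seqset k (A : set (k.-tuple T)) : set (seq T) :=
  [set s | exists2 t : k.-tuple T, A t & tval t = s].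

Definition tuple_count k W (A : set (k.-tuple T)) w : \bar R :=
  \esum_(p in [set p : k.-tuple nat | uniq p /\ forall j, j \in p -> hits eta W w j])
    \d_(map_tuple (X ^~ w) p) A.

Lemma tuple_count_ge0 k W (A : set (k.-tuple T)) w : 0 <= tuple_count W A w.
Proof. exact: esum_ge0. Qed.

Lemma measurable_tuple_count k W (A : set (k.-tuple T)) : measurable W ->
  measurable A -> measurable_fun setT (tuple_count W A).
Proof.
move=> mW mA; apply: (measurable_esum_tuples eta mW (F := fun x => \d_x A)) => //.
rewrite (_ : (fun x => _) = EFin \o \1_A); first by apply/measurable_EFinP.
by apply/funext => x /=; rewrite diracE indicE.
Qed.

Lemma tuple_countE k W (A : set (k.-tuple T)) w e : is_enum e (hits eta W w) ->
  tuple_count W A w =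
  sum_arr (fun u => (u \in seqset A)%:R%:E) k (map (X ^~ w) e).
Proof.
move=> [ue eD]; rewrite /sum_arr arr_map big_map.
rewrite -[RHS](@esum_arr R k e _ (fun u => (map (X ^~ w) u \in seqset A)%:R%:E) _ ue eD) => [|s]; last by rewrite lee_fin.
apply: eq_esum => p _; rewrite diracE; congr (_%:R%:E); congr nat_of_bool.
apply/idP/idP => [/set_mem Ap|/set_mem[t At tE]]; apply: mem_set.
  by exists (map_tuple (X ^~ w) p).
by rewrite (_ : map_tuple _ _ = t)//; apply: val_inj.
Qed.

Section boxes.
Variables (k : nat) (W : set T) (A : 'I_k -> set T).

(** Colours name the atoms generated by the sets [A j]. The cells are disjoint, as independence
    requires, and each [A j] within the window is a union of cells. *)
Definition color (x : T) : {set 'I_k} := [set j | x \in A j]%SET.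

Definition cell (al : {set 'I_k}) : set T := W `&` [set x | color x = al].

Definition coloring (a : {ffun 'I_k -> {set 'I_k}}) := [seq a j | j <- enum 'I_k].

Definition mult (a : {ffun 'I_k -> {set 'I_k}}) al := count_mem al (coloring a).

Lemma size_coloring a : size (coloring a) = k.
Proof. by rewrite size_map size_enum_ord. Qed.

Lemma coloring_inj : injective coloring.
Proof.
move=> a b /eq_in_map ab; apply/ffunP => j; apply: ab; exact: mem_enum.
Qed.

Lemma sum_mult a : (\sum_al mult a al = k)%N.
Proof. by rewrite sum_count_mem size_coloring. Qed.

(** At most one summand is nonzero, the one for the actual colouring of [u]; membership in the box
    is then the condition defining the family. *)
Lemma in_seqset_box (u : seq T) : size u = k ->
  ((u \in seqset (tuple_box A))%:R : R)%R =
  (\sum_(a in family (fun i => [pred al : {set 'I_k} | i \in al]))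
     (map color u == coloring a)%:R)%R.
Proof.
move=> uk; pose t : k.-tuple T := tcast uk (in_tuple u).
have tu : tval t = u by rewrite val_tcast.
pose a0 := [ffun j => color (tnth t j)].
have a0E : map color u = coloring a0.
  rewrite -tu -[in LHS](map_tnth_enum t) -map_comp; apply: eq_map => j /=.
  by rewrite ffunE.
have a0P : (u \in seqset (tuple_box A)) =
    (a0 \in family (fun i => [pred al : {set 'I_k} | i \in al])).
  apply/idP/familyP => [|H].
    rewrite inE => -[t' At' t'u] j; rewrite ffunE !inE.
    have -> : t = t' by apply: val_inj; rewrite -[RHS]/(tval t') t'u.
    exact: At'.
  rewrite inE; exists t => // j; have := H j.
  by rewrite ffunE !inE.
rewrite a0E a0P; have [aF|aF] := boolP (a0 \in family _).
  rewrite (bigD1 a0)//= eqxx big1 ?addr0// => a /andP[_ aa0].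
  by rewrite (inj_eq coloring_inj) eq_sym (negbTE aa0).
rewrite big1// => a aF'; case: eqP => // /coloring_inj a0a.
by move: aF; rewrite a0a aF'.
Qed.

Lemma hits_cell w e al : is_enum e (hits eta W w) ->
  is_enum [seq i <- e | color (X i w) == al] (hits eta (cell al) w).
Proof.
move=> [ue eD]; split; first exact: filter_uniq.
move=> i; rewrite mem_filter; split=> [/andP[/eqP ci /eD[? ?]]|[? [? /= ci]]].
  by split.
by rewrite ci eqxx; apply/eD; split.
Qed.

Lemma num_points_cells w :
  num_points R eta W w = \sum_(al : {set 'I_k}) num_points R eta (cell al) w.
Proof.
rewrite /num_points -esum_sum//; apply: eq_esum => i _.
rewrite diracE; have [Wi|Wi] := boolP (_ \in W); last first.
  rewrite big1// => al _; rewrite diracE memNset// => -[/mem_set].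
  by rewrite (negbTE Wi).
rewrite (bigD1 (color (X i w)))//= diracE mem_set; last by split => //; exact: set_mem.
rewrite big1 ?adde0// => al al_ne; rewrite diracE memNset// => -[_ /= E].
by rewrite E eqxx in al_ne.
Qed.

Definition pattern (a : {ffun 'I_k -> {set 'I_k}}) : set Om :=
  \bigcap_(al in [set: {set 'I_k}])
    (num_points R eta (cell al) @^-1` [set (mult a al)%:R%:E]).

Lemma pattern_num_points a w : pattern a w -> num_points R eta W w = k%:R%:E.
Proof.
move=> pw; rewrite num_points_cells.
rewrite (eq_bigr (fun al => (mult a al)%:R%:E)); last by move=> al _; exact: pw.
by rewrite sumEFin -natr_sum sum_mult.
Qed.

(* The tuples are sorted by the cells of their entries: those with cells [a]
   exist only if the cell counts are the multiplicities of [a], and then there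
   are [\prod_al (mult a al)`!] of them. *)
Lemma tuple_count_box w : num_points R eta W w = k%:R%:E ->
  tuple_count W (tuple_box A) w =
  \sum_(a in family (fun i => [pred al : {set 'I_k} | i \in al]))
    ((\prod_al (mult a al)`!)%N%:R * \1_(pattern a) w)%:E.
Proof.
move=> Nw; have [e ew ek] := num_points_finite Nw.
rewrite (tuple_countE _ ew) /sum_arr.
transitivity (\sum_(u <- arr (map (X^~ w) e) k)
  \sum_(a in family (fun i => [pred al : {set 'I_k} | i \in al]))
     ((map color u == coloring a)%:R%:E : \bar R)).
  have := @arr_map _ _ (X^~ w) e k; move: ew => [ue _] aE.
  rewrite big_seq [RHS]big_seq; apply: eq_bigr => u.
  rewrite aE => /mapP[q]; rewrite arrP// => /and3P[_ /eqP qk _] ->.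
  by rewrite sumEFin in_seqset_box// size_map.
rewrite exchange_big /=; apply: eq_bigr => a _.
rewrite sumEFin; congr (_%:E); rewrite -natr_sum.
have -> : (\sum_(u <- arr (map (X^~ w) e) k) (map color u == coloring a) =
    count (fun u => map color u == coloring a) (arr (map (X^~ w) e) k))%N.
  by elim: (arr _ _) => [|u r IH]; rewrite ?big_nil// big_cons IH.
have := arr_color_count color (coloring a) (map (X^~ w) e).
rewrite size_coloring => ->; rewrite prod_ffact_eqsum; last first.
  by rewrite !sum_count_mem size_coloring !size_map.
rewrite natrM mulrC; congr (_ * _)%R; rewrite indicE; congr (_%:R)%R.
congr nat_of_bool; apply/forallP/idP => [cm|/set_mem pw al].
  apply: mem_set => al _ /=; rewrite (num_points_enum R (hits_cell al ew)).
  congr (_%:R%:E); rewrite /mult -(eqP (cm al)) size_filter -map_comp count_map.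
  by apply: eq_count => i /=.
have := pw al Logic.I; rewrite /= (num_points_enum R (hits_cell al ew)) => -[] /eqP.
rewrite /mult eqr_nat size_filter => /eqP <-; apply/eqP; rewrite -map_comp count_map.
by apply: eq_count => i /=.
Qed.

Hypothesis mW : measurable W.
Hypothesis mA : forall i, measurable (A i).

Lemma measurable_cell al : measurable (cell al).
Proof.
rewrite (_ : cell al = W `&` \bigcap_(j in [set: 'I_k]) (if j \in al then A j else ~` A j)).
  apply: measurableI => //; apply: fin_bigcap_measurable => // j _.
  by case: ifP => _ //; exact: measurableC.
apply/seteqP; split => x [Wx /= H]; split => //.
  by move=> j _; rewrite -H inE; case: ifPn => [/set_mem//|/negP] xA /mem_set.
apply/setP => j; rewrite inE; have := H j Logic.I; case: ifP => _.
  by move=> /mem_set ->.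
by move=> xA; apply/negP => /set_mem.
Qed.

Lemma measurable_pattern a : measurable (pattern a).
Proof.
apply: fin_bigcap_measurable => // al _; rewrite -[X in measurable X]setTI.
exact: (measurable_num_points eta (measurable_cell al)).
Qed.

Lemma trivIset_cell : trivIset setT cell.
Proof. by move=> al bl _ _ [x [[_ /= <-] [_ /= <-]]]. Qed.

Lemma cell_bigcup (j : 'I_k) : A j `&` W = \bigcup_(al in [set al : {set 'I_k} | j \in al]) cell al.
Proof.
apply/seteqP; split => [x [Ax Wx]|x [al /= jal [Wx /= E]]].
  by exists (color x) => //=; rewrite inE mem_set.
by split => //; move: jal; rewrite -E inE => /set_mem.
Qed.

Lemma cell_bigcupT : W = \bigcup_(al in [set: {set 'I_k}]) cell al.
Proof. by apply/seteqP; split => [x Wx|x [al _ []//]]; exists (color x). Qed.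

End boxes.
End point_pattern.

Lemma prod_count_mem (R : comNzRingType) (C : finType) (f : C -> R) (s : seq C) :
  (\prod_c f c ^+ count_mem c s = \prod_(c <- s) f c)%R.
Proof.
elim: s => [|y s IH]; first by rewrite big_nil big1.
rewrite big_cons -IH /=; under eq_bigr do rewrite exprD.
rewrite big_split /=; congr (_ * _)%R.
by rewrite (bigD1 y)//= eqxx big1 ?mulr1// => i /negbTE; rewrite eq_sym => ->.
Qed.

Lemma exchange_esum (R : realType) (I J : choiceType) (A : set I) (B : set J)
    (a : I -> J -> \bar R) : (forall i j, 0 <= a i j) ->
  \esum_(i in A) \esum_(j in B) a i j = \esum_(j in B) \esum_(i in A) a i j.
Proof.
move=> a0; rewrite !esum_esum//.
rewrite (reindex_esum (A `*`` fun=> B) (B `*`` fun=> A) (fun p => (p.2, p.1)))//.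
split => [[i j] []//|[i j] [i' j'] _ _ [-> ->]//|[j i] [Bj Ai]].
by exists (i, j).
Qed.

Lemma poisson_probE (R : realType) (r : R) k : (0 <= r)%R ->
  poisson_prob r 0 [set k] = (pmass r k)%:E.
Proof.
rewrite le_eqVlt => /predU1P[<-|r0].
  (* At rate 0 the distribution is a Dirac mass by convention; [pmass] agrees because its zeroth
     power of 0 is 1. *)
  rewrite /poisson_prob ltxx diracE /pmass expr0n oppr0 expR0 mulr1.
  have -> : (0%N \in [set k]) = (k == 0%N) by apply/idP/eqP; rewrite !inE.
  by case: k => [|k] /=; rewrite ?divr1// mul0r.
rewrite /poisson_prob r0 esum_set1//; first by rewrite /poisson_pmf r0.
by rewrite lee_fin poisson_pmf_ge0.
Qed.

(** * Law of the points in a window of finite measure *)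

Section poisson_window.
Context d (T : measurableType d) d' (Om : measurableType d') (R : realType).
Variables (P : probability Om R) (L : {sigma_finite_measure set T -> \bar R}).
Variable eta : proper_point_process T Om.
Hypothesis eta_poisson : is_poisson_process P L eta.
Variable W : set T.
Hypotheses (mW : measurable W) (LWoo : L W < +oo).

Local Notation X := (point eta).

Let mu : {sigma_finite_measure set T -> \bar R} := mfrestr mW LWoo.
Let Lam : R := fine (L W).

Definition num_event k : set Om := [set w | num_points R eta W w = k%:R%:E].

Lemma measurable_num_event k : measurable (num_event k).
Proof.
rewrite -[X in measurable X]setTI.
exact: (@measurable_num_points _ _ _ _ R eta W mW measurableT _ (emeasurable_set1 _)).
Qed.

Let L_fin (B : set T) : measurable B -> B `<=` W -> L B = (fine (L B))%:E.
Proof.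
move=> mB BW; rewrite fineK// ge0_fin_numE//; apply: le_lt_trans LWoo.
by apply: le_measure; rewrite ?inE.
Qed.

Lemma num_points_poisson B k : measurable B -> B `<=` W ->
  P [set w | num_points R eta B w = k%:R%:E] = (pmass (fine (L B)) k)%:E.
Proof.
move=> mB BW; rewrite (eta_poisson.1 B k mB) L_fin//= poisson_probE//.
by rewrite fine_ge0.
Qed.

Section boxes.
Variables (k : nat) (A : 'I_k -> set T).
Hypothesis mA : forall i, measurable (A i).

Let lam al : R := fine (L (cell W A al)).

Let mcell al : measurable (cell W A al).
Proof. exact: measurable_cell. Qed.

Let cellW al : cell W A al `<=` W.
Proof. by move=> x []. Qed.

Lemma pattern_prob a :
  P (pattern R eta W A a) = (\prod_al pmass (lam al) (mult a al))%:E.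
Proof.
pose n := #|{set 'I_k}|.
have -> : pattern R eta W A a = \bigcap_(j in [set: 'I_n])
    (num_points R eta (cell W A (enum_val j)) @^-1` [set (mult a (enum_val j))%:R%:E]).
  apply/seteqP; split => w pw j _; first exact: pw.
  by have := pw (enum_rank j) Logic.I; rewrite enum_rankK.
rewrite (eta_poisson.2 n (fun j => cell W A (enum_val j))
  (fun j => [set (mult a (enum_val j))%:R%:E])) => // [|i j _ _ [x [xi xj]]]; last first.
  by apply: enum_val_inj; apply: (@trivIset_cell _ T k W A) => //; exists x.
rewrite (eq_bigr (fun j : 'I_n => (pmass (lam (enum_val j)) (mult a (enum_val j)))%:E)).
  rewrite prodEFin; congr (_%:E).
  rewrite (reindex (fun j : 'I_n => enum_val j : {set 'I_k}))//=.
  by apply: onW_bij; exact: enum_val_bij.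
by move=> j _; exact: num_points_poisson.
Qed.

Let sum_lam (F : {set {set 'I_k}}) :
  fine (L (\bigcup_(al in [set` F]) cell W A al)) = (\sum_(al in F) lam al)%R.
Proof.
rewrite measure_fin_bigcup//; last first.
  by move=> al bl _ _; exact: (@trivIset_cell _ T k W A).
rewrite (_ : [set` F] = [set` enum F]); last first.
  by apply/seteqP; split => al /=; rewrite mem_enum.
rewrite -fsbig_seq ?enum_uniq// big_enum_cond/=.
rewrite (eq_bigr (fun al => (lam al)%:E)).
  by rewrite sumEFin /=; apply: eq_bigl => al; rewrite andbT.
by move=> al _; exact: L_fin.
Qed.

(** The factorials from counting cancel those of the Poisson weights, leaving the product of
    [lam (a j)] for each colouring [a]. Distributivity turns the sum over colourings into the
    product of the masses of the [A j]. *)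
Lemma tuple_count_box_integral :
  \int[P]_(w in num_event k) tuple_count R eta W (tuple_box A) w =
  (expR (- Lam))%:E * power_measure mu k (tuple_box A).
Proof.
pose fam := family (fun i => [pred al : {set 'I_k} | i \in al]).
transitivity (\int[P]_(w in num_event k) \sum_(a <- enum fam)
    ((\prod_al (mult a al)`!)%N%:R * \1_(pattern R eta W A a) w)%:E).
  by apply: eq_integral => w /set_mem Nw; rewrite big_enum; exact: tuple_count_box.
have mpat := @measurable_pattern _ T _ Om R eta k W A mW mA.
rewrite ge0_integral_sum//; last 2 first.
- exact: measurable_num_event.
- move=> a; apply/measurable_EFinP; apply: measurable_funM; first exact: measurable_cst.
  by apply: measurable_indic; exact: mpat.
transitivity (\sum_(a in fam) (expR (- Lam) * \prod_j lam (a j))%:E).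
  rewrite big_enum /=.
  apply: eq_bigr => a _; under eq_integral do rewrite EFinM.
  rewrite ge0_integralZl//; last 2 first.
  - exact: measurable_num_event.
  - by apply/measurable_EFinP; apply: measurable_indic; exact: mpat.
  rewrite integral_indic//; [|exact: measurable_num_event].
  rewrite setIidl; last by move=> w /pattern_num_points.
  rewrite [X in _ * X](pattern_prob a) -EFinM natr_prod -big_split/=; congr (_%:E).
  transitivity (\prod_al ((lam al) ^+ mult a al * expR (- lam al)))%R.
    apply: eq_bigr => al _; rewrite /pmass mulrA; congr (_ * _)%R.
    by rewrite mulrC mulfVK// pnatr_eq0 -lt0n fact_gt0.
  rewrite big_split/= mulrC; congr (_ * _)%R; last first.
    by rewrite /mult prod_count_mem /coloring big_map big_enum.
  rewrite -expR_sum sumrN; congr (expR (- _)).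
  have -> : Lam = fine (L (\bigcup_(al in [set` [set: {set 'I_k}]%SET]) cell W A al)).
    rewrite /Lam [in LHS](@cell_bigcupT _ T k W A); congr (fine (L _)).
    by apply: eq_bigcupl; split => al //= _; rewrite inE.
  by rewrite sum_lam; apply: eq_bigl => al; rewrite inE.
rewrite sumEFin -mulr_sumr EFinM; congr (_ * _).
rewrite /tuple_box power_measure_box//.
rewrite (eq_bigr (fun j => (\sum_(al : {set 'I_k} | j \in al) lam al)%:E)); last first.
  move=> j _; rewrite /mu /= /mfrestr /mrestr.
  rewrite L_fin; [|exact: measurableI|by move=> x []].
  congr (_%:E); rewrite (cell_bigcup W A j).
  transitivity (fine (L (\bigcup_(al in [set` [set al : {set 'I_k} | j \in al]%SET])
      cell W A al))).
    by congr (fine (L _)); apply: eq_bigcupl; split => al /=; rewrite inE.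
  by rewrite sum_lam; apply: eq_bigl => al; rewrite inE.
rewrite prodEFin; congr (_%:E).
by rewrite bigA_distr_big_dep.
Qed.

End boxes.

Section count_measure.
Variable k : nat.

(** All [k!] orderings of the points are counted, so no factorial appears in the density. Seen as a
    measure in [A], it can be identified from its values on boxes. *)
Definition count_measure (A : set (k.-tuple T)) : \bar R :=
  \int[P]_(w in num_event k) tuple_count R eta W A w.

Let count_measure0 : count_measure set0 = 0.
Proof.
by apply: integral0_eq => w _; rewrite /tuple_count esum1.
Qed.

Let count_measure_ge0 A : 0 <= count_measure A.
Proof. by apply: integral_ge0 => w _; exact: tuple_count_ge0. Qed.

Let count_measure_sigma_additive : semi_sigma_additive count_measure.
Proof.
move=> F mF tF mUF.
have -> : count_measure (\bigcup_n F n) = \sum_(0 <= n <oo) count_measure (F n).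
  rewrite /count_measure -integral_nneseries//; last 3 first.
  - exact: measurable_num_event.
  - by move=> n; apply: measurable_funTS; exact: measurable_tuple_count.
  - by move=> n w _; exact: tuple_count_ge0.
  apply: eq_integral => w _; rewrite nneseries_esumT; last by move=> n; exact: tuple_count_ge0.
  rewrite /tuple_count exchange_esum//.
  by apply: eq_esum => p _; rewrite -nneseries_esumT// measure_semi_bigcup.
by apply: is_cvg_ereal_nneg_natsum => n _; exact: count_measure_ge0.
Qed.

HB.instance Definition _ := isMeasure.Build _ _ _ count_measure
  count_measure0 count_measure_ge0 count_measure_sigma_additive.

Let mmu := mscale (NngNum (expR_ge0 (- Lam))) (power_measure mu k).

Lemma count_measureE (A : set (k.-tuple T)) : measurable A ->
  \int[P]_(w in num_event k) tuple_count R eta W A w =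
  (expR (- Lam))%:E * power_measure mu k A.
Proof.
have cE B : (forall i, measurable (B i)) -> count_measure (tuple_box B) =
    (expR (- Lam))%:E * power_measure mu k (tuple_box B).
  exact: tuple_count_box_integral.
move=> mA; have := @tuple_measure_unique _ T R k count_measure mmu; apply=> //.
- have -> : [set: k.-tuple T] = tuple_box (fun=> setT).
    by apply/seteqP; split => // x _ i.
  change (count_measure (tuple_box (fun=> [set: T])) < +oo).
  rewrite cE// [power_measure mu k _](@power_measure_box _ _ _ mu k (fun=> setT))//.
  rewrite (eq_bigr (fun=> Lam%:E)); first by rewrite prodEFin -EFinM ltry.
  by move=> j _; rewrite /mu /= /mfrestr /mrestr setTI (L_fin mW).
Qed.

End count_measure.
End poisson_window.

Lemma natmul_EFin (R : realType) (a : R) n : (a%:E *+ n)%R = (a *+ n)%R%:E.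
Proof. by elim: n => [|n IH]; rewrite ?mulr0n// !mulrS IH. Qed.

Section nat_valued.
Context d (Om : measurableType d) (R : realType).

Lemma measurable_truncn j : measurable [set r : R | Num.truncn r = j].
Proof.
case: j => [|j].
  rewrite (_ : mkset _ = [set` `]-oo, (1%:R : R)[]); first exact: measurable_itv.
  by apply/seteqP; split => r /=; rewrite in_itv/= -truncn_le_nat leqn0 => /eqP.
rewrite (_ : mkset _ = [set` `[j.+1%:R, j.+2%:R[]); first exact: measurable_itv.
apply/seteqP; split => r /=; rewrite in_itv/= -truncn_gt_nat -truncn_le_nat.
  by move=> ->; rewrite !leqnn.
by rewrite -eqn_leq eq_sym => /eqP.
Qed.

Lemma measurable_nat_value (S : Om -> \bar R) j : measurable_fun setT S ->
  measurable [set w | nat_value S w = j].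
Proof.
move=> mS; rewrite (_ : mkset _ = (fine \o S) @^-1` [set r | Num.truncn r = j])//.
rewrite -[X in measurable X]setTI.
by apply: measurableT_comp => //; exact: measurable_truncn.
Qed.

Lemma measurable_nat_valuep (S : Om -> \bar R) (phi : nat -> R) :
  measurable_fun setT S -> measurable_fun setT (fun w => phi (nat_value S w)).
Proof.
move=> mS; apply: (measurableT_comp (f := phi)) => // _ A _; rewrite setTI.
rewrite (_ : _ @^-1` A = \bigcup_(j in A) [set w | nat_value S w = j]).
  by apply: bigcup_measurable => j _; exact: measurable_nat_value.
by apply/seteqP; split => [w /= Aw|w [j Aj /= Ej]]; [exists (nat_value S w)|rewrite /preimage/= Ej].
Qed.

Lemma nat_valueE (S : Om -> \bar R) w k : S w = k%:R%:E -> nat_value S w = k.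
Proof. by rewrite /nat_value => -> /=; rewrite natrK. Qed.

Lemma integral_nat_valued (m : {measure set Om -> \bar R}) (D : set Om)
    (V : Om -> nat) (phi : nat -> R) :
  measurable D -> (forall j, measurable [set w | V w = j]) -> (forall j, 0 <= phi j)%R ->
  \int[m]_(w in D) (phi (V w))%:E =
  \sum_(0 <= j <oo) (phi j)%:E * m (D `&` [set w | V w = j]).
Proof.
move=> mD mV p0.
transitivity (\int[m]_(w in D)
    \sum_(0 <= j <oo) (phi j)%:E * (\1_[set w | V w = j] w)%:E).
  apply: eq_integral => w _.
  rewrite (@nneseriesD1 _ _ (V w))//; last by move=> j _; rewrite mule_ge0 ?lee_fin.
  rewrite indicE mem_set// mule1 eseries0 ?adde0// => j _ /= jV.
  by rewrite indicE memNset ?mule0//= => Vj; move: jV; rewrite Vj eqxx.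
have mI j : measurable_fun D (fun w => (\1_[set w | V w = j] w)%:E : \bar R).
  by apply/measurable_EFinP; exact: measurable_indic.
rewrite integral_nneseries//; last 2 first.
- by move=> j; apply: measurable_funeM; exact: mI.
- by move=> j w _; rewrite mule_ge0 ?lee_fin.
apply: eq_eseriesr => j _; rewrite ge0_integralZl ?lee_fin//; last first.
by rewrite integral_indic// setIC.
Qed.

End nat_valued.

(** * The statistic of a window *)

Section window_statistic.
Context d (T : measurableType d) d' (Om : measurableType d') (R : realType).
Variables (P : probability Om R) (L : {sigma_finite_measure set T -> \bar R}).
Variable eta : proper_point_process T Om.
Hypothesis eta_poisson : is_poisson_process P L eta.
Variables (l : nat) (h : seq T -> bool).
Hypothesis h_sym : forall s t, perm_eq s t -> h s = h t.
Hypothesis h_meas : smeasurable (fun u => (h u : nat)%:R%:E : \bar R).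
Variable W : set T.
Hypotheses (mW : measurable W) (LWoo : L W < +oo).

Local Notation X := (point eta).

Let mu : {sigma_finite_measure set T -> \bar R} := mfrestr mW LWoo.
Let Lam : R := fine (L W).

Definition wstat w : \bar R :=
  (l`!%:R^-1)%:E * \esum_(p in [set p : l.-tuple nat |
    uniq p /\ forall j, j \in p -> hits eta W w j]) (h (map_tuple (X ^~ w) p) : nat)%:R%:E.

Let V := nstat l h.

Lemma wstat_enum w e : is_enum e (hits eta W w) ->
  wstat w = (V (map (X ^~ w) e))%:R%:E.
Proof.
move=> [ue eD]; rewrite /wstat.
rewrite (@esum_arr R l e _ (fun q => (h (map (X ^~ w) q) : nat)%:R%:E) _ ue eD) => [|s]; last by rewrite lee_fin.
transitivity ((l`!%:R^-1)%:E *
    sum_arr (fun u => (h u : nat)%:R%:E : \bar R) l (map (X ^~ w) e)).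
  by rewrite /sum_arr arr_map big_map.
rewrite sum_arr_subs => [|s t st]; last by rewrite (h_sym st).
rewrite -sum_subs_natE natmul_EFin -EFinM -[X in (_ * X)%R]mulr_natl mulKf//.
Qed.

Lemma measurable_wstat : measurable_fun setT wstat.
Proof.
apply: measurable_funeM.
apply: (measurable_esum_tuples eta mW (F := fun x => (h x : nat)%:R%:E)).
  exact: h_meas.
by move=> x; rewrite lee_fin.
Qed.

Let E k := num_event R eta W k.

Let mE k : measurable (E k). Proof. exact: measurable_num_event. Qed.

(** The set of tuples with statistic [j] is symmetric, so on the event of [k] points either all [k!]
    orderings lie in it or none does; dividing by [k!] in [count_measureE] gives the probability. *)
Lemma wstat_num_event k j :
  P (E k `&` [set w | nat_value wstat w = j]) =
  (expR (- Lam) / k`!%:R)%:E * sint mu k (fun s => (V s == j)%:R%:E).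
Proof.
pose A : set (k.-tuple T) := [set t | V t = j].
have V_sym : symmetric_on V by apply: nstat_sym.
have VE (t : k.-tuple T) : (t \in A) = (V t == j).
  by apply/idP/eqP; rewrite inE.
have mA : measurable A.
  have := smeasurable_nstat l h_meas (fun n => (n == j)%:R : R) (k := k).
  move=> /(_ measurableT _ (emeasurable_set1 1%E)); rewrite setTI.
  rewrite (_ : _ @^-1` _ = A)//; apply/seteqP; split => t /=.
    by case: eqP => //= _ [] /eqP; rewrite eq_sym oner_eq0.
  by rewrite /A/= /V => ->; rewrite eqxx.
have mN : measurable [set w | nat_value wstat w = j].
  exact: measurable_nat_value measurable_wstat.
have := count_measureE eta_poisson mW LWoo mA.
rewrite -/mu -/Lam.
have -> : power_measure mu k A = sint mu k (fun s => (V s == j)%:R%:E).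
  rewrite /sint -[LHS]mul1e -[LHS]integral_cst//.
  rewrite integral_mkcond; apply: eq_integral => t _.
  by rewrite patchE VE; case: eqP.
rewrite (eq_integral (fun w => (k`!%:R)%:E * (\1_[set w | nat_value wstat w = j] w)%:E)).
  rewrite ge0_integralZl//; last first.
    by apply/measurable_EFinP; exact: measurable_indic.
  rewrite integral_indic// setIC => cE.
  rewrite EFinM [X in X * _]muleC -muleA -cE muleA -EFinM mulVf ?mul1e//.
move=> w /set_mem Ew; have [e ew ek] := num_points_finite Ew.
rewrite (tuple_countE _ _ ew).
set u := map _ e; have uk : size u = k by rewrite size_map.
have sA : symmetric_on (fun s => (s \in seqset A)%:R%:E : \bar R).
  move=> s t st; congr (_%:R%:E); congr nat_of_bool.
  apply/idP/idP => /set_mem[x Ax xs]; apply: mem_set.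
    have tk : size t == k by rewrite -(perm_size st) -xs size_tuple.
    by exists (Tuple tk) => //=; rewrite /A/= -(V_sym _ _ st) -xs.
  have tk : size s == k by rewrite (perm_size st) -xs size_tuple.
  by exists (Tuple tk) => //=; rewrite /A/= (V_sym _ _ st) -xs.
rewrite sum_arr_subs// /sum_subs -[in subs u _]uk subs_size big_seq1.
rewrite natmul_EFin -EFinM -[(_ *+ _)%R]mulr_natl; congr (_ * _%:R)%:E.
have nV : nat_value wstat w = V u by apply: nat_valueE; exact: wstat_enum.
rewrite -[RHS](_ : nat_of_bool (V u == j) = _); last first.
  by congr nat_of_bool; apply/eqP/idP => [Vj|/set_mem /=]; [apply: mem_set; rewrite /= nV|rewrite nV].
congr nat_of_bool; apply/idP/eqP => [/set_mem /=|Vj].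
  by move=> [x Ax xu]; rewrite -xu.
apply: mem_set; have tk : size u == k by [apply/eqP].
by exists (Tuple tk).
Qed.

Lemma num_event_prob k : P (E k) = (pmass Lam k)%:E.
Proof.
exact: (num_points_poisson eta_poisson mW LWoo k mW (@subset_refl _ W)).
Qed.

Lemma trivIset_num_event : trivIset setT E.
Proof.
move=> i j _ _ [w []]; rewrite /E /num_event /= => -> [] /eqP.
by rewrite eqr_nat => /eqP.
Qed.

Lemma num_event_cover : P (\bigcup_k E k) = 1.
Proof.
rewrite measure_semi_bigcup//; last 2 first.
- exact: trivIset_num_event.
- exact: bigcup_measurable.
rewrite -(probability_setT (poisson_prob Lam 0)).
have -> : [set: nat] = \bigcup_k [set k] by apply/seteqP; split => // k _; exists k.
rewrite measure_semi_bigcup//; last by move=> i j _ _ [x [/= -> ->]].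
apply: eq_eseriesr => k _; transitivity (pmass Lam k)%:E; first exact: num_event_prob.
by apply/esym/poisson_probE; rewrite /Lam fine_ge0.
Qed.

Lemma wstat_mean (phi : nat -> R) : (forall j, 0 <= phi j)%R ->
  \int[P]_w (phi (nat_value wstat w))%:E = pint mu Lam (fun s => (phi (V s))%:E).
Proof.
move=> p0; have mN j : measurable [set w | nat_value wstat w = j].
  exact: measurable_nat_value measurable_wstat.
have mphi : measurable_fun setT (fun w => (phi (nat_value wstat w))%:E).
  by apply/measurable_EFinP; exact: measurable_nat_valuep measurable_wstat.
have UE : measurable (\bigcup_k E k) by exact: bigcup_measurable.
rewrite (ge0_negligible_integral (N := ~` \bigcup_k E k))//; last 3 first.
- exact: measurableC.
- by move=> w _; rewrite lee_fin.
- have := probability_setC P UE; rewrite num_event_cover subee//.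
rewrite setTD setCK ge0_integral_bigcup//; last 3 first.
- exact: measurable_funTS.
- by move=> w _; rewrite lee_fin.
- exact: trivIset_num_event.
apply: eq_eseriesr => k _.
rewrite integral_nat_valued//.
transitivity (\sum_(0 <= j <oo) (expR (- Lam) / k`!%:R)%:E *
    ((phi j)%:E * sint mu k (fun s => (V s == j)%:R%:E))).
  by apply: eq_eseriesr => j _; rewrite [X in _ * X](wstat_num_event k j) muleCA.
have mI j : smeasurable (fun s => (V s == j)%:R%:E : \bar R).
  exact: (smeasurable_nstat l h_meas (fun n => (n == j)%:R : R)).
rewrite nneseriesZl; last first.
  by move=> j _; rewrite mule_ge0 ?lee_fin// sint_ge0// => s; rewrite lee_fin.
congr (_ * _).
rewrite (_ : sint mu k _ = \int[power_measure mu k]_t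
    \sum_(0 <= j <oo) (phi j)%:E * (V t == j)%:R%:E); last first.
  apply: eq_integral => t _.
  rewrite (@nneseriesD1 _ _ (V t))//; last by move=> j _; rewrite mule_ge0 ?lee_fin.
  rewrite eqxx mule1 eseries0 ?adde0// => j _ /= jV.
  by rewrite eq_sym (negbTE jV) mule0.
rewrite integral_nneseries//; last 2 first.
- by move=> j; apply: measurable_funeM; exact: mI.
- by move=> j w _; rewrite mule_ge0 ?lee_fin.
apply: eq_eseriesr => j _; rewrite ge0_integralZl ?lee_fin//.
exact: mI.
Qed.

End window_statistic.

(** * Restriction of the intensity measure *)

Section restriction.
Context d (T : measurableType d) (R : realType).
Variables (L : {sigma_finite_measure set T -> \bar R}) (W : set T).
Hypotheses (mW : measurable W) (LWoo : L W < +oo).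

Let mu : {sigma_finite_measure set T -> \bar R} := mfrestr mW LWoo.

Lemma integral_mfrestr (f : T -> \bar R) : measurable_fun setT f ->
  (forall x, 0 <= f x) -> \int[mu]_x f x = \int[L]_(x in W) f x.
Proof.
move=> mf f0.
rewrite (ge0_negligible_integral (N := ~` W))//; last 2 first.
- exact: measurableC.
- by rewrite /mu/= /mfrestr /mrestr setICl measure0.
rewrite setTD setCK; apply: eq_measure_integral => A mA AW.
by rewrite /mu/= /mfrestr /mrestr setIidl.
Qed.

Definition within (D : set T) (s : seq T) : bool := all [in D] s.

Lemma smeasurable_within (D : set T) : measurable D ->
  smeasurable (fun s => (within D s : nat)%:R%:E : \bar R).
Proof.
move=> mD k; have mB := measurable_tuple_box (fun=> mD) (n := k).
rewrite (_ : (fun t => _) = EFin \o \1_(tuple_box (fun _ : 'I_k => D))).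
  by apply/measurable_EFinP; exact: measurable_indic.
apply/funext => t /=; rewrite indicE; congr (_%:R%:E); congr nat_of_bool.
apply/all_tnthP/idP => [H|/set_mem H i]; last exact/mem_set/H.
by apply: mem_set => i; apply: set_mem; exact: H.
Qed.

Lemma sint_mfrestr k F : smeasurable F -> (forall s, 0 <= F s) ->
  sint mu k F = sint L k (fun s => F s * (within W s : nat)%:R%:E).
Proof.
elim: k F => [|k IH] F mF F0.
  rewrite !sint0//; first by rewrite /= mule1.
  by apply: smeasurableM => //; exact: smeasurable_within.
have mFW : smeasurable (fun s => F s * (within W s : nat)%:R%:E).
  by apply: smeasurableM => //; exact: smeasurable_within.
have FW0 s : 0 <= F s * (within W s : nat)%:R%:E by rewrite mule_ge0// lee_fin.
rewrite !sintS// integral_mfrestr; last 2 first.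
- apply: measurable_sint => //; exact: jmeasurable_scons.
- by move=> x; exact: sint_ge0.
rewrite [LHS]integral_mkcond; apply: eq_integral => x _; rewrite patchE.
case: ifPn => xW; last first.
  rewrite -[LHS](sint_cst0 L k); apply: eq_sint => s _ /=.
  by rewrite (negbTE xW) /= mule0.
rewrite IH//; last exact: smeasurable_cons.
by apply: eq_sint => s _ /=; rewrite xW.
Qed.

Lemma sint_mfrestr_le k F : smeasurable F -> (forall s, 0 <= F s) ->
  sint mu k F <= sint L k F.
Proof.
move=> mF F0; rewrite sint_mfrestr//; apply: le_sint => //.
- by apply: smeasurableM => //; exact: smeasurable_within.
- by move=> s; rewrite mule_ge0// lee_fin.
by move=> s _; case: within; rewrite ?mule1// mule0.
Qed.

Lemma rterm_mfrestr_le l (h : seq T -> bool) i : smeasurable (fun u => (h u : nat)%:R%:E : \bar R) ->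
  rterm l h mu i <= rterm l h L i.
Proof.
move=> mh; have h0 u : 0 <= (h u : nat)%:R%:E :> \bar R by rewrite lee_fin.
have mS (m : {sigma_finite_measure set T -> \bar R}) :
    smeasurable (fun a => sint m (l - i) (fun b => (h (a ++ b) : nat)%:R%:E) ^+ 2).
  have := smeasurable_sint m (l - i) mh h0.
  by move=> mS k; under eq_fun do rewrite expe2; apply: emeasurable_funM; exact: mS.
have S0 (m : {sigma_finite_measure set T -> \bar R}) s :
    0 <= sint m (l - i) (fun b => (h (s ++ b) : nat)%:R%:E) ^+ 2.
  by rewrite expe2 mule_ge0// sint_ge0.
rewrite /rterm; apply: le_trans (sint_mfrestr_le i (mS mu) (S0 mu)) _.
apply: le_sint => // s _; rewrite !expe2.
have le1 := @sint_mfrestr_le (l - i) (fun b => (h (s ++ b) : nat)%:R%:E)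
  (smeasurable_cat s mh) (fun b => h0 _).
by apply: lee_pmul => //; apply: sint_ge0.
Qed.

Lemma rsum_mfrestr_le l (h : seq T -> bool) : smeasurable (fun u => (h u : nat)%:R%:E : \bar R) ->
  rsum l h mu <= rsum l h L.
Proof.
move=> mh; rewrite /rsum; apply: lee_sum => i _; apply: lee_wpmul2l.
  by rewrite lee_fin divr_ge0.
exact: rterm_mfrestr_le.
Qed.

End restriction.

(** * Dominated convergence for integer-valued statistics *)

Section discrete_limit.
Context d (Om : measurableType d) (R : realType) (P : probability Om R).
Variables (N_ : nat -> Om -> nat) (N : Om -> nat).
Hypothesis mN_ : forall n (phi : nat -> R), measurable_fun setT (fun w => phi (N_ n w)).
Hypothesis mN : forall phi : nat -> R, measurable_fun setT (fun w => phi (N w)).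
Hypothesis N_N : {ae P, forall w, exists m, forall n, (m <= n)%N -> N_ n w = N w}.
Hypothesis N_le : {ae P, forall w, forall n, (N_ n w <= N w)%N}.
Hypothesis N_int : \int[P]_w (N w)%:R%:E < +oo.

Lemma discrete_dominated (phi : nat -> R) (C : R) :
  (forall j, `|phi j| <= C * j.+1%:R)%R ->
  P.-integrable setT (fun w => (phi (N w))%:E) /\
  \int[P]_w (phi (N_ n w))%:E @[n --> \oo] --> \int[P]_w (phi (N w))%:E.
Proof.
move=> pC.
have C0 : (0 <= C)%R by have := pC 0%N; rewrite mulr1; exact: le_trans (normr_ge0 _).
pose g w : \bar R := (C * (N w).+1%:R)%:E.
have mg : measurable_fun setT g.
  by apply/measurable_EFinP; exact: (mN (fun j => C * j.+1%:R)%R).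
have ig : P.-integrable setT g.
  apply/integrableP; split => //.
  have -> : (fun w => `|g w|) = (fun w => C%:E * (1 + (N w)%:R%:E)).
    apply/funext => w; rewrite /g gee0_abs; first by rewrite -EFinD -natr1 addrC EFinM.
    by rewrite lee_fin mulr_ge0.
  rewrite ge0_integralZl//; last 2 first.
  - by apply: emeasurable_funD => //; apply/measurable_EFinP; exact: (mN (fun j => j%:R)).
  - by move=> w _; rewrite adde_ge0// lee_fin.
  rewrite ge0_integralD//; last first.
    by apply/measurable_EFinP; exact: (mN (fun j => j%:R)).
  have -> : \int[P]_w 1 = 1 by rewrite integral_cst// mul1e; exact: probability_setT.
  have NR : \int[P]_w (N w)%:R%:E \is a fin_num.
    by rewrite ge0_fin_numE//; apply: integral_ge0 => w _; rewrite lee_fin.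
  by rewrite -(fineK NR) -EFinD -EFinM ltry.
have := @dominated_convergence _ _ _ P setT measurableT
  (fun n w => (phi (N_ n w))%:E) (fun w => (phi (N w))%:E) g.
case.
- by move=> n; apply/measurable_EFinP.
- exact/measurable_EFinP.
- apply: filterS N_N => w [m mP] _.
  apply: cvg_near_cst; exists m => // n /= mn; by rewrite mP.
- exact: ig.
- apply: filterS N_le => w Nw n _; rewrite /g lee_fin.
  apply: le_trans (pC _) _; rewrite ler_wpM2l// ler_nat ltnS; exact: Nw.
- by [].
Qed.

End discrete_limit.

(** * Exhaustion by windows of finite measure *)

(** The values are integers bounded by the finite limit, so a largest one is attained, and
    monotonicity keeps the sequence there. *)
Lemma nat_sequence_stationary (R : realType) (u : nat -> \bar R) (s : \bar R) :
  (forall n, exists k, u n = k%:R%:E) -> {homo u : n m / (n <= m)%N >-> n <= m} ->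
  u n @[n --> \oo] --> s -> s < +oo ->
  exists k m, s = k%:R%:E /\ forall n, (m <= n)%N -> u n = s.
Proof.
move=> uN und us soo.
have u_s n : u n <= s.
  rewrite -(cvg_lim _ us)// (cvg_lim _ (ereal_nondecreasing_cvgn und))//.
  by apply: ereal_sup_ubound; exists n.
pose A k := `[< exists n, u n = k%:R%:E >].
have exA : exists k, A k by have [k uk] := uN 0%N; exists k; apply/asboolP; exists 0%N.
have sfin : s \is a fin_num.
  rewrite fin_numE -ltey soo andbT; have [k uk] := uN 0%N.
  by have := u_s 0%N; rewrite uk; case: (s).
have bndA k : A k -> (k <= Num.truncn (fine s))%N.
  move=> /asboolP[n uk]; have := u_s n; rewrite uk -(fineK sfin) lee_fin => ks.
  by rewrite truncn_ge_nat// (le_trans _ ks).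
have [k /asboolP[m um] kmax] := ex_maxnP exA bndA.
have um' n : (m <= n)%N -> u n = k%:R%:E.
  move=> mn; have [j uj] := uN n; apply/eqP; rewrite eq_le -{2}um und// uj lee_fin ler_nat.
  by rewrite andbT kmax//; apply/asboolP; exists n.
have sk : s = k%:R%:E.
  by apply: (cvg_unique _ us) => //; apply: cvg_near_cst; exists m.
by exists k, m; split => // n mn; rewrite um'// sk.
Qed.

Section exhaustion.
Context d (T : measurableType d) d' (Om : measurableType d') (R : realType).
Variables (P : probability Om R) (L : {sigma_finite_measure set T -> \bar R}).
Variable eta : proper_point_process T Om.
Hypothesis eta_poisson : is_poisson_process P L eta.
Variables (l : nat) (h : seq T -> bool).
Hypothesis l_gt0 : (0 < l)%N.
Hypothesis h_sym : forall s t, perm_eq s t -> h s = h t.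
Hypothesis h_meas : smeasurable (fun u => (h u : nat)%:R%:E : \bar R).
Variable F : nat -> set T.
Hypotheses (mF : forall n, measurable (F n)) (LF : forall n, L (F n) < +oo).
Hypotheses (F_T : \bigcup_n F n = setT) (ndF : {homo F : n m / (n <= m)%N >-> n `<=` m}).

Local Notation X := (point eta).
Local Notation hE := (fun u => (h u : nat)%:R%:E : \bar R).

Definition window_measure n : {sigma_finite_measure set T -> \bar R} :=
  mfrestr (mF n) (LF n).

Let mu := window_measure.

Let S w : \bar R := (l`!%:R^-1)%:E * \esum_(p in [set p : l.-tuple nat |
    uniq p /\ forall j, j \in p -> indices eta w j]) (h (map_tuple (X ^~ w) p) : nat)%:R%:E.

Let S_ n : Om -> \bar R := wstat R eta l h (F n).

Lemma exhaust_seq (s : seq T) : exists n, forall m, (n <= m)%N -> within (F m) s.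
Proof.
elim: s => [|x s [n IH]]; first by exists 0%N.
have [i _ Fx] : (\bigcup_n F n) x by rewrite F_T.
exists (maxn n i) => m; rewrite geq_max => /andP[nm im] /=.
by rewrite IH// andbT; apply: mem_set; exact: ndF im _ Fx.
Qed.

Lemma within_homo (s : seq T) n m : (n <= m)%N -> within (F n) s -> within (F m) s.
Proof.
move=> nm; apply: sub_all => x /set_mem Fx; apply: mem_set; exact: ndF nm _ Fx.
Qed.

Lemma wstat_homo w : {homo S_ ^~ w : n m / (n <= m)%N >-> n <= m}.
Proof.
move=> n m nm; rewrite /S_ /wstat lee_wpmul2l ?lee_fin//.
rewrite esum_mkcond [leRHS]esum_mkcond; apply: le_esum => p _.
case: ifPn => [/set_mem[up pF]|_]; last by case: ifP; rewrite lee_fin.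
rewrite mem_set//=; split => // j /pF[? Fj]; split => //; exact: ndF nm _ Fj.
Qed.

(** Finitely many index tuples involve finitely many points, which all lie in one [F n]; hence every
    finite partial sum of [S] is reached by a window statistic. *)
Lemma wstat_cvg w : S_ n w @[n --> \oo] --> S w.
Proof.
apply: cvgeZl => //.
pose D n := [set p : l.-tuple nat | uniq p /\ forall j, j \in p -> hits eta (F n) w j].
pose a (p : l.-tuple nat) : \bar R := (h (map_tuple (X ^~ w) p) : nat)%:R%:E.
have a0 p : 0 <= a p by rewrite lee_fin.
have nd : {homo (fun n => \esum_(p in D n) a p) : n m / (n <= m)%N >-> n <= m}.
  move=> n m nm; rewrite esum_mkcond [leRHS]esum_mkcond; apply: le_esum => p _.
  case: ifPn => [/set_mem[up pF]|_]; last by case: ifP.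
  rewrite mem_set//=; split => // j /pF[? Fj]; split => //; exact: ndF nm _ Fj.
suff -> : \esum_(p in [set p : l.-tuple nat |
    uniq p /\ forall j, j \in p -> indices eta w j]) a p =
  ereal_sup (range (fun n => \esum_(p in D n) a p)) by exact: ereal_nondecreasing_cvgn.
apply/eqP; rewrite eq_le; apply/andP; split; last first.
  apply: ge_ereal_sup => _ [n _ <-]; rewrite esum_mkcond [leRHS]esum_mkcond.
  apply: le_esum => p _; case: ifPn => [/set_mem[up pF]|_]; last by case: ifP.
  by rewrite mem_set//=; split => // j /pF[].
apply: ge_ereal_sup => _ [A [fA AD] <-].
have /finite_seqP[r rA] := fA.
have [n Fn] := exhaust_seq (map (X ^~ w) (flatten (map val r))).
apply: (@le_trans _ _ (\esum_(p in D n) a p)); last first.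
  by apply: ereal_sup_ubound; exists n.
apply: esum_ge; exists A => //; split => // p Ap.
have [up pw] := AD _ Ap; split => // j jp; split; first exact: pw.
have /allP/(_ (X j w)) := Fn n (leqnn n); rewrite inE; apply.
apply: map_f; apply/flattenP; exists (val p) => //; apply: map_f.
by move: Ap; rewrite rA.
Qed.

Let mean_ n := (l`!%:R^-1)%:E * sint (mu n) l hE.

Let lamE := (l`!%:R^-1)%:E * sint L l hE.

Let hE_ge0 u : 0 <= hE u. Proof. by rewrite lee_fin. Qed.

Lemma mean_cvg : mean_ n @[n --> \oo] --> lamE.
Proof.
apply: cvgeZl => //.
have -> : (fun n => sint (mu n) l hE) =
    (fun n => sint L l (fun s => hE s * (within (F n) s : nat)%:R%:E)).
  by apply/funext => n; exact: sint_mfrestr.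
have -> : sint L l hE = \int[power_measure L l]_t
    limn (fun n => hE t * (within (F n) t : nat)%:R%:E).
  apply: eq_integral => t _; apply/esym/cvg_lim => //.
  have [n Fn] := exhaust_seq t.
  by apply: cvg_near_cst; exists n => // m /= nm; rewrite Fn// mule1.
apply: cvg_monotone_convergence => //.
- by move=> n; exact: (smeasurableM h_meas (smeasurable_within (mF n))).
move=> t _ n m nm; rewrite lee_wpmul2l ?lee_fin// ler_nat.
  by case E : (within (F n) t) => //; rewrite (within_homo nm E).
Qed.

Lemma wstat_nat n : {ae P, forall w, exists k, S_ n w = k%:R%:E}.
Proof.
pose E := \bigcup_k num_event R eta (F n) k.
have mE : measurable E by apply: bigcup_measurable => k _; exact: measurable_num_event.
exists (~` E); split; first exact: measurableC.
  have := probability_setC P mE; rewrite /E.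
  by rewrite (num_event_cover eta_poisson (mF n) (LF n)) subee.
move=> w /= nk [k _ Ew]; apply: nk; have [e ew ek] := num_points_finite Ew.
by exists (nstat l h (map (X ^~ w) e)); exact: (wstat_enum R l h_sym ew).
Qed.

Let N_ n w := nat_value (S_ n) w.

Let N w := nat_value S w.

Let mS_ n : measurable_fun setT (S_ n). Proof. exact: measurable_wstat. Qed.

Lemma measurable_tuple_sum : measurable_fun setT S.
Proof.
apply: (emeasurable_fun_cvg (fun n => S_ n)) => // w _; exact: wstat_cvg.
Qed.

Let mS := measurable_tuple_sum.

Let mN_ n (phi : nat -> R) : measurable_fun setT (fun w => phi (N_ n w)).
Proof. exact: measurable_nat_valuep. Qed.

Let mN (phi : nat -> R) : measurable_fun setT (fun w => phi (N w)).
Proof. exact: measurable_nat_valuep. Qed.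

Let V := nstat l h.

Lemma nat_value_wstat_mean n (phi : nat -> R) : (forall j, 0 <= phi j)%R ->
  \int[P]_w (phi (N_ n w))%:E = pint (mu n) (fine (L (F n))) (fun s => (phi (V s))%:E).
Proof. exact: (wstat_mean eta_poisson l h_sym h_meas (mF n) (LF n)). Qed.

Lemma wstat_upper n (psi G : nat -> R) :
  (forall j, 0 <= psi j)%R -> (forall i j, (i <= j)%N -> psi j <= psi i)%R ->
  (forall j, 0 <= G j)%R ->
  (forall s n, G s.+1 <= G (s.+1 + n)%N + n%:R * psi s)%R ->
  mean_ n * \int[P]_w (G (N_ n w).+1)%:E <=
  \int[P]_w ((N_ n w)%:R * G (N_ n w))%:E + rsum l h (mu n) * \int[P]_w (psi (N_ n w))%:E.
Proof.
move=> p0 pd G0 HG.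
rewrite (@nat_value_wstat_mean n (fun j => G j.+1))//.
rewrite (@nat_value_wstat_mean n (fun j => j%:R * G j)%R) => [|j]; last by rewrite mulr_ge0.
rewrite nat_value_wstat_mean//.
have := @stein_chen_upper _ T R l h l_gt0 h_sym h_meas (mu n) (fine (L (F n))) psi p0 pd G G0 HG.
done.
Qed.

Lemma wstat_lower n (psi G : nat -> R) :
  (forall j, 0 <= psi j)%R -> (forall i j, (i <= j)%N -> psi j <= psi i)%R ->
  (forall j, 0 <= G j)%R ->
  (forall s n, G (s.+1 + n)%N <= G s.+1 + n%:R * psi s)%R ->
  \int[P]_w ((N_ n w)%:R * G (N_ n w))%:E <=
  mean_ n * \int[P]_w (G (N_ n w).+1)%:E + rsum l h (mu n) * \int[P]_w (psi (N_ n w))%:E.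
Proof.
move=> p0 pd G0 HG.
rewrite (@nat_value_wstat_mean n (fun j => G j.+1))//.
rewrite (@nat_value_wstat_mean n (fun j => j%:R * G j)%R) => [|j]; last by rewrite mulr_ge0.
rewrite nat_value_wstat_mean//.
have := @stein_chen_lower _ T R l h l_gt0 h_sym h_meas (mu n) (fine (L (F n))) psi p0 pd G G0 HG.
done.
Qed.

Lemma wstat_expectation n : \int[P]_w S_ n w = mean_ n.
Proof.
have SN : \int[P]_w S_ n w = \int[P]_w (N_ n w)%:R%:E.
  apply: ge0_ae_eq_integral => //.
  - by apply/measurable_EFinP; exact: (mN_ n (fun j => j%:R)).
  - by move=> w _; rewrite mule_ge0 ?lee_fin// esum_ge0// => p _; rewrite lee_fin.
  - apply: filterS (wstat_nat n) => w [k Sk] _.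
    by rewrite Sk /N_ (nat_valueE Sk).
have i0 : \int[P]_w (0 : R)%:E = 0 by exact: integral0.
have i1 : \int[P]_w (1 : R)%:E = 1.
  by rewrite integral_cst// mul1e; exact: probability_setT.
have iN : \int[P]_w ((N_ n w)%:R * 1)%:E = \int[P]_w (N_ n w)%:R%:E.
  by under eq_integral do rewrite mulr1.
(* With [G = 1] and [psi = 0] the two coupling inequalities say that the mean is at most and at
   least [mean_ n]. Their error term is 0 even when [rsum] is infinite. *)
apply/eqP; rewrite SN eq_le; apply/andP; split.
  have := @wstat_lower n (fun=> 0%R) (fun=> 1%R).
  by rewrite i0 i1 iN mule1 mule0 adde0; apply => // s m; rewrite mulr0 addr0.
have := @wstat_upper n (fun=> 0%R) (fun=> 1%R).
by rewrite i0 i1 iN mule1 mule0 adde0; apply => // s m; rewrite mulr0 addr0.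
Qed.

Let S_ge0 w : 0 <= S w.
Proof. by rewrite mule_ge0 ?lee_fin// esum_ge0// => p _; rewrite lee_fin. Qed.

Lemma ustat_expectation : \int[P]_w S w = lamE.
Proof.
have -> : \int[P]_w S w = \int[P]_w limn (S_ ^~ w).
  by apply: eq_integral => w _; apply/esym/cvg_lim => //; exact: wstat_cvg.
apply: (cvg_unique _ _ mean_cvg) => //.
have -> : mean_ = (fun n => \int[P]_w S_ n w).
  by apply/funext => n; rewrite wstat_expectation.
apply: cvg_monotone_convergence => //.
  by move=> n w _; rewrite mule_ge0 ?lee_fin// esum_ge0// => p _; rewrite lee_fin.
by move=> w _; exact: wstat_homo.
Qed.

Hypothesis lam_oo : lamE < +oo.

(** A finite mean makes [S] finite almost surely, and the window statistics are integers increasing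
    to [S]. *)
Lemma ustat_stationary : {ae P, forall w, exists k m,
  S w = k%:R%:E /\ forall n, (m <= n)%N -> S_ n w = S w}.
Proof.
have iS : P.-integrable setT S.
  apply/integrableP; split => //.
  by rewrite (eq_integral S) ?ustat_expectation// => w _; rewrite gee0_abs.
have := integrable_ae measurableT iS; have := ae_foralln wstat_nat.
apply: filterS2 => w Sn /(_ I) Sf.
apply: nat_sequence_stationary => //; [exact: wstat_homo|exact: wstat_cvg|].
by rewrite ltey; move: Sf; rewrite fin_numE => /andP[].
Qed.

Lemma ustat_nat : {ae P, forall w, S w = (N w)%:R%:E}.
Proof.
apply: filterS ustat_stationary => w [k [m [Sk _]]].
by rewrite /N (nat_valueE Sk).
Qed.

Let N_N : {ae P, forall w, exists m, forall n, (m <= n)%N -> N_ n w = N w}.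
Proof.
apply: filterS ustat_stationary => w [k [m [Sk Sm]]].
by exists m => n mn; rewrite /N_ /N /nat_value Sm.
Qed.

Let N_le : {ae P, forall w, forall n, (N_ n w <= N w)%N}.
Proof.
have := ae_foralln wstat_nat; have := N_N.
apply: filterS2 => w [m Nm] Sn n.
rewrite -(Nm (maxn n m))/N_ ?leq_maxr//.
have [j Sj] := Sn n; have [k Sk] := Sn (maxn n m).
rewrite (nat_valueE Sj) (nat_valueE Sk) -(ler_nat R) -lee_fin -Sj -Sk.
exact: wstat_homo (leq_maxl _ _).
Qed.

Let N_int : \int[P]_w (N w)%:R%:E < +oo.
Proof.
rewrite -(@ge0_ae_eq_integral _ _ _ P setT S)//.
- by rewrite ustat_expectation.
- by apply/measurable_EFinP; exact: (mN (fun j => j%:R)).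
- apply: filterS ustat_nat => w -> //.
Qed.

Lemma stein_chen_limit (psi G : nat -> R) (C : R) (kap : R) :
  (forall j, 0 <= psi j)%R -> (forall i j, (i <= j)%N -> psi j <= psi i)%R ->
  (forall j, 0 <= G j <= C)%R -> (0 <= kap)%R ->
  (forall n, rsum l h (mu n) * \int[P]_w (psi (N_ n w))%:E <= kap%:E * \int[P]_w (psi (N_ n w))%:E) ->
  [/\ P.-integrable setT (fun w => (G (N w).+1)%:E),
      P.-integrable setT (fun w => ((N w)%:R * G (N w))%:E),
   ((forall s n, G s.+1 <= G (s.+1 + n)%N + n%:R * psi s)%R ->
      lamE * \int[P]_w (G (N w).+1)%:E <=
      \int[P]_w ((N w)%:R * G (N w))%:E + kap%:E * \int[P]_w (psi (N w))%:E) &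
   ((forall s n, G (s.+1 + n)%N <= G s.+1 + n%:R * psi s)%R ->
      \int[P]_w ((N w)%:R * G (N w))%:E <=
      lamE * \int[P]_w (G (N w).+1)%:E + kap%:E * \int[P]_w (psi (N w))%:E)].
Proof.
move=> p0 pd GC kap0 Hkap; have G0 j : (0 <= G j)%R by have /andP[] := GC j.
have C0 : (0 <= C)%R by have /andP[G00 GC0] := GC 0%N; exact: le_trans GC0.
have dd := @discrete_dominated _ Om R P N_ N mN_ mN N_N N_le N_int.
have [j|i1 c1] := dd (fun j => G j.+1) C.
  rewrite ger0_norm//; have /andP[_ GjC] := GC j.+1; apply: le_trans GjC _.
  by rewrite ler_peMr// ler1n.
have [j|i2 c2] := dd (fun j => j%:R * G j)%R C.
  rewrite ger0_norm ?mulr_ge0// mulrC ler_pM// ?ler_nat//.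
  by have /andP[] := GC j.
have [j|i3 c3] := dd psi (psi 0%N).
  rewrite ger0_norm//; apply: (@le_trans _ _ (psi 0%N)); first exact: pd.
  by rewrite ler_peMr// ler1n.
have lam_fin : lamE \is a fin_num.
  by rewrite ge0_fin_numE// mule_ge0 ?lee_fin// sint_ge0.
have f1 := integrable_fin_num measurableT i1.
have f2 := integrable_fin_num measurableT i2.
have f3 := integrable_fin_num measurableT i3.
have cl : mean_ n * \int[P]_w (G (N_ n w).+1)%:E @[n --> \oo] -->
    lamE * \int[P]_w (G (N w).+1)%:E.
  by apply: cvgeM mean_cvg c1; exact: mule_def_fin.
have ck : kap%:E * \int[P]_w (psi (N_ n w))%:E @[n --> \oo] -->
    kap%:E * \int[P]_w (psi (N w))%:E by exact: cvgeZl.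
split => // HG.
- apply: (lee_cvg_to cl (cvgeD _ c2 ck)); first by rewrite fin_num_adde_defr.
  apply: nearW => n; apply: le_trans (wstat_upper n p0 pd G0 HG) _.
  by rewrite leeD2l.
- apply: (lee_cvg_to c2 (cvgeD _ cl ck)); first by rewrite fin_num_adde_defl// fin_numM.
  apply: nearW => n; apply: le_trans (wstat_lower n p0 pd G0 HG) _.
  by rewrite leeD2l.
Qed.

End exhaustion.

(** * Comparison with the Poisson distribution *)

Lemma step_sum (R : realType) (g : nat -> R) (c : R) :
  (forall s, `|g s.+2 - g s.+1| <= c)%R ->
  forall s n, (`|g (s.+1 + n)%N - g s.+1| <= n%:R * c)%R.
Proof.
move=> gc s; elim=> [|n IH]; first by rewrite addn0 subrr normr0 mul0r.
rewrite addnS -natr1 mulrDl mul1r -(subrKA (g (s.+1 + n)%N)) addrC.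
by apply: le_trans (ler_normD _ _) _; apply: lerD => //; exact: gc.
Qed.

Section discrete_approximation.
Context d (Om : measurableType d) (R : realType) (P : probability Om R).
Variables (N : Om -> nat) (lam : R).
Hypothesis lam_gt0 : (0 < lam)%R.
Hypothesis mN : forall phi : nat -> R, measurable_fun setT (fun w => phi (N w)).
Hypothesis N_mean : \int[P]_w (N w)%:R%:E = lam%:E.

Local Notation E := (fun phi : nat -> R => \int[P]_w (phi (N w))%:E).

Let integrable_N : P.-integrable setT (fun w => (N w)%:R%:E).
Proof.
apply/integrableP; split; first by apply/measurable_EFinP; exact: (mN (fun j => j%:R)).
by rewrite (eq_integral (fun w => (N w)%:R%:E)) ?N_mean ?ltry// => w _; rewrite gee0_abs ?lee_fin.
Qed.

Let integrable_growth (phi : nat -> R) : linear_growth phi ->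
  P.-integrable setT (fun w => (phi (N w))%:E).
Proof.
move=> [C pC]; have C0 : (0 <= C)%R.
  by have := pC 0%N; rewrite mulr1; exact: le_trans.
apply: (le_integrable measurableT (g := fun w => C%:E * ((N w)%:R%:E + 1))).
- by apply/measurable_EFinP.
- move=> w _; rewrite -EFinD -EFinM natr1 /= lee_fin [leRHS]ger0_norm ?mulr_ge0//.
- apply: integrableZl => //; apply: integrableD => //.
  exact: finite_measure_integrable_cst.
Qed.

(** The range [0, 2] is that of a Stein solution for Lipschitz data shifted up by 1. *)
Definition coupling_bound (psi : nat -> R) (kap : R) :=
  forall G : nat -> R, (forall j, 0 <= G j <= 2)%R ->
    ((forall s n, G s.+1 <= G (s.+1 + n)%N + n%:R * psi s)%R ->
      lam%:E * E (fun j => G j.+1) <= E (fun j => j%:R * G j)%R + kap%:E * E psi) /\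
    ((forall s n, G (s.+1 + n)%N <= G s.+1 + n%:R * psi s)%R ->
      E (fun j => j%:R * G j)%R <= lam%:E * E (fun j => G j.+1) + kap%:E * E psi).

Lemma poisson_approximation (psi f : nat -> R) (kap : R) (e := E psi) :
  linear_growth psi -> (forall j, `|fdiff f j| <= 1)%R -> coupling_bound psi kap ->
  ((forall s n, stein lam f s.+1 <= stein lam f (s.+1 + n)%N + n%:R * psi s)%R ->
    E f - (pmean f lam)%:E <= kap%:E * e) /\
  ((forall s n, stein lam f (s.+1 + n)%N <= stein lam f s.+1 + n%:R * psi s)%R ->
    (pmean f lam)%:E - E f <= kap%:E * e).
Proof.
move=> psi_growth f1 key; pose G j := (stein lam f j + 1)%R.
have sb j := stein_bounded lam_gt0 f1 j.
have G02 j : (0 <= G j <= 2)%R by have := sb j; rewrite ler_norml /G; lra.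
have iG : P.-integrable setT (fun w => (G (N w).+1)%:E).
  apply: (integrable_growth (phi := fun j => G j.+1)).
  apply: (linear_growth_bounded (c := 2)) => j.
  by have /andP[? ?] := G02 j.+1; rewrite ger0_norm.
have iNG : P.-integrable setT (fun w => ((N w)%:R * G (N w))%:E).
  apply: (integrable_growth (phi := fun j => j%:R * G j)%R); exists 2%R => j.
  have /andP[G0 G2] := G02 j; rewrite ger0_norm ?mulr_ge0// mulrC ler_pM//.
  by rewrite ler_nat.
have if_ : P.-integrable setT (fun w => (f (N w))%:E).
  exact/integrable_growth/linear_growth_lipschitz.
have i1 : \int[P]_w (1 : R)%:E = 1.
  by rewrite integral_cst// mul1e; exact: probability_setT.
have ic (c : R) : P.-integrable setT (fun=> c%:E).
  exact: finite_measure_integrable_cst.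
have icE (c : R) : \int[P]_w c%:E = c%:E.
  by rewrite integral_cst// [X in _ * X]probability_setT mule1.
(* The shift by 1 adds [lam - j] to the Stein equation, which integrates to 0 since the mean of [N]
   is [lam]. *)
have pw j : (f j + j%:R * G j + lam = pmean f lam + lam * G j.+1 + j%:R)%R.
  by have := steinE lam_gt0 f j; rewrite /G; lra.
have iZ : P.-integrable setT (fun w => lam%:E * (G (N w).+1)%:E) by exact: integrableZl.
have hI : E f + E (fun j => j%:R * G j)%R + lam%:E =
    (pmean f lam)%:E + lam%:E * E (fun j => G j.+1) + lam%:E.
  transitivity (\int[P]_w ((f (N w))%:E + ((N w)%:R * G (N w))%:E + lam%:E)).
    rewrite integralD//; last exact: integrableD.
    by rewrite integralD// icE.
  transitivity (\int[P]_w ((pmean f lam)%:E + lam%:E * (G (N w).+1)%:E + (N w)%:R%:E)).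
    by apply: eq_integral => w _; rewrite -EFinM -!EFinD pw.
  rewrite integralD//; last exact: integrableD.
  by rewrite integralD// icE integralZl// N_mean.
have ep := integrable_fin_num measurableT (integrable_growth psi_growth).
move: hI (key G G02); rewrite /e.
rewrite -(fineK (integrable_fin_num measurableT iG)).
rewrite -(fineK (integrable_fin_num measurableT iNG)).
rewrite -(fineK (integrable_fin_num measurableT if_)) -(fineK ep).
set x1 := fine _; set x2 := fine _; set x3 := fine _; set x4 := fine _.
rewrite -!EFinM -?EFinB -!EFinD -?EFinB !lee_fin => -[hI] [k1 k2]; split => Hs.
- have : (lam * x3 <= x2 + kap * x4)%R.
    by apply: k1 => s n; rewrite /G addrAC lerD2r.
  by move: hI; lra.
- have : (x2 <= lam * x3 + kap * x4)%R.
    by apply: k2 => s n; rewrite /G addrAC lerD2r.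
  by move: hI; lra.
Qed.

Let fdiff_unit (f : nat -> R) : (forall j, 0 <= f j <= 1)%R ->
  forall j, (`|fdiff f j| <= 1)%R.
Proof.
move=> f01 j; have := f01 j; have := f01 j.+1; rewrite /fdiff ler_norml; lra.
Qed.

(** For the indicator of 0 the Stein solution is nonincreasing on the positive integers, so one
    direction costs no error. *)
Lemma poisson_zero_ge : coupling_bound (fun=> 0%R) 0 ->
  (pmean (fun k => (k <= 0)%N%:R) lam)%:E <= E (fun k => (k <= 0)%N%:R).
Proof.
move=> key; have lg0 : linear_growth (fun=> 0%R : R).
  by apply: (linear_growth_bounded (c := 0)) => k; rewrite normr0.
have f01 : forall k, (0 <= ((k <= 0)%N%:R : R) <= 1)%R by case=> [|k] /=; rewrite ?ler01 ?lexx.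
have [_ k2] := poisson_approximation lg0 (fdiff_unit f01) key.
have fin : E (fun k => (k <= 0)%N%:R) \is a fin_num.
  apply: integrable_fin_num => //.
  exact: (integrable_growth (linear_growth_lipschitz (fdiff_unit f01))).
move: k2; rewrite mul0e leeBlDr// add0e; apply.
by move=> s n; rewrite mulr0 addr0; exact: (stein_lower_set_nonincreasing lam_gt0).
Qed.

Variable kap : R.
Hypothesis kap_ge0 : (0 <= kap)%R.
Hypothesis key : forall psi, (forall j, 0 <= psi j)%R ->
  (forall i j, (i <= j)%N -> psi j <= psi i)%R -> coupling_bound psi kap.

Let mono_growth (psi : nat -> R) : (forall j, 0 <= psi j)%R ->
  (forall i j, (i <= j)%N -> psi j <= psi i)%R -> linear_growth psi.
Proof.
move=> p0 pd; apply: (linear_growth_bounded (c := psi 0%N)) => k.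
by rewrite ger0_norm// pd.
Qed.

Let two_sided (psi f : nat -> R) : (forall j, 0 <= psi j)%R ->
  (forall i j, (i <= j)%N -> psi j <= psi i)%R -> (forall j, `|fdiff f j| <= 1)%R ->
  (forall s n, `|stein lam f (s.+1 + n)%N - stein lam f s.+1| <= n%:R * psi s)%R ->
  `|E f - (pmean f lam)%:E| <= kap%:E * E psi.
Proof.
move=> p0 pd f1 gp.
have [k1 k2] := poisson_approximation (mono_growth p0 pd) f1 (key p0 pd).
have {}k1 : E f - (pmean f lam)%:E <= kap%:E * E psi.
  by apply: k1 => s n; have := gp s n; rewrite ler_norml; lra.
have {}k2 : (pmean f lam)%:E - E f <= kap%:E * E psi.
  by apply: k2 => s n; have := gp s n; rewrite ler_norml; lra.
have fin : E f \is a fin_num.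
  by apply: integrable_fin_num => //; exact/integrable_growth/linear_growth_lipschitz.
have finp : E psi \is a fin_num.
  by apply: integrable_fin_num => //; exact/integrable_growth/mono_growth.
move: k1 k2; rewrite -(fineK fin) -(fineK finp) -!EFinB -!EFinM /= !lee_fin ler_norml.
lra.
Qed.

Lemma poisson_constant_bound (f : nat -> R) (c : R) : (0 <= c)%R ->
  (forall j, `|fdiff f j| <= 1)%R ->
  (forall s, `|stein lam f s.+2 - stein lam f s.+1| <= c)%R ->
  `|E f - (pmean f lam)%:E| <= (c * kap)%:E.
Proof.
move=> c0 f1 gc; have := two_sided (psi := fun=> c) (fun=> c0) (fun _ _ _ => lexx c) f1 (step_sum gc).
by rewrite integral_cst// [X in _ * (_ * X)]probability_setT mule1 -EFinM mulrC.
Qed.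

(** A nonnegative solution decreases by at most its starting value, so it suffices that [psi s]
    dominates [stein] at [s.+1]. *)
Lemma poisson_zero_le m :
  E (fun k => (k <= 0)%N%:R) - (pmean (fun k => (k <= 0)%N%:R) lam)%:E <=
  kap%:E * E (fun s => \sum_(0 <= k < m)
    Num.min (k.+1%:R^-1) (k`!%:R / lam ^+ k.+1) * (s <= k)%N%:R + m`!%:R / lam ^+ m.+1)%R.
Proof.
set psi := (fun s : nat => (_ + _)%R : R).
have c0 k : (0 <= Num.min (k.+1%:R^-1) (k`!%:R / lam ^+ k.+1))%R.
  by rewrite le_min invr_ge0 ler0n divr_ge0// exprn_ge0// ltW.
have p0 j : (0 <= psi j)%R.
  by rewrite addr_ge0 ?divr_ge0 ?exprn_ge0 ?(ltW lam_gt0)// sumr_ge0// => k _; rewrite mulr_ge0.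
have pd i j : (i <= j)%N -> (psi j <= psi i)%R.
  move=> ij; rewrite lerD2r; apply: ler_sum => k _; rewrite ler_wpM2l// ler_nat.
  by case: (leqP j k) => // jk; rewrite (leq_trans ij jk).
have f01 : forall k, (0 <= ((k <= 0)%N%:R : R) <= 1)%R by case=> [|k] /=; rewrite ?ler01 ?lexx.
have [+ _] := poisson_approximation (mono_growth p0 pd) (fdiff_unit f01) (key p0 pd).
apply=> s [|n]; first by rewrite addn0 mul0r addr0.
have g0 k : (0 < k)%N -> (0 <= stein lam (fun k => (k <= 0)%N%:R) k)%R.
  exact: (stein_lower_set_ge0 lam_gt0).
rewrite -[leLHS]add0r lerD ?g0//.
apply: (@le_trans _ _ (psi s)); last by rewrite ler_peMl// ler1n.
(* For [s < m] the summand [k = s] alone dominates; for [s >= m] monotonicity reduces to the value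
   at [m.+1], covered by the last term of [psi]. *)
have [sm|ms] := ltnP s m.
  rewrite /psi (big_cat_nat (leq0n s) (ltnW sm)).
  rewrite [X in (_ + X + _)%R]big_ltn// leqnn mulr1.
  set mn := Num.min _ _; set r1 := (\sum_(0 <= _ < s) _)%R; set r2 := (\sum_(s.+1 <= _ < m) _)%R.
  have r10 : (0 <= r1)%R by apply: sumr_ge0 => k _; rewrite mulr_ge0.
  have r20 : (0 <= r2)%R by apply: sumr_ge0 => k _; rewrite mulr_ge0.
  have gs : (stein lam (fun k => (k <= 0)%N%:R) s.+1 <= mn)%R.
    by rewrite le_min stein_zero_le_inv// stein_zero_le_fact.
  have : (0 <= m`!%:R / lam ^+ m.+1)%R by rewrite divr_ge0// exprn_ge0// ltW.
  move=> t0; rewrite -[leRHS]/(r1 + (mn + r2) + m`!%:R / lam ^+ m.+1)%R.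
  by move: (m`!%:R / lam ^+ m.+1)%R t0 r10 r20 gs => t; lra.
apply: (@le_trans _ _ (m`!%:R / lam ^+ m.+1)%R); last by rewrite lerDr sumr_ge0// => k _; rewrite mulr_ge0.
apply: le_trans (stein_zero_le_fact lam_gt0 m (erefl 0%N)).
by rewrite -(subnKC ms) -addSn; exact: (stein_lower_set_nonincreasing lam_gt0).
Qed.

(** Steps of size at most [lam^-1] are covered by the indicator term if [s <= v], and by the
    constant if [lam < v.+1]. Otherwise the solution is nonnegative and nonincreasing from [s.+1]
    on, and [stein_lower_set_le] bounds it there. *)
Lemma poisson_lower_set_bound v :
  `|E (fun k => (k <= v)%N%:R) - (pmean (fun k => (k <= v)%N%:R) lam)%:E| <=
  kap%:E * E (fun s => v.+1%:R ^+ 2 / lam ^+ 2 + lam^-1 * (s <= v)%N%:R)%R.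
Proof.
set f := (fun k : nat => ((k <= v)%N%:R : R)); set psi := (fun s : nat => (_ + _)%R : R).
have f01 k : (0 <= f k <= 1)%R by rewrite /f; case: (k <= v)%N; rewrite ?lexx ?ler01.
have li0 : (0 <= lam^-1)%R by rewrite invr_ge0 ltW.
have a0 : (0 <= v.+1%:R ^+ 2 / lam ^+ 2)%R.
  by rewrite divr_ge0 ?exprn_ge0// ltW.
apply: two_sided => [j|i j ij||s n]; [| |exact: fdiff_unit|].
- by rewrite addr_ge0// mulr_ge0.
- rewrite lerD2l ler_wpM2l// ler_nat.
  by case: (leqP j v) => // jv; rewrite (leq_trans ij jv).
have step k : (`|stein lam f k.+2 - stein lam f k.+1| <= lam^-1)%R.
  by apply: le_trans (stein_tv lam_gt0 k f01) _; rewrite ge_min lexx orbT.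
have nl : (`|stein lam f (s.+1 + n)%N - stein lam f s.+1| <= n%:R * lam^-1)%R.
  exact: step_sum.
have [vl|lv] := leP v.+1%:R lam; last first.
  apply: le_trans nl _; rewrite ler_wpM2l//.
  apply: (@le_trans _ _ (v.+1%:R ^+ 2 / lam ^+ 2)%R); last by rewrite lerDl mulr_ge0.
  have x1 : (1 <= v.+1%:R / lam)%R by rewrite ler_pdivlMr// mul1r ltW.
  apply: (@le_trans _ _ (v.+1%:R / lam)%R); first by rewrite ler_peMl// ler1n.
  by rewrite -expr_div_n expr2 ler_peMl// (le_trans ler01).
have [sv|vs] := leqP s v.
  apply: le_trans nl _; rewrite ler_wpM2l//.
  by rewrite /psi sv mulr1 lerDr.
case: n nl => [|n] _; first by rewrite addn0 subrr normr0 mul0r.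
have n1 : (1 <= n.+1%:R :> R)%R by rewrite ler1n.
have g1 : (stein lam f (s.+1 + n.+1) <= stein lam f s.+1)%R.
  by apply: stein_lower_set_nonincreasing => //; exact: ltnW.
have g2 : (0 <= stein lam f (s.+1 + n.+1))%R.
  by apply: stein_lower_set_ge0 => //; lia.
have g3 : (stein lam f s.+1 <= v.+1%:R ^+ 2 / lam ^+ 2)%R by exact: stein_lower_set_le.
rewrite ler0_norm ?subr_le0// opprB.
apply: (@le_trans _ _ (psi s)); last by rewrite ler_peMl// addr_ge0// mulr_ge0.
have : (0 <= lam^-1 * (s <= v)%:R :> R)%R by rewrite mulr_ge0.
by rewrite /psi; move: g2 g3; lra.
Qed.

End discrete_approximation.

(** * Integrals with respect to the Poisson distribution *)

Section poisson_mean.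
Context (R : realType) (lam : R).
Hypothesis lam_gt0 : (0 < lam)%R.

Lemma integral_poisson_prob (phi : nat -> R) : (forall k, 0 <= phi k)%R ->
  linear_growth phi ->
  \int[poisson_prob lam 0]_k (phi k)%:E = (pmean phi lam)%:E.
Proof.
move=> p0 pg.
rewrite (@integral_nat_valued _ _ R (poisson_prob lam 0) setT id phi)//.
apply/cvg_lim => //; rewrite (_ : (fun n => \sum_(0 <= j < n) (phi j)%:E * _) =
  EFin \o (fun n => \sum_(0 <= k < n) pmass lam k * phi k)%R).
  by apply/fine_cvgP; split; [exact: nearW|exact: cvg_pmean].
apply/funext => n /=; rewrite -sumEFin; apply: eq_bigr => k _.
rewrite setTI EFinM muleC; congr (_ * _).
by apply: poisson_probE; exact: ltW.
Qed.

Lemma poisson_prob_pmean (A : set nat) :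
  poisson_prob lam 0 A = (pmean (fun k => (k \in A)%:R) lam)%:E.
Proof.
rewrite -integral_poisson_prob//; last first.
  by apply: (linear_growth_bounded (c := 1)) => k; case: (k \in A); rewrite ?normr1 ?normr0.
transitivity (\int[poisson_prob lam 0]_k (\1_A k)%:E) => //.
by rewrite integral_indic// setIT.
Qed.

Lemma poisson_expectation (g : nat -> R) : (forall k, `|fdiff g k| <= 1)%R ->
  'E_(poisson_prob lam 0)[g] = (pmean g lam)%:E.
Proof.
(* A Lipschitz [g] may be negative and unbounded; [a] is nonnegative and differs from [g] by an
   explicit affine function. *)
move=> g1; pose a k := (g k - g 0%N + k%:R)%R.
have gl k : (`|g k - g 0%N| <= k%:R)%R.
  elim: k => [|k IH]; first by rewrite subrr normr0.
  have := g1 k; rewrite /fdiff -natr1; move: IH; rewrite !ler_norml; lra.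
have a0 k : (0 <= a k)%R by have := gl k; rewrite /a ler_norml; lra.
have lga : linear_growth a.
  exists 2%R => k; rewrite ger0_norm// /a -natr1; have := gl k; rewrite ler_norml.
  have : (0 <= k%:R :> R)%R by []. lra.
have lgn : linear_growth (fun k => k%:R : R).
  by exists 1%R => k; rewrite ger0_norm// mul1r ler_nat.
have ia : (poisson_prob lam 0).-integrable setT (EFin \o a).
  apply/integrableP; split => //.
  under eq_integral do rewrite gee0_abs ?lee_fin//.
  by rewrite (integral_poisson_prob a0 lga) ltry.
have in_ : (poisson_prob lam 0).-integrable setT (fun k => k%:R%:E).
  apply/integrableP; split => //.
  under eq_integral do rewrite gee0_abs ?lee_fin//.
  by rewrite (integral_poisson_prob (fun k => ler0n _ k) lgn) ltry.
have ic : (poisson_prob lam 0).-integrable setT (fun=> (g 0%N)%:E).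
  exact: finite_measure_integrable_cst.
have gE k : (g k = a k - k%:R + g 0%N)%R by rewrite /a; ring.
rewrite unlock; transitivity (\int[poisson_prob lam 0]_k ((a k)%:E - k%:R%:E + (g 0%N)%:E)).
  by apply: eq_integral => k _; rewrite -EFinB -EFinD -gE.
rewrite integralD//; last exact: integrableB.
rewrite integralB// integral_cst// [X in _ * X]probability_setT mule1.
rewrite (integral_poisson_prob a0 lga) (integral_poisson_prob (fun k => ler0n _ k) lgn).
rewrite -EFinB -EFinD; congr EFin.
have : pmean a lam = pmean (fun k => (g k + (k%:R + - g 0%N))%R) lam.
  by congr pmean; apply/funext => k; rewrite /a; ring.
have lgc : linear_growth (fun=> - g 0%N : R)%R.
  by apply: (linear_growth_bounded (c := `|g 0%N|)) => k; rewrite normrN.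
have lgg := linear_growth_lipschitz g1.
have lgs : linear_growth (fun k => k%:R - g 0%N : R)%R.
  exists (1 + `|g 0%N|)%R => k; apply: le_trans (ler_normB _ _) _.
  rewrite ger0_norm// mulrDl mul1r lerD ?ler_nat// ler_peMr// ler1n//.
have cE : pmean (fun=> - g 0%N : R)%R lam = (- g 0%N)%R := pmean_cst _ _.
rewrite (pmeanD lam lgg lgs) (pmeanD lam lgn lgc) cE.
by move=> ->; ring.
Qed.

End poisson_mean.

Lemma sum_bin_le l : (\sum_(1 <= i < l) 'C(l, i) <= 2 ^ l)%N.
Proof.
have -> : (2 ^ l = \sum_(0 <= i < l.+1) 'C(l, i))%N.
  rewrite -[2%N]/(1 + 1)%N expnDn big_mkord; apply: eq_bigr => i _.
  by rewrite !exp1n !muln1.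
case: l => [|l]; first by rewrite big_geq.
rewrite [leqRHS]big_nat_recr//=; apply: leq_trans (leq_addr _ _).
by rewrite [leqRHS]big_ltn// leq_addl.
Qed.

(** * The kernel as a predicate on sequences *)

Section seq_kernel.
Context d (T : measurableType d) (R : realType) (l : nat).
Variable h : l.-tuple T -> R.
Hypothesis h01 : forall x, h x = 0%R \/ h x = 1%R.
Hypothesis h_sym : symmetric_kernel h.
Hypothesis h_meas : measurable_fun setT h.

(** Sequences of a length other than [l] get the value false; concatenation and selection then need
    no casts. *)
Definition seq_kernel (s : seq T) : bool :=
  if insub s is Some t then h t == 1%R else false.

Lemma seq_kernelE (t : l.-tuple T) : ((seq_kernel t : nat)%:R = h t)%R.
Proof.
by rewrite /seq_kernel valK; case: (h01 t) => ->; rewrite ?eqxx// eq_sym oner_eq0.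
Qed.

Lemma seq_kernel_sym s t : perm_eq s t -> seq_kernel s = seq_kernel t.
Proof.
move=> st; have [sl|sl] := boolP (size s == l); last first.
  by rewrite /seq_kernel !insubN// -?(perm_size st).
have tl : size t == l by rewrite -(perm_size st).
have : perm_eq (Tuple sl) (Tuple tl) by [].
move=> /tuple_permP[p sE].
rewrite /seq_kernel (insubT (fun s => size s == l) sl) (insubT (fun s => size s == l) tl).
by rewrite -(h_sym p (Tuple tl)); congr (h _ == _); apply: val_inj.
Qed.

Lemma smeasurable_seq_kernel :
  smeasurable (fun s => (seq_kernel s : nat)%:R%:E : \bar R).
Proof.
move=> k; have [<-|kl] := eqVneq l k.
  rewrite (_ : (fun t => _) = EFin \o h); first exact/measurable_EFinP.
  by apply/funext => t; rewrite seq_kernelE.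
rewrite (_ : (fun t => _) = cst 0)//; apply/funext => t /=.
by rewrite /seq_kernel insubN// size_tuple eq_sym.
Qed.

Variable L : {sigma_finite_measure set T -> \bar R}.
Hypothesis h_int : (power_measure L l).-integrable setT (EFin \o h).

Lemma seq_kernel_mean :
  (l`!%:R^-1)%:E * sint L l (fun s => (seq_kernel s : nat)%:R%:E) = (ustat_mean L h)%:E.
Proof.
rewrite /ustat_mean EFinM; congr (_ * _).
rewrite /Rintegral fineK; last exact: integrable_fin_num.
by apply: eq_integral => t _; rewrite seq_kernelE.
Qed.

Lemma ustat_r_ge0 : 0 <= ustat_r L h.
Proof. by apply: bigmax_ge_id. Qed.

Lemma rterm_le_ustat_r i : (0 < i < l)%N -> rterm l seq_kernel L i <= ustat_r L h.
Proof.
move=> /andP[i0 il]; pose i' := Ordinal il.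
rewrite /ustat_r; apply: le_trans (le_bigmax_cond _ _ (i0 : (0 < i')%N)).
rewrite le_eqVlt; apply/orP; left; apply/eqP; apply: eq_integral => x _.
congr (_ ^+ 2); apply: eq_integral => y _; rewrite -seq_kernelE.
by rewrite val_tcast.
Qed.

(** The factor [(l - i)!] is dropped, every term is bounded by the maximum, and the binomial
    coefficients sum to at most [2 ^ l]. *)
Lemma rsum_le_ustat_r :
  rsum l seq_kernel L <= ((2 ^+ l / l`!%:R)%R : R)%:E * ustat_r L h.
Proof.
have r0 := ustat_r_ge0.
apply: (@le_trans _ _ (\sum_(1 <= i < l) ('C(l, i)%:R / l`!%:R)%:E * ustat_r L h)).
  rewrite /rsum big_nat_cond [leRHS]big_nat_cond; apply: lee_sum => i /andP[il _].
  apply: lee_pmul; [by rewrite lee_fin divr_ge0| | |exact: rterm_le_ustat_r].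
    by apply: sint_ge0 => s; rewrite expe2 mule_ge0// sint_ge0// => u; rewrite lee_fin.
  rewrite lee_fin ler_wpM2l// -natrM lef_pV2 ?posrE ?ltr0n ?muln_gt0 ?fact_gt0//.
  by rewrite ler_nat leq_pmulr// fact_gt0.
rewrite -ge0_sume_distrl; last by move=> i _; rewrite lee_fin divr_ge0.
rewrite lee_wpmul2r// sumEFin lee_fin -mulr_suml ler_wpM2r ?invr_ge0//.
by rewrite -natr_sum -natrX ler_nat sum_bin_le.
Qed.

End seq_kernel.

Theorem theorem3p3
  (R : realType)
  (d : measure_display) (T : measurableType d)
  (d' : measure_display) (Om : measurableType d') (P : probability Om R)
  (L : {sigma_finite_measure set T -> \bar R})
  (eta : proper_point_process T Om) (eta_poisson : is_poisson_process P L eta)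
  (l : nat) (l_gt0 : (0 < l)%N)
  (h : l.-tuple T -> R)
  (h01 : forall x, h x = 0%R \/ h x = 1%R)
  (h_sym : symmetric_kernel h)
  (h_meas : measurable_fun [set: l.-tuple T] h)
  (h_int : (power_measure L l).-integrable [set: l.-tuple T] (EFin \o h)) :
  let S : Om -> \bar R := ustat eta h in
  let lambda : R := ustat_mean L h in
  let K : \bar R := ((2 ^+ l / l`!%:R)%R : R)%:E * ustat_r L h in
  (0 < lambda)%R ->
  \int[P]_w S w = lambda%:E /\
  dTV_poisson P S lambda <= (Num.min 1 lambda^-1)%R%:E * K /\
  dW_poisson P S lambda <=
    (Num.min 1 (11437 / 10000 / Num.sqrt lambda))%R%:E * K /\
  (forall m : nat, (0 < m)%N ->
    0 <= P [set w | S w = 0] - (expR (- lambda))%:E /\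
    P [set w | S w = 0] - (expR (- lambda))%:E <=
      (\sum_(0 <= k < m)
         (Num.min (k.+1%:R^-1) (k`!%:R / lambda ^+ k.+1))%R%:E *
         P [set w | S w <= k%:R%:E]
       + (m`!%:R / lambda ^+ m.+1)%R%:E) * K) /\
  (forall v : nat, (0 < v)%N ->
    `|P [set w | S w <= v%:R%:E] - poisson_prob lambda 0 [set k | (k <= v)%N]|
      <= ((v.+1%:R ^+ 2 / lambda)%R%:E + P [set w | S w <= v%:R%:E])
         * ((lambda^-1)%R%:E * K)).
Proof.
move=> S lambda K lam_gt0.
have [F [TF ndF Foo]] := (sigma_finiteP _ _).1 (sigma_finiteT L).
have mF n := (Foo n).1; have LF n := (Foo n).2.
have F_T : \bigcup_n F n = setT by [].
have {}ndF : {homo F : n m / (n <= m)%N >-> n `<=` m} by move=> n m /ndF /subsetPset.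
pose hs := seq_kernel h.
have hs_sym s t : perm_eq s t -> hs s = hs t by exact: seq_kernel_sym.
have hs_meas : smeasurable (fun s => (hs s : nat)%:R%:E : \bar R).
  exact: smeasurable_seq_kernel.
have SE : S = (fun w => (l`!%:R^-1)%:E * \esum_(p in [set p : l.-tuple nat |
    uniq p /\ forall j, j \in p -> indices eta w j])
    (hs (map_tuple (point eta ^~ w) p) : nat)%:R%:E).
  apply/funext => w; congr (_ * _); apply: eq_esum => p _.
  by rewrite /hs (seq_kernelE h01).
have lamE : (l`!%:R^-1)%:E * sint L l (fun s => (hs s : nat)%:R%:E) = lambda%:E.
  exact: seq_kernel_mean.
have lam_oo : (l`!%:R^-1)%:E * sint L l (fun s => (hs s : nat)%:R%:E) < +oo.
  by rewrite lamE ltry.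
have S_mean : \int[P]_w S w = lambda%:E.
  by rewrite SE (ustat_expectation eta_poisson l_gt0 hs_sym hs_meas mF LF F_T ndF).
pose N := nat_value S.
have SN : {ae P, forall w, S w = (N w)%:R%:E}.
  by rewrite /N SE; exact: (ustat_nat eta_poisson l_gt0 hs_sym hs_meas mF LF F_T ndF lam_oo).
have mS : measurable_fun setT S.
  by rewrite SE; exact: (measurable_tuple_sum eta l hs_meas mF F_T ndF).
have mN (phi : nat -> R) : measurable_fun setT (fun w => phi (N w)).
  exact: measurable_nat_valuep.
have N_mean : \int[P]_w (N w)%:R%:E = lambda%:E.
  rewrite -S_mean; apply: ge0_ae_eq_integral => //.
  - by apply/measurable_EFinP; exact: (mN (fun j => j%:R)).
  - by move=> w _; rewrite mule_ge0 ?lee_fin// esum_ge0// => p _; case: (h01 (map_tuple (point eta ^~ w) p)) => ->.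
  - by apply: filterS SN => w ->.
have key psi kap : (forall j, 0 <= psi j)%R -> (forall i j, (i <= j)%N -> psi j <= psi i)%R ->
    (0 <= kap)%R ->
    (forall n, rsum l hs (window_measure mF LF n) *
       \int[P]_w (psi (nat_value (wstat R eta l hs (F n)) w))%:E <=
     kap%:E * \int[P]_w (psi (nat_value (wstat R eta l hs (F n)) w))%:E) ->
    coupling_bound P N lambda psi kap.
  move=> p0 pd kap0 Hkap G G02; rewrite -lamE.
  have [_ _ k1 k2] := stein_chen_limit eta_poisson l_gt0 hs_sym hs_meas F_T ndF lam_oo p0 pd G02 kap0 Hkap.
  by move: k1 k2; rewrite -SE.
(* This instance does not involve [K], so the lower bound on the probability of 0 also covers
   infinite [K]. *)
have key0 : coupling_bound P N lambda (fun=> 0%R) 0.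
  apply: key => // n; rewrite mul0e.
  by rewrite [X in _ * X](_ : _ = 0) ?mule0//; exact: integral0.
have r0 : 0 <= ustat_r L h by exact: ustat_r_ge0.
have K0 : 0 <= K by rewrite mule_ge0// lee_fin divr_ge0// exprn_ge0.
have keyK kap : K = kap%:E -> forall psi, (forall j, 0 <= psi j)%R ->
    (forall i j, (i <= j)%N -> psi j <= psi i)%R -> coupling_bound P N lambda psi kap.
  move=> KE psi p0 pd; apply: key => //; first by rewrite -lee_fin -KE.
  move=> n; rewrite lee_wpmul2r ?integral_ge0// => [w _|]; first by rewrite lee_fin.
  rewrite -KE; apply: le_trans (rsum_le_ustat_r h01 L).
  exact: rsum_mfrestr_le.
(* [S] equals the integer [N] only almost surely, so events in [S] become means of functions of [N]
   up to null sets. *)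
have PE (q : nat -> bool) (B : set Om) : measurable B ->
    (forall w, S w = (N w)%:R%:E -> B w <-> q (N w)) ->
    P B = \int[P]_w ((q (N w))%:R)%:E.
  move=> mB Bq; rewrite -(setIT B) -[LHS](integral_indic P measurableT)//.
  apply: ge0_ae_eq_integral => //.
  - by apply/measurable_EFinP.
  - by apply/measurable_EFinP; exact: (mN (fun j => (q j)%:R)).
  - apply: filterS SN => w Sw _; rewrite indicE; congr (_%:R%:E); congr nat_of_bool.
    by apply/idP/idP => [/set_mem/(Bq _ Sw)//|/(Bq _ Sw)/mem_set].
have mle v : measurable [set w | S w <= v%:R%:E].
  by rewrite -[X in measurable X]setTI; exact: emeasurable_fun_infty_c.
have Ple v : P [set w | S w <= v%:R%:E] = \int[P]_w ((N w <= v)%N%:R)%:E.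
  apply: (PE (fun k => (k <= v)%N)) => //.
  by move=> w /= ->; rewrite lee_fin ler_nat.
have P0 : P [set w | S w = 0] = \int[P]_w ((N w <= 0)%N%:R)%:E.
  apply: (PE (fun k => (k <= 0)%N)).
    by rewrite -[X in measurable X]setTI; exact: (mS measurableT _ (emeasurable_set1 0)).
  move=> w /= ->; rewrite leqn0; split => [[] /eqP|/eqP -> //].
  by rewrite pnatr_eq0.
have poisle v : poisson_prob lambda 0 [set k | (k <= v)%N] =
    (pmean (fun k => (k <= v)%N%:R) lambda)%:E.
  rewrite poisson_prob_pmean//; congr (pmean _ _)%:E; apply/funext => k.
  by congr (_%:R); congr nat_of_bool; apply/idP/idP; rewrite inE.
have exp0 : (expR (- lambda))%:E = (pmean (fun k => (k <= 0)%N%:R) lambda)%:E.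
  by rewrite pmean_lower_set /pcdf big_nat1 /pmass expr0 divr1 mul1r.
split => //; split; [|split; [|split]].
- apply: ge_ereal_sup => _ [A _ <-].
  have [c0 c1] : (0 < Num.min 1 lambda^-1)%R /\ true by rewrite lt_min ltr01 invr_gt0.
  have mA : measurable (nat_event S A).
    have -> : nat_event S A = \bigcup_(k in A) S @^-1` [set k%:R%:E].
      by apply/seteqP; split => w [k Ak Sk]; exists k.
    apply: bigcup_measurable => k _; rewrite -[X in measurable X]setTI.
    exact: (mS measurableT _ (emeasurable_set1 _)).
  rewrite poisson_prob_pmean// (PE (fun k => k \in A))//; last first.
    move=> w Sw; split => [[k Ak]|]; first by rewrite Sw => -[] /eqP; rewrite eqr_nat => /eqP ->; exact: mem_set.
    by move=> /set_mem AN; exists (N w).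
  (* For infinite [K] strict positivity of the prefactor matters: a zero prefactor would make the
     product 0 by convention. *)
  have [->|Kfin] := eqVneq K +oo; first by rewrite gt0_muley ?leey// lte_fin.
  have KE : K = (fine K)%:E by rewrite fineK// ge0_fin_numE// ltey.
  have f01 k : (0 <= ((k \in A)%:R : R) <= 1)%R by case: (k \in A); rewrite ?lexx ?ler01.
  rewrite KE -EFinM; apply: (poisson_constant_bound lam_gt0 mN N_mean (keyK _ KE)); first exact: ltW.
    by move=> j; have := f01 j; have := f01 j.+1; rewrite /fdiff ler_norml; lra.
  by move=> s; exact: stein_tv.
- apply: ge_ereal_sup => _ [g g1 <-].
  have [c cE c_gt0] : exists2 c : R, c = (11437 / 10000)%R & (0 < c)%R.
    by exists (11437 / 10000)%R; [reflexivity|lra].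
  rewrite -cE; have c0 : (0 < Num.min 1 (c / Num.sqrt lambda))%R.
    by rewrite lt_min ltr01 divr_gt0// sqrtr_gt0.
  have [->|Kfin] := eqVneq K +oo; first by rewrite gt0_muley ?leey// lte_fin.
  have KE : K = (fine K)%:E by rewrite fineK// ge0_fin_numE// ltey.
  have gd k : (`|fdiff g k| <= 1)%R.
    by apply: le_trans (g1 _ _) _; rewrite -natr1 addrAC subrr add0r normr1.
  rewrite poisson_expectation// unlock KE -EFinM.
  apply: (poisson_constant_bound lam_gt0 mN N_mean (keyK _ KE)) => //; first exact: ltW.
  by move=> s; rewrite cE; exact: stein_wasserstein.
- move=> m m_gt0; rewrite P0 exp0; split.
    by rewrite sube_ge0//; exact: (poisson_zero_ge lam_gt0 mN N_mean key0).
  have c0 k : (0 <= Num.min (k.+1%:R^-1) (k`!%:R / lambda ^+ k.+1))%R.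
    by rewrite le_min invr_ge0 ler0n divr_ge0// exprn_ge0// ltW.
  have t0 : (0 < m`!%:R / lambda ^+ m.+1)%R by rewrite divr_gt0 ?exprn_gt0// ltr0n fact_gt0.
  set A := \sum_(0 <= k < m) _.
  have A0 : 0 <= A by apply: sume_ge0 => k _; rewrite mule_ge0// lee_fin.
  have [->|Kfin] := eqVneq K +oo.
    by rewrite gt0_muley ?leey//; apply: lt_le_trans (leeDr _ A0); rewrite lte_fin.
  have KE : K = (fine K)%:E by rewrite fineK// ge0_fin_numE// ltey.
  apply: le_trans (poisson_zero_le lam_gt0 mN N_mean (keyK _ KE) m) _.
  have kap0 : (0 <= fine K)%R by apply: fine_ge0.
  rewrite KE muleC; apply: lee_wpmul2r; first by rewrite lee_fin.
  under eq_integral do rewrite EFinD -sumEFin.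
  have mq k : measurable_fun setT (fun w => ((N w <= k)%N%:R : R)%:E).
    by apply/measurable_EFinP; exact: (mN (fun j => (j <= k)%N%:R)).
  rewrite ge0_integralD//; last 3 first.
  - by move=> w _; apply: sume_ge0 => k _; rewrite lee_fin mulr_ge0.
  - apply: emeasurable_sum => k; under eq_fun do rewrite EFinM.
    exact: measurable_funeM.
  - by move=> w _; rewrite lee_fin ltW.
  rewrite ge0_integral_sum//; last 2 first.
  - by move=> k; under eq_fun do rewrite EFinM; exact: measurable_funeM.
  - by move=> k w _; rewrite lee_fin mulr_ge0.
  rewrite integral_cst// [X in _ + _ * X]probability_setT mule1 leeD2r//.
  apply: lee_sum => k _; under eq_integral do rewrite EFinM.
  by rewrite ge0_integralZl ?lee_fin// Ple.
- move=> v v_gt0; rewrite poisle Ple.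
  have a0 : (0 < v.+1%:R ^+ 2 / lambda)%R by rewrite divr_gt0// exprn_gt0.
  have li0 : (0 < lambda^-1)%R by rewrite invr_gt0.
  set p := \int[P]_w _.
  have p0 : 0 <= p by apply: integral_ge0 => w _; rewrite lee_fin.
  have [->|Kfin] := eqVneq K +oo.
    rewrite [X in _ * X]gt0_muley ?lte_fin// gt0_muley ?leey//.
    by apply: lt_le_trans (leeDl _ p0); rewrite lte_fin.
  have KE : K = (fine K)%:E by rewrite fineK// ge0_fin_numE// ltey.
  have kap0 : (0 <= fine K)%R by apply: fine_ge0.
  apply: le_trans (poisson_lower_set_bound lam_gt0 mN N_mean kap0 (keyK _ KE) v) _.
  rewrite [X in _ <= _ * (_ * X)]KE; under eq_integral do rewrite EFinD.
  have mq : measurable_fun setT (fun w => ((N w <= v)%N%:R : R)%:E).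
    by apply/measurable_EFinP; exact: (mN (fun j => (j <= v)%N%:R)).
  have pfin : p \is a fin_num by rewrite /p -Ple fin_num_measure.
  rewrite ge0_integralD//; last 3 first.
  - by move=> w _; rewrite lee_fin divr_ge0 ?exprn_ge0// ltW.
  - by move=> w _; rewrite lee_fin mulr_ge0// ltW.
  - by apply/measurable_EFinP; exact: (mN (fun j => lambda^-1 * (j <= v)%N%:R)%R).
  have -> : \int[P]_w (lambda^-1 * (N w <= v)%N%:R)%:E = (lambda^-1)%:E * p.
    under eq_integral do rewrite EFinM.
    by rewrite ge0_integralZl ?lee_fin ?(ltW li0).
  rewrite integral_cst// [X in _ * X + _]probability_setT mule1.
  rewrite -(fineK pfin).
  rewrite -[X in _ * (_ + X)]EFinM -[X in _ * X <= _]EFinD -[X in _ <= X * _]EFinD -!EFinM.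
  (* Both terms of [psi] contain the factor [lambda^-1]; extracting it gives the stated form. *)
  rewrite lee_fin le_eqVlt; apply/orP; left; apply/eqP.
  by field; rewrite gt_eqF.
Qed.
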